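(* Let $0<d<\pi/2$, $\mathscr{D}_d=\{\zeta\in\mathbb{C}:|\Im\zeta|<d\}$, $\mathscr{D}_d^{-}=\{\zeta\in\mathscr{D}_d:\Re\zeta<0\}$, $\mathscr{D}_d^{+}=\{\zeta\in\mathscr{D}_d:\Re\zeta\ge0\}$, and $\psi(t)=\sinh t$. Assume $f$ is analytic on $\psi(\mathscr{D}_d)$ and there are constants $K,\alpha,\beta>0$ with $|f(z)|\le K|1+z^2|^{-(\alpha+1)/2}$ for $z\in\psi(\mathscr{D}_d^-)$ and $|f(z)|\le K|1+z^2|^{-(\beta+1)/2}$ for $z\in\psi(\mathscr{D}_d^+)$. Let $\mu=\min\{\alpha,\beta\}$, $\nu=\max\{\alpha,\beta\}$, let $n$ be a positive integer, $h=\sqrt{\pi d/(\mu n)}$, and let $M=n$, $N=\lceil\alpha n/\beta\rceil$ if $\mu=\alpha$, and $N=n$, $M=\lceil\beta n/\alpha\rceil$ if $\mu=\beta$. Then \[ \sup_{\tau\in\mathbb{R}}\left|\int_{-\infty}^{\tau}f(t)\,dt-\sum_{k=-M}^{N}f(\psi(kh))\psi'(kh)J(k,h)(\psi^{-1}(\tau))\right|\le C_1e^{-\sqrt{\pi d\mu n}}, \] with $C_1=\frac{2^{\nu+1}K}{\mu}\left\{\frac{1}{(1-e^{-2\sqrt{\pi d\mu}})(\cos d)^{\nu}}\sqrt{\frac{\pi}{d\mu}}+1.1\right\}$.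
   Context: $J(k,h)(x)=h\left\{\frac12+\frac1\pi\operatorname{Si}[\pi(x/h-k)]\right\}$, where $\operatorname{Si}(x)=\int_0^x\frac{\sin\sigma}{\sigma}\,d\sigma$. $\psi^{-1}=\operatorname{arcsinh}$. *)

(* Defs.v *)
From Stdlib Require Import Reals ZArith.
From Coquelicot Require Import Coquelicot.
Open Scope R_scope.

Definition sinc (s : R) : R := if Req_EM_T s 0 then 1 else sin s / s.

Definition Si (x : R) : R := RInt sinc 0 x.

Definition J (k h x : R) : R := h * (/2 + / PI * Si (PI * (x / h - k))).

Definition csinh (z : C) : C := (sinh (Re z) * cos (Im z), cosh (Re z) * sin (Im z)).

Definition Cdiff (f : C -> C) (z : C) : Prop := @ex_derive C_AbsRing C_NormedModule f z.

(* sum_{k=-M}^{N} g k, for integers M,N with -M <= N *)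
Definition sum_Z (g : Z -> C) (M N : Z) : C :=
  @sum_n C_AbelianMonoid (fun i => g (Z.of_nat i - M)%Z) (Z.to_nat (N + M)).

(* Main.v *)
Require Import Defs.
From Stdlib Require Import Reals ZArith Lra Lia Psatz ClassicalEpsilon List.
From Coquelicot Require Import Coquelicot.
Open Scope R_scope.

(* Pull [f] back to [F z = f (sinh z) * cosh z], which is analytic on the strip, and let [om = PI / h].
   Residues of [F w / ((w - u) sin (om w))] on the rectangle of half-width [(L + 1/2) h] and half-height
   [t < d] express the error of cardinal interpolation at a real point [u] as a contour integral. Integrating it in
   [u] and exchanging the integrals leaves, on a horizontal side, the kernel [int sin (om u) / (w - u) du],
   which is at most [h / t] after an integration by parts; the vertical sides vanish as [L] grows. This
   yields the discretization error with a factor [2 / PI] to spare, which pays for [t < d]. The terms outside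
   [-M, N] are controlled by [|J| <= 1.1 h], that is by the maximum of the sine integral. *)

(** Goursat's theorem is proved for integrands that are merely continuous on the real axis. All
    poles lie on that axis, so subtracting [r / (w - p)] and filling in the value at [p] leaves an
    admissible integrand, and the residue theorem follows without a theorem on removable
    singularities. The half-integer width puts the vertical sides midway between zeros of the sine,
    where [|sin (om w)| >= 1]. The error is integrated from [a = - X / 2], with [X] the half-width:
    this point tends to minus infinity with [X] and yet stays [X / 2] away from the vertical side.
    The sum then yields [J] at the upper limit minus [J] at [a], and the part at [a] is of order
    [1 / X]: nodes left of [- X / 4] carry exponentially small values of [F], and for the others [J]
    is small at [a]. The two terms of [C1] differ by a power of [cos d]: the contour runs off the
    axis, where [|cosh|] is only known to exceed [cos d * exp |s| / 2], while the discarded terms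
    are values on the axis. The choice of [h] makes [PI * d / h] and [mu * n * h] both equal to the
    exponent of the theorem. *)

(** * Complex differentiability *)

Section Cont.
Context {U : UniformSpace}.
Implicit Types (f g : U -> C) (x : U).

Lemma continuous_pair (f g : U -> R) (x : U) :
  continuous f x -> continuous g x ->
  @continuous U C_UniformSpace (fun y => (f y, g y)) x.
Proof.
intros Hf Hg P [eps HP].
assert (A : locally x (fun y => ball (f x) eps (f y))) by exact (Hf _ (locally_ball (f x) eps)).
assert (B : locally x (fun y => ball (g x) eps (g y))) by exact (Hg _ (locally_ball (g x) eps)).
change (locally x (fun y => P (f y, g y))). generalize (filter_and _ _ A B).
apply filter_imp; intros y [H1 H2]. apply HP; split; assumption.
Qed.

Lemma continuous_Re f x : continuous f x -> continuous (fun y => Re (f y)) x.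
Proof.
intros H. exact (continuous_comp f fst x H (@continuous_fst R_UniformSpace R_UniformSpace (fst (f x)) (snd (f x)))).
Qed.

Lemma continuous_Im f x : continuous f x -> continuous (fun y => Im (f y)) x.
Proof.
intros H. exact (continuous_comp f snd x H (@continuous_snd R_UniformSpace R_UniformSpace (fst (f x)) (snd (f x)))).
Qed.

Lemma continuous_Cplus f g x : continuous f x -> continuous g x ->
  @continuous U C_UniformSpace (fun y => (f y + g y)%C) x.
Proof.
intros Hf Hg. apply continuous_pair.
- exact (continuous_plus (V:=R_NormedModule) _ _ x (continuous_Re f x Hf) (continuous_Re g x Hg)).
- exact (continuous_plus (V:=R_NormedModule) _ _ x (continuous_Im f x Hf) (continuous_Im g x Hg)).
Qed.

Lemma continuous_Copp f x : continuous f x ->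
  @continuous U C_UniformSpace (fun y => (- f y)%C) x.
Proof.
intros Hf. apply continuous_pair.
- exact (continuous_opp (V:=R_NormedModule) _ x (continuous_Re f x Hf)).
- exact (continuous_opp (V:=R_NormedModule) _ x (continuous_Im f x Hf)).
Qed.

Lemma continuous_Cmult f g x : continuous f x -> continuous g x ->
  @continuous U C_UniformSpace (fun y => (f y * g y)%C) x.
Proof.
intros Hf Hg.
assert (a := continuous_Re f x Hf). assert (b := continuous_Im f x Hf).
assert (c := continuous_Re g x Hg). assert (d := continuous_Im g x Hg).
apply continuous_pair.
- exact (continuous_minus (V:=R_NormedModule) _ _ x
    (continuous_mult (K:=R_AbsRing) _ _ x a c) (continuous_mult (K:=R_AbsRing) _ _ x b d)).
- exact (continuous_plus (V:=R_NormedModule) _ _ x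
    (continuous_mult (K:=R_AbsRing) _ _ x a d) (continuous_mult (K:=R_AbsRing) _ _ x b c)).
Qed.

Lemma continuous_Cinv f x : continuous f x -> f x <> 0 ->
  @continuous U C_UniformSpace (fun y => (/ f y)%C) x.
Proof.
intros Hf Hn.
assert (a := continuous_Re f x Hf). assert (b := continuous_Im f x Hf).
assert (Hd : continuous (fun y => / (Re (f y) ^ 2 + Im (f y) ^ 2)) x).
{ apply (continuous_comp (fun y => Re (f y) ^ 2 + Im (f y) ^ 2) Rinv).
  - apply (continuous_ext (fun y => Re (f y) * Re (f y) + Im (f y) * Im (f y))).
    { intros y; change (@eq R (Re (f y) * Re (f y) + Im (f y) * Im (f y)) (Re (f y) ^ 2 + Im (f y) ^ 2)); ring. }
    exact (continuous_plus (V:=R_NormedModule) _ _ x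
     (continuous_mult (K:=R_AbsRing) _ _ x a a) (continuous_mult (K:=R_AbsRing) _ _ x b b)).
  - apply continuous_Rinv. intros H0. apply Hn.
    apply Cmod_eq_0. unfold Cmod. fold (Re (f x)) (Im (f x)). rewrite H0. apply sqrt_0. }
apply continuous_pair.
- exact (continuous_mult (K:=R_AbsRing) _ _ x a Hd).
- exact (continuous_mult (K:=R_AbsRing) _ _ x
    (continuous_opp (V:=R_NormedModule) _ x b) Hd).
Qed.
End Cont.

Lemma Re_Im_le_Cmod (z : C) : Rabs (Re z) <= Cmod z /\ Rabs (Im z) <= Cmod z.
Proof.
generalize (Rmax_Cmod z); unfold Re, Im; intros H.
split; eapply Rle_trans; try apply H; [apply Rmax_l|apply Rmax_r].
Qed.

Lemma Cmod_le_Rabs (z : C) : Cmod z <= Rabs (Re z) + Rabs (Im z).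
Proof.
unfold Cmod, Re, Im. destruct z as [x y]; simpl fst; simpl snd.
rewrite <- (sqrt_pow2 (Rabs x + Rabs y)).
- apply sqrt_le_1_alt. rewrite <- (pow2_abs x), <- (pow2_abs y).
  generalize (Rabs_pos x) (Rabs_pos y); nra.
- generalize (Rabs_pos x) (Rabs_pos y); lra.
Qed.

(** The uniform structure of [C] is that of a product, so its balls are squares. Arguments are kept
    in squares and values are measured by [Cmod], which is at most the sum of the two coordinates;
    hence the [eps / 2] in the proof. *)
Lemma continuous_C_eps (f : C -> C) (z : C) :
  (forall eps : R, 0 < eps -> exists delta : R, 0 < delta /\
     forall w : C, Rabs (Re w - Re z) < delta -> Rabs (Im w - Im z) < delta ->
       Cmod (f w - f z) < eps) <->
  @continuous C_UniformSpace C_UniformSpace f z.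
Proof.
split.
- intros H P [eps HP]. destruct (H eps (cond_pos eps)) as [d [Hd HH]].
  exists (mkposreal d Hd). intros w [H1 H2]. apply HP.
  specialize (HH w H1 H2). destruct (Re_Im_le_Cmod (f w - f z)) as [A B].
  split.
  + eapply Rle_lt_trans; [apply A|apply HH].
  + eapply Rle_lt_trans; [apply B|apply HH].
- intros H eps Heps.
  assert (He2 : 0 < eps / 2) by lra.
  destruct (H _ (locally_ball (f z) (mkposreal _ He2))) as [d Hd].
  exists d; split; [apply cond_pos|]. intros w H1 H2.
  destruct (Hd w (conj H1 H2)) as [A B].
  eapply Rle_lt_trans; [apply Cmod_le_Rabs|].
  change (Rabs (Re (f w) - Re (f z)) < eps / 2) in A.
  change (Rabs (Im (f w) - Im (f z)) < eps / 2) in B.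
  change (Rabs (Re (f w) - Re (f z)) + Rabs (Im (f w) - Im (f z)) < eps). lra.
Qed.

(* Caratheodory's form of complex differentiability. *)
Definition cdiff (f : C -> C) (z : C) : Prop :=
  exists phi : C -> C, @continuous C_UniformSpace C_UniformSpace phi z /\
    exists delta : R, 0 < delta /\ forall w : C,
      Rabs (Re w - Re z) < delta -> Rabs (Im w - Im z) < delta ->
      (f w = f z + phi w * (w - z))%C.

Lemma cdiff_continuous (f : C -> C) (z : C) : cdiff f z ->
  @continuous C_UniformSpace C_UniformSpace f z.
Proof.
intros [phi [Hphi [d [Hd H]]]].
apply continuous_ext_loc with (fun w => (f z + phi w * (w - z))%C).
- exists (mkposreal d Hd). intros w [H1 H2]. symmetry. apply H; assumption.
- apply continuous_Cplus; [apply continuous_const|].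
  apply continuous_Cmult; [exact Hphi|].
  apply continuous_Cplus; [apply continuous_id|apply continuous_const].
Qed.

Lemma cdiff_ext_loc (f g : C -> C) (z : C) (d : R) : 0 < d ->
  (forall w, Rabs (Re w - Re z) < d -> Rabs (Im w - Im z) < d -> f w = g w) ->
  cdiff f z -> cdiff g z.
Proof.
intros Hd He [phi [Hp [e [He' H]]]]. exists phi; split; [exact Hp|].
exists (Rmin d e); split; [apply Rmin_pos; assumption|].
intros w H1 H2.
rewrite <- (He w), <- (He z).
- apply H; eapply Rlt_le_trans; try eassumption; apply Rmin_r.
- rewrite Rminus_diag, Rabs_R0; assumption.
- rewrite Rminus_diag, Rabs_R0; assumption.
- eapply Rlt_le_trans; [eassumption|apply Rmin_l].
- eapply Rlt_le_trans; [eassumption|apply Rmin_l].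
Qed.

Lemma cdiff_const (c z : C) : cdiff (fun _ => c) z.
Proof.
exists (fun _ => 0); split; [apply continuous_const|].
exists 1; split; [lra|]; intros; ring.
Qed.

Lemma cdiff_id (z : C) : cdiff (fun w => w) z.
Proof.
exists (fun _ => 1); split; [apply continuous_const|].
exists 1; split; [lra|]; intros; ring.
Qed.

Lemma cdiff_plus (f g : C -> C) (z : C) : cdiff f z -> cdiff g z ->
  cdiff (fun w => f w + g w)%C z.
Proof.
intros [p [Hp [d [Hd H]]]] [q [Hq [e [He H']]]].
exists (fun w => p w + q w)%C; split; [apply continuous_Cplus; assumption|].
exists (Rmin d e); split; [apply Rmin_pos; assumption|].
intros w H1 H2. rewrite (H w), (H' w); try ring;
eapply Rlt_le_trans; try eassumption; (apply Rmin_r || apply Rmin_l).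
Qed.

Lemma cdiff_mult (f g : C -> C) (z : C) : cdiff f z -> cdiff g z ->
  cdiff (fun w => f w * g w)%C z.
Proof.
intros Hf0 [q [Hq [e [He H']]]]. generalize (cdiff_continuous _ _ Hf0); intros Hf.
destruct Hf0 as [p [Hp [d [Hd H]]]].
(* From [f w * g w - f z * g z = (f w - f z) * g z + f w * (g w - g z)]; this slope is continuous
   because [f] is. *)
exists (fun w => g z * p w + f w * q w)%C; split.
{ apply continuous_Cplus; apply continuous_Cmult; try assumption; apply continuous_const. }
exists (Rmin d e); split; [apply Rmin_pos; assumption|].
intros w H1 H2. rewrite (H w), (H' w); try ring;
eapply Rlt_le_trans; try eassumption; (apply Rmin_r || apply Rmin_l).
Qed.

Lemma cdiff_scal (c : C) (f : C -> C) (z : C) : cdiff f z -> cdiff (fun w => c * f w)%C z.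
Proof. intros H; apply cdiff_mult; [apply cdiff_const|exact H]. Qed.

Lemma cdiff_minus (f g : C -> C) (z : C) : cdiff f z -> cdiff g z ->
  cdiff (fun w => f w - g w)%C z.
Proof.
intros Hf Hg.
apply cdiff_ext_loc with (fun w => f w + (-(1)) * g w)%C 1; [lra|intros; ring|].
apply cdiff_plus; [assumption|apply cdiff_scal; assumption].
Qed.

Lemma cdiff_comp (f g : C -> C) (z : C) : cdiff f (g z) -> cdiff g z ->
  cdiff (fun w => f (g w)) z.
Proof.
intros [p [Hp [d [Hd H]]]] Hg0. generalize (cdiff_continuous _ _ Hg0); intros Hg.
destruct Hg0 as [q [Hq [e [He H']]]].
exists (fun w => p (g w) * q w)%C; split.
{ apply continuous_Cmult; [|assumption]. apply continuous_comp; assumption. }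
destruct (Hg _ (locally_ball (g z) (mkposreal d Hd))) as [e' Hge].
exists (Rmin e e'); split; [apply Rmin_pos; [assumption|apply cond_pos]|].
intros w H1 H2.
assert (H1' := Rlt_le_trans _ _ _ H1 (Rmin_r _ _)).
assert (H2' := Rlt_le_trans _ _ _ H2 (Rmin_r _ _)).
destruct (Hge w (conj H1' H2')) as [A B].
rewrite (H (g w) A B).
assert (E := H' w (Rlt_le_trans _ _ _ H1 (Rmin_l _ _)) (Rlt_le_trans _ _ _ H2 (Rmin_l _ _))).
set (u := p (g w)). rewrite E. ring.
Qed.

Lemma cdiff_inv (f : C -> C) (z : C) : cdiff f z -> f z <> 0 -> cdiff (fun w => / f w)%C z.
Proof.
intros Hf Hn. apply (cdiff_comp Cinv f); [|exact Hf].
set (p := f z) in *.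
exists (fun w => - (/ w * / p))%C; split.
{ apply continuous_Copp, continuous_Cmult; [|apply continuous_const].
  apply (continuous_Cinv (fun w => w)); [apply continuous_id|exact Hn]. }
assert (Hp : 0 < Cmod p) by (apply Cmod_gt_0; exact Hn).
(* On this square [w] cannot be 0, since otherwise [|Re p| + |Im p| < Cmod p]. *)
exists (Cmod p / 2); split; [lra|].
intros w H1 H2.
assert (Hw : w <> 0).
{ intros ->. unfold Re, Im in *; simpl in H1, H2.
  generalize (Cmod_le_Rabs p); unfold Re, Im.
  rewrite Rminus_0_l, Rabs_Ropp in H1, H2. lra. }
field. split; assumption.
Qed.

(** The slope is the difference quotient, completed by the derivative at [z]. The hypothesis is
    phrased with discs of [Cmod], the conclusion with squares; the square of half-side [d / 2] lies
    in the disc of radius [d]. *)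
Lemma Cdiff_cdiff (f : C -> C) (z : C) : Cdiff f z -> cdiff f z.
Proof.
intros [l [Hl Hd]].
exists (fun w => if excluded_middle_informative (w = z) then l else ((f w - f z) / (w - z))%C).
split.
2:{ exists 1; split; [lra|]. intros w _ _.
  destruct (excluded_middle_informative (w = z)) as [->|Hw]; [ring|].
  field. intros H; apply Hw. rewrite <- (Cplus_0_r z), <- H; ring. }
apply continuous_C_eps. intros eps Heps.
assert (He2 : 0 < eps / 2) by lra.
destruct (Hd z (fun P H => H) (mkposreal _ He2)) as [d Hdd].
exists (d / 2); split; [generalize (cond_pos d); lra|].
intros w H1 H2.
destruct (excluded_middle_informative (z = z)) as [_|Hw]; [|congruence].
destruct (excluded_middle_informative (w = z)) as [->|Hw].
{ replace (l - l)%C with (RtoC 0) by ring. rewrite Cmod_0; lra. }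
assert (Hn : (w - z)%C <> 0). { intros H; apply Hw. rewrite <- (Cplus_0_r z), <- H; ring. }
assert (Hp := proj1 (Cmod_gt_0 _) Hn).
assert (HB : @ball (AbsRing_UniformSpace C_AbsRing) z d w).
{ change (Cmod (w - z) < d). eapply Rle_lt_trans; [apply Cmod_le_Rabs|].
  change (Rabs (Re w - Re z) + Rabs (Im w - Im z) < d). lra. }
specialize (Hdd w HB).
change (Cmod (f w - f z - (w - z) * l) <= eps / 2 * Cmod (w - z)) in Hdd.
replace ((f w - f z) / (w - z) - l)%C with ((f w - f z - (w - z) * l) / (w - z))%C by (field; exact Hn).
rewrite Cmod_div by exact Hn.
apply Rmult_lt_reg_r with (Cmod (w - z)); [exact Hp|].
unfold Rdiv at 1. rewrite Rmult_assoc, Rinv_l by lra. nra.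
Qed.

(** * Rectangle contours and Goursat's theorem *)

Definition CI (g : R -> C) (a b : R) : C := @RInt C_R_CompleteNormedModule g a b.
Notation exC := (@ex_RInt C_R_NormedModule).

Lemma exC_continuous (g : R -> C) (a b : R) : a <= b ->
  (forall x, a <= x <= b -> @continuous R_UniformSpace C_UniformSpace g x) -> exC g a b.
Proof.
intros Hab H. apply (ex_RInt_continuous (V:=C_R_CompleteNormedModule)).
rewrite Rmin_left, Rmax_right by exact Hab. exact H.
Qed.

Lemma is_CI (g : R -> C) (a b : R) : exC g a b -> @is_RInt C_R_NormedModule g a b (CI g a b).
Proof. exact (RInt_correct (V:=C_R_CompleteNormedModule) g a b). Qed.

Lemma CI_unique (g : R -> C) (a b : R) (l : C) : @is_RInt C_R_NormedModule g a b l -> CI g a b = l.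
Proof. exact (is_RInt_unique (V:=C_R_CompleteNormedModule) g a b l). Qed.

Lemma is_CI_parts (g : R -> C) (a b : R) (l : C) :
  is_RInt (fun t => Re (g t)) a b (Re l) -> is_RInt (fun t => Im (g t)) a b (Im l) ->
  @is_RInt C_R_NormedModule g a b l.
Proof.
intros H1 H2. rewrite (surjective_pairing l).
exact (is_RInt_fct_extend_pair (U:=R_NormedModule) (V:=R_NormedModule) g a b _ _ H1 H2).
Qed.

Lemma is_CI_Re (g : R -> C) (a b : R) (l : C) :
  @is_RInt C_R_NormedModule g a b l -> is_RInt (fun t => Re (g t)) a b (Re l).
Proof. exact (is_RInt_fct_extend_fst (U:=R_NormedModule) (V:=R_NormedModule) g a b l). Qed.

Lemma is_CI_Im (g : R -> C) (a b : R) (l : C) :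
  @is_RInt C_R_NormedModule g a b l -> is_RInt (fun t => Im (g t)) a b (Im l).
Proof. exact (is_RInt_fct_extend_snd (U:=R_NormedModule) (V:=R_NormedModule) g a b l). Qed.

Lemma is_CI_scal (g : R -> C) (a b : R) (c l : C) : @is_RInt C_R_NormedModule g a b l ->
  @is_RInt C_R_NormedModule (fun t => c * g t)%C a b (c * l)%C.
Proof.
intros H. assert (H1 := is_CI_Re _ _ _ _ H). assert (H2 := is_CI_Im _ _ _ _ H).
apply is_CI_parts.
- exact (is_RInt_minus _ _ _ _ _ _ (is_RInt_scal _ _ _ (Re c) _ H1) (is_RInt_scal _ _ _ (Im c) _ H2)).
- exact (is_RInt_plus _ _ _ _ _ _ (is_RInt_scal _ _ _ (Re c) _ H2) (is_RInt_scal _ _ _ (Im c) _ H1)).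
Qed.

Lemma exC_scal (g : R -> C) (a b : R) (c : C) : exC g a b -> exC (fun t => c * g t)%C a b.
Proof. intros H; exists (c * CI g a b)%C. apply is_CI_scal, is_CI, H. Qed.

Lemma CI_scal (g : R -> C) (a b : R) (c : C) : exC g a b ->
  CI (fun t => c * g t)%C a b = (c * CI g a b)%C.
Proof. intros H. apply CI_unique, is_CI_scal, is_CI, H. Qed.

Lemma exC_minus (f g : R -> C) (a b : R) : exC f a b -> exC g a b -> exC (fun t => f t - g t)%C a b.
Proof. exact (ex_RInt_minus (V:=C_R_NormedModule) f g a b). Qed.

Lemma CI_minus (f g : R -> C) (a b : R) : exC f a b -> exC g a b ->
  CI (fun t => f t - g t)%C a b = (CI f a b - CI g a b)%C.
Proof. exact (RInt_minus (V:=C_R_CompleteNormedModule) f g a b). Qed.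

Lemma CI_plus (f g : R -> C) (a b : R) : exC f a b -> exC g a b ->
  CI (fun t => f t + g t)%C a b = (CI f a b + CI g a b)%C.
Proof. exact (RInt_plus (V:=C_R_CompleteNormedModule) f g a b). Qed.

Lemma CI_const (k : C) (a b : R) : CI (fun _ => k) a b = (RtoC (b - a) * k)%C.
Proof.
unfold CI; rewrite RInt_const. change (((b-a) * fst k, (b-a) * snd k) = (RtoC (b - a) * k)%C).
destruct k; unfold Cmult, RtoC; simpl; f_equal; ring.
Qed.

Lemma CI_ext (f g : R -> C) (a b : R) : a <= b ->
  (forall x, a <= x <= b -> f x = g x) -> CI f a b = CI g a b.
Proof.
intros Hab H. apply (RInt_ext (V:=C_R_CompleteNormedModule)).
rewrite Rmin_left, Rmax_right by exact Hab. intros x Hx; apply H; lra.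
Qed.

Lemma CI_Chasles (g : R -> C) (a b c : R) : exC g a b -> exC g b c ->
  CI g a c = (CI g a b + CI g b c)%C.
Proof.
intros H1 H2; symmetry. exact (RInt_Chasles (V:=C_R_CompleteNormedModule) g a b c H1 H2).
Qed.

Lemma CI_norm (g : R -> C) (B : R -> R) (a b : R) : a <= b -> exC g a b -> ex_RInt B a b ->
  (forall x, a <= x <= b -> Cmod (g x) <= B x) -> Cmod (CI g a b) <= RInt B a b.
Proof.
intros Hab Hg HB H. rewrite Cmod_norm.
apply (norm_RInt_le (V:=C_R_NormedModule) g B a b (CI g a b) (RInt B a b) Hab).
- intros x Hx. rewrite <- Cmod_norm. apply H, Hx.
- apply is_CI, Hg.
- apply (RInt_correct (V:=R_CompleteNormedModule)), HB.
Qed.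

Lemma CI_norm_const (g : R -> C) (M a b : R) : a <= b -> exC g a b ->
  (forall x, a <= x <= b -> Cmod (g x) <= M) -> Cmod (CI g a b) <= (b - a) * M.
Proof.
intros Hab Hg H.
replace ((b - a) * M) with (RInt (fun _ => M) a b).
- apply CI_norm; try assumption. apply ex_RInt_const.
- rewrite RInt_const. reflexivity.
Qed.

(** The boundary of [[a, b] x [c, d]] run counterclockwise: bottom minus top, and [dz = i dy] on the
    right and left sides. *)
Definition contour (g : C -> C) (a b c d : R) : C :=
  (CI (fun x => g (x, c)) a b - CI (fun x => g (x, d)) a b
   + Ci * (CI (fun y => g (b, y)) c d - CI (fun y => g (a, y)) c d))%C.

Lemma continuous_hor (g : C -> C) (x y : R) :
  @continuous C_UniformSpace C_UniformSpace g (x, y) ->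
  @continuous R_UniformSpace C_UniformSpace (fun t => g (t, y)) x.
Proof.
intros H. apply (continuous_comp (V:=C_UniformSpace) (fun t => (t, y)) g); [|exact H].
apply continuous_pair; [apply continuous_id|apply continuous_const].
Qed.

Lemma continuous_ver (g : C -> C) (x y : R) :
  @continuous C_UniformSpace C_UniformSpace g (x, y) ->
  @continuous R_UniformSpace C_UniformSpace (fun t => g (x, t)) y.
Proof.
intros H. apply (continuous_comp (V:=C_UniformSpace) (fun t => (x, t)) g); [|exact H].
apply continuous_pair; [apply continuous_const|apply continuous_id].
Qed.

Definition rcont (g : C -> C) (a b c d : R) :=
  forall x y, a <= x <= b -> c <= y <= d -> @continuous C_UniformSpace C_UniformSpace g (x, y).

Lemma exC_hor (g : C -> C) (a b c d y : R) : a <= b -> c <= y <= d -> rcont g a b c d -> exC (fun x => g (x, y)) a b.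
Proof.
intros Hab Hy H. apply exC_continuous; [exact Hab|].
intros x Hx. apply continuous_hor, H; assumption.
Qed.

Lemma exC_ver (g : C -> C) (a b c d x : R) : c <= d -> a <= x <= b -> rcont g a b c d -> exC (fun y => g (x, y)) c d.
Proof.
intros Hcd Hx H. apply exC_continuous; [exact Hcd|].
intros y Hy. apply continuous_ver, H; assumption.
Qed.

Lemma rcont_sub (g : C -> C) (a b c d a' b' c' d' : R) : a <= a' -> b' <= b -> c <= c' -> d' <= d ->
  rcont g a b c d -> rcont g a' b' c' d'.
Proof. intros H1 H2 H3 H4 H x y Hx Hy; apply H; lra. Qed.

(** Each inner segment is run twice, in opposite directions, and cancels. *)
Lemma contour_split4 (g : C -> C) (a m b c n d : R) : a <= m <= b -> c <= n <= d ->
  rcont g a b c d ->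
  contour g a b c d = (contour g a m c n + contour g m b c n
                       + contour g a m n d + contour g m b n d)%C.
Proof.
intros Hm Hn H. unfold contour.
assert (E1 : forall y p q, c <= y <= d -> a <= p -> p <= q -> q <= b -> exC (fun x => g (x, y)) p q).
{ intros y p q Hy H1 H2 H3. apply (exC_hor g p q c d); try assumption.
  apply (rcont_sub g a b c d); lra || exact H. }
assert (E2 : forall x p q, a <= x <= b -> c <= p -> p <= q -> q <= d -> exC (fun y => g (x, y)) p q).
{ intros x p q Hx H1 H2 H3. apply (exC_ver g a b p q); try assumption.
  apply (rcont_sub g a b c d); lra || exact H. }
rewrite (CI_Chasles (fun x => g (x, c)) a m b), (CI_Chasles (fun x => g (x, d)) a m b),
  (CI_Chasles (fun y => g (b, y)) c n d), (CI_Chasles (fun y => g (a, y)) c n d);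
  [ring|apply E2; lra|apply E2; lra|apply E2; lra|apply E2; lra
  |apply E1; lra|apply E1; lra|apply E1; lra|apply E1; lra].
Qed.

Lemma contour_minus (f g : C -> C) (a b c d : R) : a <= b -> c <= d ->
  rcont f a b c d -> rcont g a b c d ->
  contour (fun z => f z - g z)%C a b c d = (contour f a b c d - contour g a b c d)%C.
Proof.
intros Hab Hcd Hf Hg. unfold contour.
rewrite !CI_minus; [ring|..];
  (apply (exC_hor _ a b c d) || apply (exC_ver _ a b c d)); assumption || lra.
Qed.

(** An affine function differs by a constant between opposite sides, so both pairs of sides reduce
    to integrals of constants, which cancel. *)
Lemma contour_affine (k l : C) (a b c d : R) : a <= b -> c <= d ->
  contour (fun z => k + l * z)%C a b c d = 0.
Proof.
intros Hab Hcd.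
assert (H : rcont (fun z => k + l * z)%C a b c d).
{ intros x y _ _. apply continuous_Cplus; [apply continuous_const|].
  apply continuous_Cmult; [apply continuous_const|apply continuous_id]. }
unfold contour.
assert (E1 : forall y, c <= y <= d -> exC (fun x => k + l * (x, y))%C a b).
{ intros y Hy. exact (exC_hor _ a b c d y Hab Hy H). }
assert (E2 : forall x, a <= x <= b -> exC (fun y => k + l * (x, y))%C c d).
{ intros x Hx. exact (exC_ver _ a b c d x Hcd Hx H). }
rewrite <- (CI_minus (fun x => k + l * (x, c))%C (fun x => k + l * (x, d))%C) by (apply E1; lra).
rewrite <- (CI_minus (fun y => k + l * (b, y))%C (fun y => k + l * (a, y))%C) by (apply E2; lra).
rewrite (CI_ext _ (fun _ => l * (Ci * RtoC (c - d)))%C a b), (CI_ext _ (fun _ => l * RtoC (b - a))%C c d), !CI_const; try assumption.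
- apply injective_projections; simpl; ring.
- intros x _. apply injective_projections; simpl; ring.
- intros x _. apply injective_projections; simpl; ring.
Qed.

Lemma contour_norm (g : C -> C) (M a b c d : R) : a <= b -> c <= d -> rcont g a b c d ->
  (forall x y, a <= x <= b -> c <= y <= d -> Cmod (g (x, y)) <= M) ->
  Cmod (contour g a b c d) <= 2 * M * ((b - a) + (d - c)).
Proof.
intros Hab Hcd Hg HM. unfold contour.
eapply Rle_trans; [apply Cmod_triangle|].
rewrite Cmod_mult, Cmod_Ci, Rmult_1_l.
assert (T : forall u v, Cmod (u - v) <= Cmod u + Cmod v).
{ intros u v. unfold Cminus. rewrite <- (Cmod_opp v). apply Cmod_triangle. }
assert (T1 := T (CI (fun x => g (x, c)) a b) (CI (fun x => g (x, d)) a b)).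
assert (T2 := T (CI (fun y => g (b, y)) c d) (CI (fun y => g (a, y)) c d)).
assert (X1 := CI_norm_const (fun x => g (x, c)) M a b Hab (exC_hor g a b c d c Hab ltac:(lra) Hg)
   ltac:(intros; apply HM; lra)).
assert (X2 := CI_norm_const (fun x => g (x, d)) M a b Hab (exC_hor g a b c d d Hab ltac:(lra) Hg)
   ltac:(intros; apply HM; lra)).
assert (X3 := CI_norm_const (fun y => g (b, y)) M c d Hcd (exC_ver g a b c d b Hcd ltac:(lra) Hg)
   ltac:(intros; apply HM; lra)).
assert (X4 := CI_norm_const (fun y => g (a, y)) M c d Hcd (exC_ver g a b c d a Hcd ltac:(lra) Hg)
   ltac:(intros; apply HM; lra)).
lra.
Qed.

(** The affine part integrates to 0, so only the deviation from it is multiplied by the perimeter.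
    Goursat's theorem uses this with a tangent off the real axis and with a constant on it. *)
Lemma contour_near_affine (g : C -> C) (k l : C) (M a b c d : R) : a <= b -> c <= d -> rcont g a b c d ->
  (forall x y, a <= x <= b -> c <= y <= d -> Cmod (g (x, y) - (k + l * (x, y))) <= M) ->
  Cmod (contour g a b c d) <= 2 * M * ((b - a) + (d - c)).
Proof.
intros Hab Hcd Hg HM.
assert (H : rcont (fun z => k + l * z)%C a b c d).
{ intros x y _ _. apply continuous_Cplus; [apply continuous_const|].
  apply continuous_Cmult; [apply continuous_const|apply continuous_id]. }
replace (contour g a b c d) with (contour (fun z => g z - (k + l * z))%C a b c d).
- apply contour_norm; try assumption.
  intros x y Hx Hy. apply continuous_Cplus; [apply Hg; assumption|].
  apply continuous_Copp, H; assumption.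
- rewrite contour_minus by assumption. rewrite contour_affine by assumption. ring.
Qed.

Lemma nested_intervals (a e : nat -> R) :
  (forall n, a n <= a (S n)) -> (forall n, e (S n) <= e n) -> (forall n, a n <= e n) ->
  exists x, forall n, a n <= x <= e n.
Proof.
intros Ha He Hae.
assert (Ha' : forall n m, a n <= a (n + m)%nat).
{ intros n m; induction m; [rewrite Nat.add_0_r; lra|].
  rewrite Nat.add_succ_r. generalize (Ha (n + m)%nat); lra. }
assert (He' : forall n m, e (n + m)%nat <= e n).
{ intros n m; induction m; [rewrite Nat.add_0_r; lra|].
  rewrite Nat.add_succ_r. generalize (He (n + m)%nat); lra. }
assert (Hm : forall n m, a n <= e m).
{ intros n m. generalize (Ha' n m) (He' m n) (Hae (n + m)%nat). rewrite (Nat.add_comm m n). lra. }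
destruct (completeness (fun r => exists n, r = a n)) as [x [Hx1 Hx2]].
- exists (e O). intros r [n ->]. apply Hm.
- exists (a O), O; reflexivity.
- exists x. intros n; split; [apply Hx1; exists n; reflexivity|].
  apply Hx2. intros r [m ->]. apply Hm.
Qed.

(** [P x y s] speaks of the rectangle with lower left corner [(x, y)] and sides [s * w], [s * v]. If
    [P] passes from four quarters to the whole, a failure at scale 1 propagates to ever smaller
    quarters; these shrink to a point [(p, q)], around which [P] holds at all small scales. *)
Lemma rect_bisection (P : R -> R -> R -> Prop) (a c w v : R) : 0 < w -> 0 < v ->
  (forall x y s, 0 < s -> a <= x -> x + s * w <= a + w -> c <= y -> y + s * v <= c + v ->
     P x y (s / 2) -> P (x + s / 2 * w) y (s / 2) ->
     P x (y + s / 2 * v) (s / 2) -> P (x + s / 2 * w) (y + s / 2 * v) (s / 2) -> P x y s) ->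
  (forall p q, a <= p <= a + w -> c <= q <= c + v -> exists delta, 0 < delta /\
     forall x y s, 0 < s < delta -> a <= x <= p -> p <= x + s * w <= a + w ->
       c <= y <= q -> q <= y + s * v <= c + v -> P x y s) ->
  P a c 1.
Proof.
intros Hw Hv Hadd Hloc.
destruct (excluded_middle_informative (P a c 1)) as [Y|Hbad]; [exact Y|exfalso].
(* Selects a quarter where [P] fails. The upper right one is not tested: when the other three
   satisfy [P], it must fail by [Hadd]. *)
pose (step := fun (z : R * R) (s : R) =>
  let t := s / 2 in
  if excluded_middle_informative (P (fst z) (snd z) t) then
  if excluded_middle_informative (P (fst z + t * w) (snd z) t) then
  if excluded_middle_informative (P (fst z) (snd z + t * v) t) then
    (fst z + t * w, snd z + t * v)
  else (fst z, snd z + t * v) else (fst z + t * w, snd z) else z).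
pose (z := fix z n := match n with O => (a, c) | S n => step (z n) (/ 2 ^ n) end).
assert (Hs : forall n, 0 < / 2 ^ n) by (intros n; apply Rinv_0_lt_compat, pow_lt; lra).
assert (Hhalf : forall n, / 2 ^ S n = / 2 ^ n / 2).
{ intros n; simpl; field. apply pow_nonzero; lra. }
assert (Hstep : forall n,
  ~ P (fst (z n)) (snd (z n)) (/ 2 ^ n) /\
  a <= fst (z n) /\ fst (z n) + / 2 ^ n * w <= a + w /\
  c <= snd (z n) /\ snd (z n) + / 2 ^ n * v <= c + v ->
  ~ P (fst (z (S n))) (snd (z (S n))) (/ 2 ^ S n) /\
  fst (z n) <= fst (z (S n)) /\ fst (z (S n)) + / 2 ^ S n * w <= fst (z n) + / 2 ^ n * w /\
  snd (z n) <= snd (z (S n)) /\ snd (z (S n)) + / 2 ^ S n * v <= snd (z n) + / 2 ^ n * v).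
{ intros n (H0 & H1 & H2 & H3 & H4). simpl z. unfold step. fold z. rewrite Hhalf.
  assert (Hsn := Hs n). set (s := / 2 ^ n) in *.
  assert (0 < s * w) by (apply Rmult_lt_0_compat; assumption).
  assert (0 < s * v) by (apply Rmult_lt_0_compat; assumption).
  specialize (Hadd _ _ _ Hsn H1 H2 H3 H4).
  cbv zeta.
  repeat match goal with |- context [excluded_middle_informative ?A] =>
    destruct (excluded_middle_informative A) end; simpl fst; simpl snd;
  (split; [tauto|lra]). }
assert (Hall : forall n,
  ~ P (fst (z n)) (snd (z n)) (/ 2 ^ n) /\
  a <= fst (z n) /\ fst (z n) + / 2 ^ n * w <= a + w /\
  c <= snd (z n) /\ snd (z n) + / 2 ^ n * v <= c + v).
{ induction n.
  - simpl. rewrite Rinv_1. split; [exact Hbad|lra].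
  - generalize (Hstep n IHn). destruct IHn as [_ IH]. intros [H1 H2]; split; [exact H1|lra]. }
assert (Hpos : forall n r, 0 < r -> 0 < / 2 ^ n * r).
{ intros n r Hr; apply Rmult_lt_0_compat; auto. }
destruct (nested_intervals (fun n => fst (z n)) (fun n => fst (z n) + / 2 ^ n * w)) as [p Hp].
{ intros n; apply (Hstep n (Hall n)). }
{ intros n; apply (Hstep n (Hall n)). }
{ intros n; generalize (Hpos n w Hw); simpl; lra. }
destruct (nested_intervals (fun n => snd (z n)) (fun n => snd (z n) + / 2 ^ n * v)) as [q Hq].
{ intros n; apply (Hstep n (Hall n)). }
{ intros n; apply (Hstep n (Hall n)). }
{ intros n; generalize (Hpos n v Hv); simpl; lra. }
destruct (Hloc p q) as [delta [Hd H]].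
{ generalize (Hp O); simpl; rewrite Rinv_1; lra. }
{ generalize (Hq O); simpl; rewrite Rinv_1; lra. }
destruct (pow_lt_1_zero (/ 2) ltac:(rewrite Rabs_pos_eq; lra) delta Hd) as [N HN].
specialize (HN N (Nat.le_refl N)). rewrite pow_inv, Rabs_pos_eq in HN by lra || (apply Rlt_le, Hs).
destruct (Hall N) as [H0 H1]. apply H0. generalize (Hp N) (Hq N); simpl; intros.
apply H; try lra. split; [apply Hs|]. first [exact HN | lra].
Qed.

Lemma rcont_near (g : C -> C) (p q eps : R) : 0 < eps ->
  @continuous C_UniformSpace C_UniformSpace g (p, q) ->
  exists delta, 0 < delta /\ forall x y, Rabs (x - p) < delta -> Rabs (y - q) < delta ->
    Cmod (g (x, y) - g (p, q)) < eps.
Proof.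
intros He H. destruct (proj2 (continuous_C_eps g (p, q)) H eps He) as [delta [Hd H']].
exists delta; split; [exact Hd|]. intros x y Hx Hy. exact (H' (x, y) Hx Hy).
Qed.

(* Half-open on either side, so that each is additive under subdivision, while their sum
   is positive on every nondegenerate closed interval containing 0. *)
Definition has0l (y t : R) : R := if Rle_dec y 0 then if Rlt_dec 0 t then 1 else 0 else 0.
Definition has0r (y t : R) : R := if Rlt_dec y 0 then if Rle_dec 0 t then 1 else 0 else 0.

Lemma has0_split (y m t : R) : y <= m <= t ->
  has0l y t + has0r y t = has0l y m + has0r y m + (has0l m t + has0r m t).
Proof.
intros H. unfold has0l, has0r.
repeat match goal with |- context [Rle_dec ?u ?v] => destruct (Rle_dec u v)
  | |- context [Rlt_dec ?u ?v] => destruct (Rlt_dec u v) end; lra.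
Qed.

Lemma has0_pos (y t : R) : 0 <= has0l y t + has0r y t.
Proof.
unfold has0l, has0r.
repeat match goal with |- context [Rle_dec ?u ?v] => destruct (Rle_dec u v)
  | |- context [Rlt_dec ?u ?v] => destruct (Rlt_dec u v) end; lra.
Qed.

Lemma has0_ge1 (y t : R) : y < t -> y <= 0 <= t -> 1 <= has0l y t + has0r y t.
Proof.
intros H1 H2. unfold has0l, has0r.
repeat match goal with |- context [Rle_dec ?u ?v] => destruct (Rle_dec u v)
  | |- context [Rlt_dec ?u ?v] => destruct (Rlt_dec u v) end; lra.
Qed.

(* Goursat by bisection: the contour integral over a small rectangle is at most [eps] times its area,
   plus [eps] times its width if it meets the real axis. *)
Theorem goursat (g : C -> C) (a b c d : R) : a < b -> c < d -> rcont g a b c d ->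
  (forall x y, a <= x <= b -> c <= y <= d -> y <> 0 -> cdiff g (x, y)) ->
  contour g a b c d = 0.
Proof.
intros Hab Hcd Hc Hd. apply Cmod_eq_0.
set (w := b - a). set (v := d - c).
assert (Hw : 0 < w) by (unfold w; lra). assert (Hv : 0 < v) by (unfold v; lra).
assert (Eb : b = a + 1 * w) by (unfold w; ring).
assert (Ed : d = c + 1 * v) by (unfold v; ring).
assert (Main : forall eps, 0 < eps ->
  Cmod (contour g a (a + 1 * w) c (c + 1 * v)) <= eps * (1 * 1 + 1 * (has0l c (c + 1 * v) + has0r c (c + 1 * v)))).
{ intros eps He.
apply (rect_bisection (fun x y s => Cmod (contour g x (x + s * w) y (y + s * v)) <=
   eps * (s * s + s * (has0l y (y + s * v) + has0r y (y + s * v)))) a c w v Hw Hv).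
- intros x y s Hs H1 H2 H3 H4 P1 P2 P3 P4.
  assert (0 < s * w) by (apply Rmult_lt_0_compat; assumption).
  assert (0 < s * v) by (apply Rmult_lt_0_compat; assumption).
  replace (x + s / 2 * w + s / 2 * w) with (x + s * w) in * by field.
  replace (y + s / 2 * v + s / 2 * v) with (y + s * v) in * by field.
  rewrite (contour_split4 g x (x + s / 2 * w) (x + s * w) y (y + s / 2 * v) (y + s * v));
   [|lra|lra|apply (rcont_sub g a b c d); assumption || lra].
  (* The bound is additive: the squares give [4 * (s / 2)^2 = s^2], and the two quarters of a row
     share their count, which gives [2 * (s / 2) * (i1 + i2) = s * (i1 + i2)]. *)
  assert (Hsp := has0_split y (y + s / 2 * v) (y + s * v) ltac:(lra)).
  rewrite Hsp. clear Hsp.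
  set (i1 := has0l y (y + s / 2 * v) + has0r y (y + s / 2 * v)) in *.
  set (i2 := has0l (y + s / 2 * v) (y + s * v) + has0r (y + s / 2 * v) (y + s * v)) in *.
  eapply Rle_trans; [apply Cmod_triangle|].
  eapply Rle_trans; [apply Rplus_le_compat_r, Cmod_triangle|].
  eapply Rle_trans; [apply Rplus_le_compat_r, Rplus_le_compat_r, Cmod_triangle|].
  lra.
- intros p q Hp Hq.
  assert (Hcp := Hc p q ltac:(lra) ltac:(lra)).
  destruct (Req_dec q 0) as [Hq0|Hq0].
  (* On the axis only continuity is available: the deviation from the constant [g (p, q)] times the
     perimeter is linear in [s], which the [has0] term permits. *)
  + set (e' := eps * / (2 * (w + v))).
    assert (He' : 0 < e').
    { apply Rmult_lt_0_compat; [exact He|]. apply Rinv_0_lt_compat; lra. }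
    assert (Ee' : 2 * e' * (w + v) = eps) by (unfold e'; field; lra).
    destruct (rcont_near g p q e' He' Hcp) as [del [Hdel Hnear]].
    exists (del * / (w + v)); split.
    { apply Rmult_lt_0_compat; [exact Hdel|]. apply Rinv_0_lt_compat; lra. }
    intros x y s Hs H1 H2 H3 H4.
    assert (Hsd : s * (w + v) < del).
    { replace del with (del * / (w + v) * (w + v)) by (field; lra).
      apply Rmult_lt_compat_r; lra. }
    assert (0 < s * w) by (apply Rmult_lt_0_compat; lra).
    assert (0 < s * v) by (apply Rmult_lt_0_compat; lra).
    assert (B := contour_near_affine g (g (p, q)) 0 e' x (x + s * w) y (y + s * v) ltac:(lra) ltac:(lra)
      (rcont_sub g a b c d x (x + s * w) y (y + s * v) ltac:(lra) ltac:(lra) ltac:(lra) ltac:(lra) Hc)).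
    eapply Rle_trans; [apply B|].
    * intros x' y' Hx' Hy'. rewrite Cmult_0_l, Cplus_0_r. apply Rlt_le, Hnear;
      apply Rabs_def1; lra.
    * assert (I := has0_ge1 y (y + s * v) ltac:(lra) ltac:(lra)).
      replace (2 * e' * (x + s * w - x + (y + s * v - y))) with (s * (2 * e' * (w + v))) by ring.
      rewrite Ee'.
      assert (0 <= eps * (s * s)) by (apply Rmult_le_pos; nra).
      assert (s * 1 <= s * (has0l y (y + s * v) + has0r y (y + s * v))) by (apply Rmult_le_compat_l; lra).
      nra.
  + destruct (Hd p q ltac:(lra) ltac:(lra) Hq0) as [phi [Hphi [del0 [Hdel0 Hg]]]].
    (* Off the axis the deviation from the tangent is [e'] times the size of the rectangle, and the
       perimeter contributes a second factor [s]. *)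
    set (e' := eps * / (2 * (w + v) * (w + v))).
    assert (He' : 0 < e').
    { apply Rmult_lt_0_compat; [exact He|]. apply Rinv_0_lt_compat; nra. }
    assert (Ee' : 2 * e' * (w + v) * (w + v) = eps) by (unfold e'; field; lra).
    destruct (rcont_near phi p q e' He' Hphi) as [del1 [Hdel1 Hnear]].
    set (del := Rmin del0 del1).
    assert (Hdel : 0 < del) by (apply Rmin_pos; assumption).
    exists (del * / (w + v)); split.
    { apply Rmult_lt_0_compat; [exact Hdel|]. apply Rinv_0_lt_compat; lra. }
    intros x y s Hs H1 H2 H3 H4.
    assert (Hsd : s * (w + v) < del).
    { replace del with (del * / (w + v) * (w + v)) by (field; lra).
      apply Rmult_lt_compat_r; lra. }
    assert (L0 := Rmin_l del0 del1). assert (L1 := Rmin_r del0 del1). fold del in L0, L1.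
    assert (0 < s * w) by (apply Rmult_lt_0_compat; lra).
    assert (0 < s * v) by (apply Rmult_lt_0_compat; lra).
    assert (B := contour_near_affine g (g (p, q) - phi (p, q) * (p, q)) (phi (p, q)) (e' * (s * (w + v)))
      x (x + s * w) y (y + s * v) ltac:(lra) ltac:(lra)
      (rcont_sub g a b c d x (x + s * w) y (y + s * v) ltac:(lra) ltac:(lra) ltac:(lra) ltac:(lra) Hc)).
    eapply Rle_trans; [apply B|].
    * intros x' y' Hx' Hy'.
      assert (Ax : Rabs (x' - p) < del) by (apply Rabs_def1; lra).
      assert (Ay : Rabs (y' - q) < del) by (apply Rabs_def1; lra).
      rewrite (Hg (x', y')) by (simpl; lra).
      replace (g (p, q) + phi (x', y') * ((x', y') - (p, q)) - (g (p, q) - phi (p, q) * (p, q) + phi (p, q) * (x', y')))%C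
       with ((phi (x', y') - phi (p, q)) * ((x', y') - (p, q)))%C by ring.
      rewrite Cmod_mult. apply Rmult_le_compat; try apply Cmod_ge_0.
      -- apply Rlt_le, Hnear; lra.
      -- eapply Rle_trans; [apply Cmod_le_Rabs|]. simpl.
         assert (Rabs (x' + - p) <= s * w) by (apply Rabs_le; lra).
         assert (Rabs (y' + - q) <= s * v) by (apply Rabs_le; lra). lra.
    * replace (2 * (e' * (s * (w + v))) * (x + s * w - x + (y + s * v - y))) with (s * s * (2 * e' * (w + v) * (w + v))) by ring.
      rewrite Ee'. generalize (has0_pos y (y + s * v)); intros I.
      assert (0 <= eps * (s * (has0l y (y + s * v) + has0r y (y + s * v)))).
      { apply Rmult_le_pos; [lra|]. apply Rmult_le_pos; lra. }
      lra. }
rewrite Eb, Ed.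
set (k := 1 * 1 + 1 * (has0l c (c + 1 * v) + has0r c (c + 1 * v))) in *.
assert (Hk : 0 < k) by (generalize (has0_pos c (c + 1 * v)); unfold k; lra).
apply Rle_antisym; [|apply Cmod_ge_0].
apply le_epsilon. intros e He. rewrite Rplus_0_l.
replace e with (e * / k * k) by (field; lra). apply Main.
apply Rmult_lt_0_compat; [exact He|apply Rinv_0_lt_compat, Hk].
Qed.

(** * Residues at simple poles on the real axis *)

Lemma sum_sq_neq (a b : R) : a <> 0 \/ b <> 0 -> a * a + b * b <> 0.
Proof. intros H E. assert (a = 0 /\ b = 0) by (split; nra). lra. Qed.

Ltac conj_nra := repeat match goal with |- _ /\ _ => split | |- _ <> _ => first [lra | apply sum_sq_neq; lra] end.

(** Continuity at the points of the four sides only, because [/ (z - p)] is singular inside the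
    rectangle. *)
Definition bcont (g : C -> C) (a b c d : R) : Prop :=
  (forall x, a <= x <= b -> @continuous C_UniformSpace C_UniformSpace g (x, c) /\
                            @continuous C_UniformSpace C_UniformSpace g (x, d)) /\
  (forall y, c <= y <= d -> @continuous C_UniformSpace C_UniformSpace g (a, y) /\
                            @continuous C_UniformSpace C_UniformSpace g (b, y)).

Lemma bcont_exC (g : C -> C) (a b c d : R) : a <= b -> c <= d -> bcont g a b c d ->
  exC (fun x => g (x, c)) a b /\ exC (fun x => g (x, d)) a b /\
  exC (fun y => g (a, y)) c d /\ exC (fun y => g (b, y)) c d.
Proof.
intros Hab Hcd [H1 H2].
repeat split; apply exC_continuous; try assumption; intros t Ht;
 (apply continuous_hor || apply continuous_ver); (apply (H1 t Ht) || apply (H2 t Ht)).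
Qed.

(** The decomposition is required only on the boundary: when a pole is split off, it need not hold
    at the pole itself. *)
Lemma contour_add_scal (g f k : C -> C) (r : C) (a b c d : R) : a <= b -> c <= d ->
  bcont f a b c d -> bcont k a b c d ->
  (forall x y, a <= x <= b -> c <= y <= d -> (x = a \/ x = b \/ y = c \/ y = d) ->
     g (x, y) = (f (x, y) + r * k (x, y))%C) ->
  contour g a b c d = (contour f a b c d + r * contour k a b c d)%C.
Proof.
intros Hab Hcd Hf Hk He.
destruct (bcont_exC f a b c d Hab Hcd Hf) as (F1 & F2 & F3 & F4).
destruct (bcont_exC k a b c d Hab Hcd Hk) as (K1 & K2 & K3 & K4).
assert (G : forall (u v w : R -> C) p q, p <= q -> exC v p q -> exC w p q ->
   (forall x, p <= x <= q -> u x = (v x + r * w x)%C) -> CI u p q = (CI v p q + r * CI w p q)%C).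
{ intros u v w p q Hpq Hv Hw E. rewrite (CI_ext u (fun x => v x + r * w x)%C p q Hpq E).
  rewrite CI_plus, CI_scal; try assumption; [reflexivity|]. apply exC_scal, Hw. }
unfold contour.
rewrite (G (fun x => g (x, c)) (fun x => f (x, c)) (fun x => k (x, c))),
 (G (fun x => g (x, d)) (fun x => f (x, d)) (fun x => k (x, d))),
 (G (fun y => g (a, y)) (fun y => f (a, y)) (fun y => k (a, y))),
 (G (fun y => g (b, y)) (fun y => f (b, y)) (fun y => k (b, y))); try assumption; [ring|..];
intros t Ht; apply He; lra.
Qed.

Lemma Cpair_neq (x y p : R) : x <> p \/ y <> 0 -> ((x, y) - RtoC p)%C <> 0.
Proof. intros H E. injection E; intros; destruct H; lra. Qed.

Lemma continuous_inv_pole (x y p : R) : x <> p \/ y <> 0 ->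
  @continuous C_UniformSpace C_UniformSpace (fun z => / (z - RtoC p))%C (x, y).
Proof.
intros H. apply (continuous_Cinv (fun z => z - RtoC p)%C).
- apply continuous_Cplus; [apply continuous_id|apply continuous_const].
- apply Cpair_neq, H.
Qed.

Lemma cdiff_inv_pole (z : C) (q : C) : z <> q -> cdiff (fun z => / (z - q))%C z.
Proof.
intros H. apply cdiff_inv.
- apply cdiff_minus; [apply cdiff_id|apply cdiff_const].
- intros E; apply H. rewrite <- (Cplus_0_r q), <- E; ring.
Qed.

Lemma bcont_inv_pole (p X t : R) : - X < p < X -> 0 < t ->
  bcont (fun z => / (z - RtoC p))%C (- X) X (- t) t.
Proof.
intros Hp Ht. split; intros; split; apply continuous_inv_pole; lra.
Qed.

Lemma is_CI_derive (F f : R -> C) (a b : R) : a <= b ->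
  (forall x, a <= x <= b -> is_derive (fun t => Re (F t)) x (Re (f x))) ->
  (forall x, a <= x <= b -> is_derive (fun t => Im (F t)) x (Im (f x))) ->
  (forall x, a <= x <= b -> @continuous R_UniformSpace C_UniformSpace f x) ->
  @is_RInt C_R_NormedModule f a b (F b - F a)%C.
Proof.
intros Hab H1 H2 H3. apply is_CI_parts.
- apply (is_RInt_derive (V:=R_CompleteNormedModule) (fun t => Re (F t)));
  rewrite Rmin_left, Rmax_right by exact Hab; [exact H1|].
  intros x Hx. apply continuous_Re, H3, Hx.
- apply (is_RInt_derive (V:=R_CompleteNormedModule) (fun t => Im (F t)));
  rewrite Rmin_left, Rmax_right by exact Hab; [exact H2|].
  intros x Hx. apply continuous_Im, H3, Hx.
Qed.

(** Opposite sides are combined and integrated by explicit primitives. The logarithms on the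
    vertical sides are even in [y] and drop out; the arctangents pair up as
    [atan r + atan (/ r) = PI / 2] and add up to [2 PI]. *)
Lemma contour_inv_pole (p X t : R) : - X < p < X -> 0 < t ->
  contour (fun z => / (z - RtoC p))%C (- X) X (- t) t = (RtoC (2 * PI) * Ci)%C.
Proof.
intros Hp Ht.
destruct (bcont_exC _ (- X) X (- t) t ltac:(lra) ltac:(lra) (bcont_inv_pole p X t Hp Ht)) as (F1 & F2 & F3 & F4).
unfold contour.
rewrite <- (CI_minus _ _ _ _ F1 F2). rewrite <- (CI_minus _ _ _ _ F4 F3).
assert (E1 : CI (fun x => / ((x, (- t)%R) - RtoC p) - / ((x, t) - RtoC p))%C (- X) X =
   (0, 2 * atan ((X - p) / t) - 2 * atan ((- X - p) / t))).
{ rewrite (CI_unique _ _ _ ((0, (2 * atan ((X - p) / t))%R) - (0, (2 * atan ((- X - p) / t))%R))%C).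
  { apply injective_projections; simpl; ring. }
  apply (is_CI_derive (fun x => (0, 2 * atan ((x - p) / t)))); [lra|..].
  - intros x Hx. simpl.
    auto_derive; [exact I|]. field. conj_nra.
  - intros x Hx. simpl. auto_derive; [exact I|]. unfold Rsqr. field. conj_nra.
  - intros x Hx. apply continuous_Cplus; [|apply continuous_Copp];
     apply (continuous_hor (fun z => / (z - RtoC p))%C), continuous_inv_pole; lra. }
assert (E2 : CI (fun y => / ((X, y) - RtoC p) - / (((- X)%R, y) - RtoC p))%C (- t) t =
   (2 * atan (t / (X - p)) + 2 * atan (t / (X + p)), 0)).
{ pose (G := fun y => (atan (y / (X - p)) + atan (y / (X + p)),
     (ln ((X + p) * (X + p) + y * y) - ln ((X - p) * (X - p) + y * y)) / 2) : C).
  rewrite (CI_unique _ _ _ (G t - G (- t)%R)%C).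
  { unfold G. apply injective_projections; simpl.
    - rewrite !Rdiv_opp_l, !atan_opp. ring.
    - rewrite !Rmult_opp_opp. ring. }
  apply (is_CI_derive G); [lra|..].
  - intros x Hx. simpl. auto_derive; [exact I|]. unfold Rsqr. field. conj_nra.
  - intros x Hx. simpl.
    assert (0 < (X + p) * (X + p)) by nra. assert (0 < (X - p) * (X - p)) by nra.
    auto_derive; [repeat split; nra|]. field. conj_nra.
  - intros x Hx. apply continuous_Cplus; [|apply continuous_Copp];
     apply (continuous_ver (fun z => / (z - RtoC p))%C), continuous_inv_pole; lra. }
rewrite E1, E2.
assert (A1 : atan (t / (X - p)) = PI / 2 - atan ((X - p) / t)).
{ rewrite <- atan_inv by (apply Rdiv_lt_0_compat; lra). f_equal. field; lra. }
assert (A2 : atan (t / (X + p)) = PI / 2 + atan ((- X - p) / t)).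
{ replace (t / (X + p)) with (/ ((X + p) / t)) by (field; lra).
  rewrite atan_inv by (apply Rdiv_lt_0_compat; lra).
  replace ((- X - p) / t) with (- ((X + p) / t)) by (field; lra). rewrite atan_opp; ring. }
rewrite A1, A2. apply injective_projections; simpl; field.
Qed.

Definition Csum (l : list (R * C)) : C := fold_right (fun pr s => snd pr + s)%C 0 l.

(** The list pairs each pole with its residue. By induction the poles are split off one at a time;
    what remains is continuous on the axis and differentiable off it, as [goursat] asks. The value
    of [g] at a pole is left free. *)
Lemma residue_real_poles (ps : list (R * C)) (g : C -> C) (X t : R) : 0 < X -> 0 < t ->
  (forall x y, - X <= x <= X -> - t <= y <= t -> y <> 0 -> cdiff g (x, y)) ->
  (forall x, - X <= x <= X -> ~ In x (map fst ps) ->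
     @continuous C_UniformSpace C_UniformSpace g (x, 0)) ->
  (forall p r, In (p, r) ps -> - X < p < X /\
     exists k, @continuous C_UniformSpace C_UniformSpace k (RtoC p) /\
     exists delta, 0 < delta /\ forall w : C, Rabs (Re w - p) < delta -> Rabs (Im w) < delta ->
       w <> RtoC p -> (g w = k w + r * / (w - RtoC p))%C) ->
  NoDup (map fst ps) ->
  contour g (- X) X (- t) t = (RtoC (2 * PI) * Ci * Csum ps)%C.
Proof.
intros HX Ht. revert g. induction ps as [|[p r] ps IH]; intros g Hd Hc Hp Hnd.
- simpl Csum. rewrite Cmult_0_r. apply goursat; try lra.
  + intros x y Hx Hy. destruct (Req_dec y 0) as [->|Hy0].
    * apply Hc; [exact Hx|]. intros [].
    * apply cdiff_continuous, Hd; assumption.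
  + exact Hd.
- inversion Hnd as [|? ? Hnin Hnd']; subst. simpl in Hnin, Hnd'.
  destruct (Hp p r (or_introl eq_refl)) as [HpX [k [Hk [del [Hdel Hg]]]]].
  (* Near [p] this is the regular part [k], so [g1] is continuous at [p]. At the other poles the
     subtracted term is regular and is absorbed into their [k']. *)
  pose (g1 := fun w => if excluded_middle_informative (w = RtoC p) then k w
                       else (g w - r * / (w - RtoC p))%C).
  assert (Hg1 : forall w, w <> RtoC p -> g1 w = (g w - r * / (w - RtoC p))%C).
  { intros w Hw. unfold g1. destruct (excluded_middle_informative (w = RtoC p)); tauto. }
  assert (Hne : forall x y, x <> p \/ y <> 0 -> (x, y) <> RtoC p).
  { intros x y H E. injection E; intros; destruct H; auto. }
  assert (Hd1 : forall x y, - X <= x <= X -> - t <= y <= t -> y <> 0 -> cdiff g1 (x, y)).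
  { intros x y Hx Hy Hy0.
    apply (cdiff_ext_loc (fun w => g w - r * / (w - RtoC p))%C g1 _ (Rabs y)).
    - apply Rabs_pos_lt, Hy0.
    - intros [u v] _ Hv. symmetry. apply Hg1, Hne. right. simpl in Hv. intros ->.
      rewrite Rminus_0_l, Rabs_Ropp in Hv. lra.
    - apply cdiff_minus; [apply Hd; assumption|]. apply cdiff_scal, cdiff_inv_pole, Hne.
      right; exact Hy0. }
  assert (Hc1 : forall x, - X <= x <= X -> ~ In x (map fst ps) ->
     @continuous C_UniformSpace C_UniformSpace g1 (x, 0)).
  { intros x Hx Hin. destruct (Req_dec x p) as [->|Hxp].
    - apply (continuous_ext_loc _ k); [|exact Hk].
      exists (mkposreal del Hdel). intros w [B1 B2].
      destruct (excluded_middle_informative (w = RtoC p)) as [->|Hw].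
      + unfold g1. destruct (excluded_middle_informative (RtoC p = RtoC p)); tauto.
      + assert (E : forall u v : C, u = (u + v - v)%C) by (intros; ring).
        rewrite (Hg1 w Hw), (Hg w); [apply E|exact B1| |exact Hw].
        change (Rabs (Im w - 0) < del) in B2. rewrite Rminus_0_r in B2. exact B2.
    - apply (continuous_ext_loc _ (fun w => g w - r * / (w - RtoC p))%C).
      + assert (Hxp' : 0 < Rabs (x - p)) by (apply Rabs_pos_lt; lra).
        exists (mkposreal _ Hxp'). intros [u v] [B1 _]. symmetry. apply Hg1, Hne. left. intros ->.
        change (Rabs (p - x) < Rabs (x - p)) in B1. rewrite Rabs_minus_sym in B1. lra.
      + apply continuous_Cplus.
        * apply Hc; [exact Hx|]. simpl. intros [E|E]; [congruence|tauto].
        * apply continuous_Copp, continuous_Cmult; [apply continuous_const|].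
          apply continuous_inv_pole. left; exact Hxp. }
  rewrite (contour_add_scal g g1 (fun z => / (z - RtoC p))%C r); try lra.
  + rewrite contour_inv_pole by assumption. rewrite (IH g1); try assumption.
    * simpl Csum. ring.
    * intros p' r' Hin. destruct (Hp p' r' (or_intror Hin)) as [HpX' [k' [Hk' [del' [Hdel' Hg']]]]].
      assert (Hpp : p' <> p). { intros ->. apply Hnin. apply (in_map fst _ _ Hin). }
      split; [exact HpX'|].
      exists (fun w => k' w - r * / (w - RtoC p))%C. split.
      -- apply continuous_Cplus; [exact Hk'|].
         apply continuous_Copp, continuous_Cmult; [apply continuous_const|].
         apply continuous_inv_pole. left; exact Hpp.
      -- assert (Hxp' : 0 < Rabs (p' - p)) by (apply Rabs_pos_lt; lra).
         exists (Rmin del' (Rabs (p' - p))). split; [apply Rmin_pos; assumption|].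
         intros [u v] B1 B2 Hw.
         rewrite Hg1, (Hg' (u, v)); [ring| | |exact Hw|].
         ++ eapply Rlt_le_trans; [exact B1|apply Rmin_l].
         ++ eapply Rlt_le_trans; [exact B2|apply Rmin_l].
         ++ apply Hne. left. intros ->. simpl in B1.
            assert (B3 := Rlt_le_trans _ _ _ B1 (Rmin_r _ _)).
            rewrite Rabs_minus_sym in B3. lra.
  + assert (Hps : forall q, In q (map fst ps) -> - X < q < X).
    { intros q Hq. apply in_map_iff in Hq. destruct Hq as [[q' r'] [<- Hin]].
      apply (Hp q' r' (or_intror Hin)). }
    assert (Hall : forall x y, - X <= x <= X -> - t <= y <= t -> (x = - X \/ x = X \/ y <> 0) ->
       @continuous C_UniformSpace C_UniformSpace g1 (x, y)).
    { intros x y Hx Hy Hb. destruct (Req_dec y 0) as [->|Hy0].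
      - apply Hc1; [exact Hx|]. intros Hin. generalize (Hps x Hin). intros; lra.
      - apply cdiff_continuous, Hd1; assumption. }
    split; intros; split; apply Hall; lra.
  + apply bcont_inv_pole; assumption.
  + intros x y Hx Hy Hb. rewrite Hg1; [ring|]. apply Hne. lra.
Qed.

(** * Complex sine and hyperbolic functions *)

(** Caratheodory's form on the real line, with an identity that holds for all [y] and not only near
    [x]. *)
Lemma Rdiff_quotient (f : R -> R) (x l : R) : is_derive f x l ->
  exists phi : R -> R, continuous phi x /\ phi x = l /\ forall y, f y = f x + phi y * (y - x).
Proof.
intros H. apply is_derive_Reals in H.
exists (fun y => if Req_dec_T y x then l else (f y - f x) / (y - x)).
split; [|split].
- apply continuity_pt_filterlim. intros eps He.
  destruct (H eps He) as [d Hd]. exists d; split; [apply cond_pos|].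
  intros y [_ Hy]. simpl in *. unfold Rdist in *.
  destruct (Req_dec_T x x) as [_|]; [|congruence].
  destruct (Req_dec_T y x) as [->|Hyx]; [rewrite Rminus_diag, Rabs_R0; lra|].
  generalize (Hd (y - x) ltac:(lra) Hy). replace (x + (y - x)) with y by ring. tauto.
- destruct (Req_dec_T x x); congruence.
- intros y. destruct (Req_dec_T y x) as [->|Hyx]; [ring|]. field; lra.
Qed.

(** Since [Re (w - z) = (w - z) - i Im (w - z)], the increment is [P w * (w - z) + (Q w - i P w) *
    Im (w - z)]. Here [|Im (w - z)| <= |w - z|], and [Q - i P] is continuous and vanishes at [z]. *)
Lemma cdiff_Cauchy_Riemann (f P Q : C -> C) (z : C) :
  @continuous C_UniformSpace C_UniformSpace P z ->
  @continuous C_UniformSpace C_UniformSpace Q z -> Q z = (Ci * P z)%C ->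
  (forall w, f w = (f z + P w * RtoC (Re w - Re z) + Q w * RtoC (Im w - Im z))%C) -> cdiff f z.
Proof.
intros HP HQ E Hf.
exists (fun w => P w + (Q w - Ci * P w) * (RtoC (Im w - Im z) * / (w - z)))%C. split.
2:{ exists 1; split; [lra|]. intros w _ _. rewrite (Hf w).
  destruct (excluded_middle_informative (w = z)) as [->|Hw].
  - rewrite !Rminus_diag. ring.
  - assert (Hn : (w - z)%C <> 0). { intros H; apply Hw. rewrite <- (Cplus_0_r z), <- H; ring. }
    transitivity (f z + P w * (w - z) + (Q w - Ci * P w) * RtoC (Im w - Im z))%C; [|field; exact Hn].
    replace (w - z)%C with (RtoC (Re w - Re z) + Ci * RtoC (Im w - Im z))%C; [ring|].
    apply injective_projections; simpl; unfold Re, Im; ring. }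
apply continuous_C_eps. intros eps He.
assert (HD : @continuous C_UniformSpace C_UniformSpace (fun w => Q w - Ci * P w)%C z).
{ apply continuous_Cplus; [exact HQ|].
  apply continuous_Copp, continuous_Cmult; [apply continuous_const|exact HP]. }
assert (He2 : 0 < eps / 2) by lra.
destruct (proj2 (continuous_C_eps _ z) HP (eps / 2) He2) as [d1 [Hd1 H1]].
destruct (proj2 (continuous_C_eps _ z) HD (eps / 2) He2) as [d2 [Hd2 H2]].
exists (Rmin d1 d2); split; [apply Rmin_pos; assumption|].
intros w A1 A2.
specialize (H1 w ltac:(eapply Rlt_le_trans; [eassumption|apply Rmin_l]) ltac:(eapply Rlt_le_trans; [eassumption|apply Rmin_l])).
specialize (H2 w ltac:(eapply Rlt_le_trans; [eassumption|apply Rmin_r]) ltac:(eapply Rlt_le_trans; [eassumption|apply Rmin_r])).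
rewrite E in H2 |- *.
replace (P w + (Q w - Ci * P w) * (RtoC (Im w - Im z) * / (w - z)) -
  (P z + (Ci * P z - Ci * P z) * (RtoC (Im z - Im z) * / (z - z))))%C with
  ((P w - P z) + (Q w - Ci * P w) * (RtoC (Im w - Im z) * / (w - z)))%C by ring.
eapply Rle_lt_trans; [apply Cmod_triangle|].
replace (Q w - Ci * P w - (Ci * P z - Ci * P z))%C with (Q w - Ci * P w)%C in H2 by ring.
rewrite Cmod_mult.
assert (Hle : Cmod (RtoC (Im w - Im z) * / (w - z)) <= 1).
{ destruct (excluded_middle_informative (w = z)) as [->|Hw].
  - rewrite Rminus_diag, Cmult_0_l, Cmod_0; lra.
  - assert (Hn : (w - z)%C <> 0). { intros H; apply Hw. rewrite <- (Cplus_0_r z), <- H; ring. }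
    rewrite Cmod_mult, Cmod_inv by exact Hn. rewrite Cmod_R.
    assert (Hp := proj1 (Cmod_gt_0 _) Hn).
    apply Rmult_le_reg_r with (Cmod (w - z)); [exact Hp|].
    rewrite Rmult_assoc, Rinv_l, Rmult_1_l, Rmult_1_r by lra.
    apply (proj2 (Re_Im_le_Cmod (w - z))). }
generalize (Cmod_ge_0 (Q w - Ci * P w)); intros. nra.
Qed.

(** The two equations are those of Cauchy and Riemann. The shape, a product of a function of [Re]
    and one of [Im] in each part, covers [csin], [csinh] and [ccosh] at once. *)
Lemma cdiff_separated (A1 B1 A2 B2 : R -> R) (a1 b1 a2 b2 : R) (z : C) :
  is_derive A1 (Re z) a1 -> is_derive B1 (Im z) b1 ->
  is_derive A2 (Re z) a2 -> is_derive B2 (Im z) b2 ->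
  a1 * B1 (Im z) = A2 (Re z) * b2 -> A1 (Re z) * b1 = - (a2 * B2 (Im z)) ->
  cdiff (fun w => (A1 (Re w) * B1 (Im w), A2 (Re w) * B2 (Im w))) z.
Proof.
intros HA1 HB1 HA2 HB2 E1 E2.
assert (C1 : continuous B1 (Im z)) by (apply (ex_derive_continuous B1); exists b1; exact HB1).
assert (C2 : continuous B2 (Im z)) by (apply (ex_derive_continuous B2); exists b2; exact HB2).
destruct (Rdiff_quotient _ _ _ HA1) as [p1 [Hp1 [Ep1 F1]]].
destruct (Rdiff_quotient _ _ _ HA2) as [p2 [Hp2 [Ep2 F2]]].
destruct (Rdiff_quotient _ _ _ HB1) as [q1 [Hq1 [Eq1 G1]]].
destruct (Rdiff_quotient _ _ _ HB2) as [q2 [Hq2 [Eq2 G2]]].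
assert (KRe : forall g : R -> R, continuous g (Re z) -> @continuous C_UniformSpace R_UniformSpace (fun w : C => g (Re w)) z).
{ intros g Hg. apply (continuous_comp (U:=C_UniformSpace) Re g); [|exact Hg].
  exact (continuous_Re (U:=C_UniformSpace) (fun w => w) z (continuous_id z)). }
assert (KIm : forall g : R -> R, continuous g (Im z) -> @continuous C_UniformSpace R_UniformSpace (fun w : C => g (Im w)) z).
{ intros g Hg. apply (continuous_comp (U:=C_UniformSpace) Im g); [|exact Hg].
  exact (continuous_Im (U:=C_UniformSpace) (fun w => w) z (continuous_id z)). }
apply (cdiff_Cauchy_Riemann _ (fun w => (p1 (Re w) * B1 (Im w), p2 (Re w) * B2 (Im w)))
  (fun w => (A1 (Re z) * q1 (Im w), A2 (Re z) * q2 (Im w)))).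
- apply continuous_pair.
  + exact (continuous_mult (K:=R_AbsRing) _ _ z (KRe p1 Hp1) (KIm B1 C1)).
  + exact (continuous_mult (K:=R_AbsRing) _ _ z (KRe p2 Hp2) (KIm B2 C2)).
- apply continuous_pair.
  + exact (continuous_mult (K:=R_AbsRing) _ _ z (continuous_const (A1 (Re z)) z) (KIm q1 Hq1)).
  + exact (continuous_mult (K:=R_AbsRing) _ _ z (continuous_const (A2 (Re z)) z) (KIm q2 Hq2)).
- rewrite Ep1, Ep2, Eq1, Eq2. unfold Ci, Cmult; simpl. f_equal; lra.
- intros w. apply injective_projections; simpl.
  + rewrite (F1 (Re w)), (G1 (Im w)). ring.
  + rewrite (F2 (Re w)), (G2 (Im w)). ring.
Qed.

Lemma is_derive_cosh (x : R) : is_derive cosh x (sinh x).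
Proof. apply is_derive_Reals, derivable_pt_lim_cosh. Qed.

Lemma is_derive_sinh (x : R) : is_derive sinh x (cosh x).
Proof. apply is_derive_Reals, derivable_pt_lim_sinh. Qed.

Definition csin (z : C) : C := (sin (Re z) * cosh (Im z), cos (Re z) * sinh (Im z)).
Definition ccosh (z : C) : C := (cosh (Re z) * cos (Im z), sinh (Re z) * sin (Im z)).

Lemma cdiff_csin (z : C) : cdiff csin z.
Proof.
apply (cdiff_separated sin cosh cos sinh (cos (Re z)) (sinh (Im z)) (- sin (Re z)) (cosh (Im z)));
 auto using is_derive_sin, is_derive_cos, is_derive_cosh, is_derive_sinh; ring.
Qed.

Lemma cdiff_csinh (z : C) : cdiff csinh z.
Proof.
apply (cdiff_separated sinh cos cosh sin (cosh (Re z)) (- sin (Im z)) (sinh (Re z)) (cos (Im z)));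
 auto using is_derive_sin, is_derive_cos, is_derive_cosh, is_derive_sinh; ring.
Qed.

Lemma cdiff_ccosh (z : C) : cdiff ccosh z.
Proof.
apply (cdiff_separated cosh cos sinh sin (sinh (Re z)) (- sin (Im z)) (cosh (Re z)) (cos (Im z)));
 auto using is_derive_sin, is_derive_cos, is_derive_cosh, is_derive_sinh; ring.
Qed.

Lemma cosh2_sinh2 (x : R) : cosh x * cosh x = 1 + sinh x * sinh x.
Proof.
unfold cosh, sinh. assert (E : exp x * exp (- x) = 1) by (rewrite <- exp_plus, Rplus_opp_r; apply exp_0).
nra.
Qed.

Lemma sin2_cos2' (x : R) : sin x * sin x + cos x * cos x = 1.
Proof. exact (sin2_cos2 x). Qed.

(** This form shows that the zeros are real, and gives the lower bounds on the contour: keep the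
    [sinh] term on the horizontal sides, the [sin] term on the vertical ones. *)
Lemma Cmod_csin2 (z : C) : Cmod (csin z) ^ 2 = sin (Re z) * sin (Re z) + sinh (Im z) * sinh (Im z).
Proof.
rewrite Cmod2_alt. unfold csin; simpl.
generalize (cosh2_sinh2 (Im z)) (sin2_cos2' (Re z)). intros H1 H2.
set (s := sin (Re z)) in *. set (c := cos (Re z)) in *. set (S := sinh (Im z)) in *. set (k := cosh (Im z)) in *.
replace (s * k * (s * k * 1) + c * S * (c * S * 1)) with (s * s * (k * k) + (c * c) * (S * S)) by ring.
rewrite H1. replace (c * c) with (1 - s * s) by lra. ring.
Qed.

Lemma cosh_ge1 (x : R) : 1 <= cosh x.
Proof.
unfold cosh. generalize (exp_ineq1_le x) (exp_ineq1_le (- x)). lra.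
Qed.

Lemma sinh_neg (x : R) : sinh (- x) = - sinh x.
Proof. unfold sinh. rewrite Ropp_involutive. field. Qed.

Lemma sinh_pos (x : R) : 0 < x -> 0 < sinh x.
Proof. intros H. rewrite <- sinh_0. apply sinh_lt, H. Qed.

Lemma sinh_eq_0 (x : R) : sinh x = 0 -> x = 0.
Proof.
intros H. destruct (Rtotal_order x 0) as [H1|[H1|H1]]; [|exact H1|].
- apply sinh_lt in H1. rewrite sinh_0 in H1. lra.
- apply sinh_lt in H1. rewrite sinh_0 in H1. lra.
Qed.

Lemma csin_eq_0 (z : C) : csin z = 0 -> sin (Re z) = 0 /\ Im z = 0.
Proof.
intros H. generalize (Cmod_csin2 z). rewrite H, Cmod_0. intros E.
assert (sin (Re z) = 0 /\ sinh (Im z) = 0) as [H1 H2].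
{ apply Rplus_sqr_eq_0. unfold Rsqr. rewrite <- E; ring. }
split; [exact H1|]. apply sinh_eq_0, H2.
Qed.

Lemma Rabs_sin_le (x : R) : Rabs (sin x) <= Rabs x.
Proof.
assert (H : forall y, 0 <= y -> sin y <= y /\ - y <= sin y).
{ intros y Hy. destruct (Req_dec y 0) as [->|]; [rewrite sin_0; lra|].
  generalize (sin_lt_x y ltac:(lra)). split; [lra|].
  destruct (Rle_lt_dec y PI); [generalize (sin_ge_0 y Hy r); lra|].
  generalize (SIN_bound y) PI2_3_2; lra. }
destruct (Rle_lt_dec 0 x).
- rewrite (Rabs_pos_eq x) by assumption. apply Rabs_le. generalize (H x r); lra.
- rewrite (Rabs_left x) by assumption. apply Rabs_le. generalize (H (- x) ltac:(lra)). rewrite sin_neg; lra.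
Qed.

Lemma mean_value_bound (f df : R -> R) (M x : R) : (forall t, is_derive f t (df t)) ->
  (forall t, Rabs t <= Rabs x -> Rabs (df t) <= M) -> Rabs (f x - f 0) <= M * Rabs x.
Proof.
intros Hd HM. destruct (MVT_gen f 0 x df) as [c [Hc E]].
- intros t _; apply Hd.
- intros t _. apply derivable_continuous_pt. exists (df t). apply is_derive_Reals, Hd.
- rewrite E, Rminus_0_r, Rabs_mult. apply Rmult_le_compat_r; [apply Rabs_pos|].
  apply HM. revert Hc. unfold Rmin, Rmax. destruct (Rle_dec 0 x); intros.
  + rewrite !Rabs_pos_eq; lra.
  + rewrite !Rabs_left1; lra.
Qed.

Lemma one_minus_cos_le (x : R) : Rabs (1 - cos x) <= Rabs x * Rabs x.
Proof.
replace x with (2 * (x / 2)) at 1 by field. rewrite cos_2a_sin.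
generalize (Rabs_sin_le (x / 2)); intros H.
replace (Rabs x) with (2 * Rabs (x / 2)).
- replace (1 - (1 - 2 * sin (x / 2) * sin (x / 2))) with (2 * (sin (x / 2) * sin (x / 2))) by ring.
  rewrite !Rabs_mult, (Rabs_pos_eq 2) by lra. generalize (Rabs_pos (sin (x / 2))). nra.
- unfold Rdiv. rewrite Rabs_mult, (Rabs_pos_eq (/ 2)) by lra. field.
Qed.

Lemma sin_minus_id_le (x : R) : Rabs (sin x - x) <= Rabs x * Rabs x * Rabs x.
Proof.
generalize (mean_value_bound (fun t => sin t - t) (fun t => cos t - 1) (Rabs x * Rabs x) x).
rewrite sin_0, !Rminus_0_r. intros H; apply H.
- intros t. auto_derive; [exact I|ring].
- intros t Ht. rewrite Rabs_minus_sym. eapply Rle_trans; [apply one_minus_cos_le|].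
  generalize (Rabs_pos t); nra.
Qed.

Lemma exp_le (x y : R) : x <= y -> exp x <= exp y.
Proof. intros [H| ->]; [left; apply exp_increasing, H|right; reflexivity]. Qed.

Lemma cosh_le3 (x : R) : Rabs x <= 1 -> cosh x <= 3.
Proof.
intros H. generalize (Rle_abs x) (Rle_abs (- x)). rewrite Rabs_Ropp. intros. unfold cosh.
assert (exp x <= exp 1) by (apply exp_le; lra).
assert (exp (- x) <= exp 1) by (apply exp_le; lra).
generalize exp_le_3; lra.
Qed.

Lemma sinh_le3 (x : R) : Rabs x <= 1 -> Rabs (sinh x) <= 3 * Rabs x.
Proof.
intros H. generalize (mean_value_bound sinh cosh 3 x is_derive_sinh).
rewrite sinh_0, Rminus_0_r. intros G; apply G.
intros t Ht. rewrite Rabs_pos_eq by (generalize (cosh_ge1 t); lra). apply cosh_le3; lra.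
Qed.

Lemma cosh_minus_1_le (x : R) : Rabs x <= 1 -> Rabs (cosh x - 1) <= 3 * Rabs x * Rabs x.
Proof.
intros H. generalize (mean_value_bound cosh sinh (3 * Rabs x) x is_derive_cosh).
rewrite cosh_0. intros G; apply G.
intros t Ht. eapply Rle_trans; [apply sinh_le3; lra|lra].
Qed.

Lemma sinh_minus_id_le (x : R) : Rabs x <= 1 -> Rabs (sinh x - x) <= 3 * Rabs x * Rabs x * Rabs x.
Proof.
intros H. generalize (mean_value_bound (fun t => sinh t - t) (fun t => cosh t - 1) (3 * Rabs x * Rabs x) x).
rewrite sinh_0, !Rminus_0_r. intros G; apply G.
- intros t. apply (is_derive_minus (V:=R_NormedModule) sinh (fun t => t)); [apply is_derive_sinh|].
  auto_derive; [exact I|reflexivity].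
- intros t Ht. eapply Rle_trans; [apply cosh_minus_1_le; lra|]. generalize (Rabs_pos t); nra.
Qed.

(** Only the cubic order matters, for [cdiff_csinc_0]; the constant is crude, each of the two parts
    contributing 6. *)
Lemma csin_minus_id_le (z : C) : Cmod z <= 1 -> Cmod (csin z - z) <= 16 * (Cmod z * Cmod z * Cmod z).
Proof.
intros H. destruct (Re_Im_le_Cmod z) as [H1 H2]. set (r := Cmod z) in *.
eapply Rle_trans; [apply Cmod_le_Rabs|]. unfold csin; simpl. fold (Re z) (Im z).
set (x := Re z) in *. set (y := Im z) in *.
assert (P1 := Rabs_pos x). assert (P2 := Rabs_pos y).
assert (Q : forall u v w, 0 <= u <= r -> 0 <= v <= r -> 0 <= w <= r -> u * v * w <= r * r * r).
{ intros u v w Hu Hv Hw. apply Rmult_le_compat; try lra.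
  - apply Rmult_le_pos; lra.
  - apply Rmult_le_compat; lra. }
assert (E1 : Rabs (sin x * cosh y + - x) <= 6 * (r * r * r)).
{ replace (sin x * cosh y + - x) with ((sin x - x) * cosh y + x * (cosh y - 1)) by ring.
  eapply Rle_trans; [apply Rabs_triang|]. rewrite !Rabs_mult.
  assert (A1 := sin_minus_id_le x). assert (A2 := cosh_minus_1_le y ltac:(lra)).
  assert (A3 : Rabs (cosh y) <= 3).
  { rewrite Rabs_pos_eq; [apply cosh_le3; lra|generalize (cosh_ge1 y); lra]. }
  assert (Q1 := Q (Rabs x) (Rabs x) (Rabs x) ltac:(lra) ltac:(lra) ltac:(lra)).
  assert (Q2 := Q (Rabs x) (Rabs y) (Rabs y) ltac:(lra) ltac:(lra) ltac:(lra)).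
  assert (Rabs (sin x - x) * Rabs (cosh y) <= (r * r * r) * 3).
  { apply Rmult_le_compat; try apply Rabs_pos; lra. }
  assert (Rabs x * Rabs (cosh y - 1) <= Rabs x * (3 * Rabs y * Rabs y)).
  { apply Rmult_le_compat_l; lra. }
  lra. }
assert (E2 : Rabs (cos x * sinh y + - y) <= 6 * (r * r * r)).
{ replace (cos x * sinh y + - y) with ((sinh y - y) - (1 - cos x) * sinh y) by ring.
  eapply Rle_trans; [apply Rabs_triang|]. rewrite Rabs_Ropp, !Rabs_mult.
  assert (A1 := sinh_minus_id_le y ltac:(lra)). assert (A2 := one_minus_cos_le x).
  assert (A3 := sinh_le3 y ltac:(lra)).
  assert (Q1 := Q (Rabs y) (Rabs y) (Rabs y) ltac:(lra) ltac:(lra) ltac:(lra)).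
  assert (Q2 := Q (Rabs x) (Rabs x) (Rabs y) ltac:(lra) ltac:(lra) ltac:(lra)).
  assert (Rabs (1 - cos x) * Rabs (sinh y) <= (Rabs x * Rabs x) * (3 * Rabs y)).
  { apply Rmult_le_compat; try apply Rabs_pos; lra. }
  lra. }
assert (0 <= r * r * r) by (assert (0 <= r) by apply Cmod_ge_0; nra).
lra.
Qed.

Definition csinc (z : C) : C :=
  if excluded_middle_informative (z = 0) then RtoC 1 else (csin z / z)%C.

Lemma csinc_mul (z : C) : (csin z = csinc z * z)%C.
Proof.
unfold csinc. destruct (excluded_middle_informative (z = 0)) as [->|H].
- unfold csin; simpl. rewrite sin_0, sinh_0. apply injective_projections; simpl; ring.
- field; exact H.
Qed.

Lemma csinc_0 : csinc 0 = 1.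
Proof. unfold csinc. destruct (excluded_middle_informative (RtoC 0 = 0)); tauto. Qed.

(** The slope at 0 is [(csin w - w) / w^2], at most [16 |w|]. Differentiability at the filled-in
    point lets [csinc] divide out a zero of the sine in [pole_csin]. *)
Lemma cdiff_csinc_0 : cdiff csinc 0.
Proof.
exists (fun z : C => if excluded_middle_informative (z = RtoC 0) then RtoC 0 else ((csinc z - 1) / z)%C). split.
2:{ exists 1; split; [lra|]. intros w _ _. rewrite csinc_0.
  destruct (excluded_middle_informative (w = RtoC 0)) as [->|H]; [rewrite csinc_0; ring|field; exact H]. }
apply continuous_C_eps. intros eps He.
(* [/ 2] ensures [Cmod w <= 1]; [eps / 64] ensures [Cmod w < eps / 32], so that
   [16 * Cmod w < eps]. *)
exists (Rmin (/ 2) (eps / 64)); split; [apply Rmin_pos; lra|].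
intros w H1 H2.
destruct (excluded_middle_informative (RtoC 0 = 0)) as [_|N]; [|tauto].
destruct (excluded_middle_informative (w = RtoC 0)) as [->|H].
{ replace (0 - 0)%C with (RtoC 0) by ring. rewrite Cmod_0; lra. }
assert (L1 := Rmin_l (/ 2) (eps / 64)). assert (L2 := Rmin_r (/ 2) (eps / 64)).
change (Re 0) with 0 in H1. change (Im 0) with 0 in H2. rewrite Rminus_0_r in H1, H2.
assert (Hm := Cmod_le_Rabs w). assert (Hp := proj1 (Cmod_gt_0 _) H).
assert (B := csin_minus_id_le w ltac:(lra)).
replace ((csinc w - 1) / w - 0)%C with ((csin w - w) / (w * w))%C by (rewrite csinc_mul; field; exact H).
rewrite Cmod_div by (apply Cmult_neq_0; exact H). rewrite Cmod_mult.
apply Rle_lt_trans with (16 * Cmod w); [|lra].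
apply Rmult_le_reg_r with (Cmod w * Cmod w); [nra|].
unfold Rdiv. rewrite Rmult_assoc, Rinv_l by nra. lra.
Qed.

(** * The cardinal interpolation formula *)

(** At most a simple pole, with residue [r] and regular part [k]: the local hypothesis of
    [residue_real_poles]. *)
Definition pole (g : C -> C) (p : R) (r : C) : Prop :=
  exists k, @continuous C_UniformSpace C_UniformSpace k (RtoC p) /\
  exists delta, 0 < delta /\ forall w : C, Rabs (Re w - p) < delta -> Rabs (Im w) < delta ->
    w <> RtoC p -> (g w = k w + r * / (w - RtoC p))%C.

Lemma Cminus_neq_0 (a b : C) : a <> b -> (a - b)%C <> 0.
Proof. intros H E; apply H. rewrite <- (Cplus_0_r b), <- E; ring. Qed.

Lemma RtoC_neq_0 (x : R) : x <> 0 -> RtoC x <> 0.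
Proof. intros H E; apply H. injection E; auto. Qed.

Lemma Cinv_0 : (/ RtoC 0)%C = 0.
Proof. apply injective_projections; simpl; unfold Rdiv; ring. Qed.

(* No hypothesis: [/ 0 = 0]. *)
Lemma Cinv_mul (x y : C) : (/ (x * y) = / x * / y)%C.
Proof.
destruct (excluded_middle_informative (x = 0)) as [->|Hx].
{ rewrite Cmult_0_l, Cinv_0. ring. }
destruct (excluded_middle_informative (y = 0)) as [->|Hy].
{ rewrite Cmult_0_r, Cinv_0. ring. }
field; split; assumption.
Qed.

(** The Caratheodory slope of [b] at [p] is the regular part of [b w / (w - p)]. *)
Lemma pole_of_cdiff (b g : C -> C) (p : R) : cdiff b (RtoC p) ->
  (forall w, w <> RtoC p -> g w = b w * / (w - RtoC p))%C -> pole g p (b (RtoC p)).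
Proof.
intros [phi [Hphi [d [Hd H]]]] Hg. exists phi; split; [exact Hphi|].
exists d; split; [exact Hd|]. intros w H1 H2 Hw.
rewrite (Hg w Hw), (H w); [|exact H1|].
- field. apply Cminus_neq_0, Hw.
- simpl. unfold Im in *; simpl. rewrite Rminus_0_r. exact H2.
Qed.

Lemma csin_shift (om p : R) (w : C) : sin (om * p) = 0 ->
  (csin (RtoC om * w) = RtoC (cos (om * p)) * csin (RtoC om * (w - RtoC p)))%C.
Proof.
intros H. destruct w as [x y]. unfold csin; simpl.
replace (om * x - 0 * y) with (om * p + (om * (x + - p) - 0 * (y + - 0))) by ring.
set (q := om * (x + - p) - 0 * (y + - 0)).
rewrite sin_plus, cos_plus, H.
replace (om * (y + - 0) + 0 * (x + - p)) with (om * y + 0 * x) by ring.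
apply injective_projections; simpl; ring.
Qed.

Lemma cos_sq_of_sin_0 (x : R) : sin x = 0 -> cos x * cos x = 1.
Proof. intros H. generalize (sin2_cos2' x). rewrite H. lra. Qed.

Lemma csin_neq_0 (om : R) (z : C) : 0 < om -> (Im z <> 0 \/ sin (om * Re z) <> 0) ->
  csin (RtoC om * z) <> 0.
Proof.
intros Ho H E. apply csin_eq_0 in E. destruct z as [x y]; unfold Re, Im in *; simpl in *.
replace (om * x - 0 * y) with (om * x) in E by ring.
destruct E as [E1 E2]. destruct H as [H|H]; [|tauto].
apply H. apply Rmult_eq_reg_l with om; lra.
Qed.

Lemma cdiff_csin_scal (om : R) (z : C) : cdiff (fun w => csin (RtoC om * w)) z.
Proof.
apply (cdiff_comp csin (fun w => RtoC om * w)%C).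
- apply cdiff_csin.
- apply cdiff_scal, cdiff_id.
Qed.

(** Shifting by the zero [p] gives [csin (om w) = cos (om p) * om * csinc (om (w - p)) * (w - p)],
    so the residue is [a p / (om cos (om p))]. As [cos (om p)] is 1 or -1, it equals its inverse and
    may stand in the numerator. *)
Lemma pole_csin (a g : C -> C) (om p : R) : 0 < om -> sin (om * p) = 0 -> cdiff a (RtoC p) ->
  (forall w, w <> RtoC p -> g w = a w * / csin (RtoC om * w))%C ->
  pole g p (a (RtoC p) * RtoC (cos (om * p) / om))%C.
Proof.
intros Ho Hs Ha Hg.
assert (Hcc := cos_sq_of_sin_0 _ Hs).
set (e := cos (om * p)) in *.
assert (He : e <> 0) by (intros E; rewrite E in Hcc; lra).
assert (Heo : (RtoC e * RtoC om)%C <> 0).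
{ apply Cmult_neq_0; apply RtoC_neq_0; [exact He|lra]. }
assert (Hz : csinc (RtoC om * (RtoC p - RtoC p))%C = 1).
{ replace (RtoC om * (RtoC p - RtoC p))%C with (RtoC 0) by ring. apply csinc_0. }
pose (b := fun w => (a w * / (RtoC e * RtoC om * csinc (RtoC om * (w - RtoC p))))%C).
replace (a (RtoC p) * RtoC (e / om))%C with (b (RtoC p)).
- apply pole_of_cdiff.
  + apply cdiff_mult; [exact Ha|]. apply cdiff_inv.
    * apply cdiff_scal. apply (cdiff_comp csinc (fun w => RtoC om * (w - RtoC p))%C).
      -- replace (RtoC om * (RtoC p - RtoC p))%C with (RtoC 0) by ring. apply cdiff_csinc_0.
      -- apply cdiff_scal, cdiff_minus; [apply cdiff_id|apply cdiff_const].
    * rewrite Hz, Cmult_1_r. exact Heo.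
  + intros w Hw. rewrite (Hg w Hw). unfold b.
    rewrite (csin_shift om p w Hs), csinc_mul. fold e.
    set (s := csinc _).
    replace (RtoC e * (s * (RtoC om * (w - RtoC p))))%C with ((RtoC e * RtoC om * s) * (w - RtoC p))%C by ring.
    rewrite Cinv_mul. ring.
- unfold b. rewrite Hz. rewrite Cmult_1_r. f_equal.
  rewrite <- RtoC_mult, <- RtoC_inv; [|apply Rmult_integral_contrapositive; split; [exact He|lra]].
  f_equal. rewrite Rinv_mult. unfold Rdiv. f_equal.
  apply Rmult_eq_reg_l with e; [|exact He]. rewrite Rinv_r; lra.
Qed.

Definition CS (f : nat -> C) (n : nat) : C := @sum_n C_AbelianMonoid f n.

Lemma sum_SnC (f : nat -> C) (n : nat) :
  CS f (S n) = (CS f n + f (S n))%C.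
Proof. exact (sum_Sn (G:=C_AbelianMonoid) f n). Qed.

Lemma sum_OC (f : nat -> C) : CS f 0 = f 0%nat.
Proof. exact (sum_O (G:=C_AbelianMonoid) f). Qed.

Lemma Csum_map_seq (f : nat -> R * C) (n : nat) :
  Csum (map f (seq 0 (S n))) = CS (fun i => snd (f i)) n.
Proof.
assert (H : forall l s, fold_right (fun pr s => snd pr + s)%C s l = (Csum l + s)%C).
{ induction l; intros s; simpl; [ring|]. rewrite IHl. unfold Csum; simpl. ring. }
induction n.
- rewrite sum_OC. simpl. apply Cplus_0_r.
- rewrite sum_SnC, <- IHn, seq_S, map_app. unfold Csum at 1. rewrite fold_right_app, H. simpl. rewrite Cplus_0_r. reflexivity.
Qed.

Lemma sum_n_scal_ext (a : C) (f g : nat -> C) (n : nat) :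
  (forall i, (i <= n)%nat -> f i = (a * g i)%C) ->
  CS f n = (a * CS g n)%C.
Proof.
induction n; intros H.
- rewrite !sum_OC. apply H; lia.
- rewrite !sum_SnC, IHn by (intros; apply H; lia). rewrite (H (S n)) by lia. ring.
Qed.

Lemma sum_n_zero (f : nat -> C) (n : nat) : (forall i, (i <= n)%nat -> f i = RtoC 0) ->
  CS f n = RtoC 0.
Proof.
intros H. rewrite (sum_n_scal_ext 0 f f n); [ring|]. intros i Hi; rewrite (H i Hi); ring.
Qed.

Lemma sum_n_single (f : nat -> C) (n j : nat) : (j <= n)%nat ->
  (forall i, (i <= n)%nat -> i <> j -> f i = RtoC 0) -> CS f n = f j.
Proof.
induction n; intros Hj H.
- rewrite sum_OC. f_equal; lia.
- rewrite sum_SnC. destruct (Nat.eq_dec j (S n)) as [->|Hn].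
  + rewrite sum_n_zero; [ring|]. intros; apply H; lia.
  + rewrite (H (S n)) by lia. rewrite IHn; [ring|lia|intros; apply H; lia].
Qed.

Lemma sum_Z_sym (g : Z -> C) (L : nat) :
  sum_Z g (Z.of_nat L) (Z.of_nat L) =
  CS (fun i => g (Z.of_nat i - Z.of_nat L)%Z) (2 * L).
Proof. unfold sum_Z, CS. do 2 f_equal. lia. Qed.

Lemma sin_multiple (om h : R) (k : Z) : om * h = PI -> sin (om * (IZR k * h)) = 0.
Proof.
intros H. apply sin_eq_0_1. exists k. rewrite <- H. ring.
Qed.

Lemma sinc_neq (x : R) : x <> 0 -> sinc x = sin x / x.
Proof. intros H. unfold sinc. destruct (Req_EM_T x 0); tauto. Qed.

Lemma sinc_0 : sinc 0 = 1.
Proof. unfold sinc. destruct (Req_EM_T 0 0); tauto. Qed.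

Lemma csin_zero_grid (om h x : R) (L : nat) : 0 < h -> om * h = PI ->
  Rabs x <= (INR L + / 2) * h -> sin (om * x) = 0 ->
  exists i, (i <= 2 * L)%nat /\ x = IZR (Z.of_nat i - Z.of_nat L) * h.
Proof.
intros Hh Hoh Hx Hs. apply sin_eq_0_0 in Hs. destruct Hs as [k Hk].
rewrite <- Hoh in Hk.
assert (Ho : om <> 0) by (intros ->; generalize PI_RGT_0; lra).
assert (E : x = IZR k * h) by (apply Rmult_eq_reg_l with om; lra).
assert (Hkl : Rabs (IZR k) < INR L + 1).
{ rewrite E, Rabs_mult, (Rabs_pos_eq h) in Hx by lra.
  apply Rmult_le_reg_r in Hx; lra. }
rewrite <- abs_IZR, INR_IZR_INZ, <- plus_IZR in Hkl. apply lt_IZR in Hkl.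
exists (Z.to_nat (k + Z.of_nat L)). split; [lia|].
rewrite E. do 2 f_equal. lia.
Qed.

(** The residue at [u] is [F u / sin (om u)], that at a node [p] is
    [F p * cos (om p) / (om (p - u))]. After multiplication by [sin (om u)] the latter is
    [- F p * sinc (om (u - p))], because [sin (om (u - p)) = sin (om u) cos (om p)]. *)
Theorem cardinal_interpolation (F : C -> C) (om h t u : R) (L : nat) :
  0 < h -> om * h = PI -> 0 < t ->
  (forall x y, - ((INR L + / 2) * h) <= x <= (INR L + / 2) * h -> - t <= y <= t -> cdiff F (x, y)) ->
  - ((INR L + / 2) * h) < u < (INR L + / 2) * h ->
  (F (RtoC u) - sum_Z (fun k => F (RtoC (IZR k * h)) * RtoC (sinc (om * (u - IZR k * h))))
     (Z.of_nat L) (Z.of_nat L) =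
   RtoC (sin (om * u)) * / (RtoC (2 * PI) * Ci) *
   contour (fun w => F w * / csin (RtoC om * w) * / (w - RtoC u))
     (- ((INR L + / 2) * h)) ((INR L + / 2) * h) (- t) t)%C.
Proof.
intros Hh Hoh Ht HF Hu. set (X := (INR L + / 2) * h) in *.
assert (HL := pos_INR L).
assert (HX : 0 < X) by (apply Rmult_lt_0_compat; lra).
assert (Ho : 0 < om).
{ apply Rmult_lt_reg_r with h; [exact Hh|]. rewrite Rmult_0_l, Hoh. apply PI_RGT_0. }
rewrite sum_Z_sym.
(* When [u] is a node, two simple poles would merge into a double one. This case is settled
   directly: the sum reduces to [F u], and the factor [sin (om u)] makes the right-hand side 0. *)
destruct (Req_dec (sin (om * u)) 0) as [Hs0|Hs0].
{ rewrite Hs0, !Cmult_0_l.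
  destruct (csin_zero_grid om h u L Hh Hoh) as [j [Hj ->]]; [apply Rabs_le; unfold X in *; lra|exact Hs0|].
  rewrite (sum_n_single _ _ j Hj).
  - rewrite Rminus_diag, Rmult_0_r, sinc_0. ring.
  - intros i Hi Hij.
    assert (Hne : IZR (Z.of_nat j - Z.of_nat L) * h - IZR (Z.of_nat i - Z.of_nat L) * h <> 0).
    { rewrite <- Rmult_minus_distr_r, <- minus_IZR. apply Rmult_integral_contrapositive. split; [|lra].
      apply not_0_IZR. lia. }
    rewrite sinc_neq; [|apply Rmult_integral_contrapositive; split; [lra|exact Hne]].
    rewrite <- Rmult_minus_distr_r, <- minus_IZR, sin_multiple by exact Hoh.
    unfold Rdiv. rewrite Rmult_0_l. ring. }
pose (p := fun i : nat => IZR (Z.of_nat i - Z.of_nat L) * h).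
pose (r := fun i : nat => (F (RtoC (p i)) * / (RtoC (p i) - RtoC u) * RtoC (cos (om * p i) / om))%C).
set (g := fun w => (F w * / csin (RtoC om * w) * / (w - RtoC u))%C).
assert (Hp : forall i, sin (om * p i) = 0) by (intros i; apply sin_multiple, Hoh).
assert (Hpu : forall i, p i <> u) by (intros i E; apply Hs0; rewrite <- E; apply Hp).
assert (HpX : forall i, (i <= 2 * L)%nat -> - X < p i < X).
{ intros i Hi. unfold p, X. rewrite INR_IZR_INZ, minus_IZR.
  assert (0 <= IZR (Z.of_nat i) <= 2 * IZR (Z.of_nat L)).
  { rewrite <- mult_IZR. split; apply IZR_le; lia. }
  split; [|apply Rmult_lt_compat_r; lra].
  rewrite Ropp_mult_distr_l. apply Rmult_lt_compat_r; lra. }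
assert (Hcd : forall x y, - X <= x <= X -> - t <= y <= t -> (y <> 0 \/ sin (om * x) <> 0) -> (x, y) <> RtoC u ->
   cdiff g (x, y)).
{ intros x y Hx Hy Hsn Hne. apply cdiff_mult; [apply cdiff_mult; [apply HF; assumption|]|].
  - apply cdiff_inv; [apply cdiff_csin_scal|]. apply csin_neq_0; assumption.
  - apply cdiff_inv_pole, Hne. }
assert (exists ls, ls = seq 0 (S (2 * L))) as [ls Els] by (eexists; reflexivity).
assert (Hls : forall i, In i ls <-> (i <= 2 * L)%nat).
{ intros i. rewrite Els, in_seq. lia. }
assert (Hnd : NoDup ls) by (rewrite Els; apply seq_NoDup).
assert (HR := residue_real_poles
  ((u, (F (RtoC u) * / csin (RtoC om * RtoC u))%C) :: map (fun i => (p i, r i)) ls)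
  g X t HX Ht).
assert (Hsu : csin (RtoC om * RtoC u) = RtoC (sin (om * u))).
{ rewrite <- RtoC_mult. unfold csin; simpl. rewrite cosh_0, sinh_0. apply injective_projections; simpl; ring. }
rewrite HR; clear HR.
- change (Csum ((u, (F (RtoC u) * / csin (RtoC om * RtoC u))%C) :: map (fun i => (p i, r i)) ls))
    with (F (RtoC u) * / csin (RtoC om * RtoC u) + Csum (map (fun i => (p i, r i)) ls))%C.
  rewrite Els, Csum_map_seq, Hsu.
  rewrite (sum_n_scal_ext (- RtoC (sin (om * u))) _ (fun i => snd (p i, r i))).
  + field. repeat split; first [apply RtoC_neq_0, Hs0 | apply RtoC_neq_0; generalize PI_RGT_0; lra
      | intros E; injection E; lra].
  + intros i Hi. simpl snd. fold (p i). unfold r.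
    rewrite sinc_neq.
    2:{ apply Rmult_integral_contrapositive; split; [lra|]. generalize (Hpu i); lra. }
    replace (om * (u - p i)) with (om * u - om * p i) at 1 by ring.
    rewrite sin_minus, Hp, Rmult_0_r, Rminus_0_r.
    rewrite <- RtoC_minus. rewrite <- RtoC_inv by (generalize (Hpu i); lra).
    rewrite <- RtoC_opp, <- !Cmult_assoc, <- !RtoC_mult.
    rewrite (Cmult_comm (RtoC (- sin (om * u)))), <- !Cmult_assoc, <- !RtoC_mult.
    do 2 f_equal. field. split; generalize (Hpu i); lra.
- intros x y Hx Hy Hy0. apply Hcd; try assumption; [left; exact Hy0|].
  intros E. injection E; intros; lra.
- intros x Hx Hin. simpl in Hin. apply cdiff_continuous, Hcd; [exact Hx|lra| |].
  + right. intros Hs. apply Hin. right.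
    destruct (csin_zero_grid om h x L Hh Hoh) as [j [Hj ->]]; [apply Rabs_le; unfold X in *; lra|exact Hs|].
    rewrite map_map. apply (in_map p). apply Hls, Hj.
  + intros E. apply Hin. left. injection E; auto.
- intros q s Hin. destruct Hin as [E|Hin].
  + injection E; intros <- <-. split; [exact Hu|].
    apply (pole_of_cdiff (fun w => F w * / csin (RtoC om * w))%C g u).
    * apply cdiff_mult; [apply HF; lra|]. apply cdiff_inv; [apply cdiff_csin_scal|].
      apply csin_neq_0; [exact Ho|right; exact Hs0].
    * intros w _; reflexivity.
  + apply in_map_iff in Hin. destruct Hin as [i [E Hin]]. injection E; intros <- <-.
    assert (Hi := proj1 (Hls i) Hin).
    assert (HiX := HpX i Hi). split; [exact HiX|].
    apply (pole_csin (fun w => F w * / (w - RtoC u))%C g om (p i) Ho (Hp i)).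
    * apply cdiff_mult; [apply HF; lra|]. apply cdiff_inv_pole.
      intros E'; injection E'; apply Hpu.
    * intros w _. unfold g. ring.
- simpl map. rewrite map_map.
  constructor.
  + intros Hin. apply in_map_iff in Hin. destruct Hin as [i [E _]]. exact (Hpu i E).
  + apply NoDup_map_NoDup_ForallPairs; [|exact Hnd].
    intros i j _ _ E. unfold p in E. apply Rmult_eq_reg_r in E; [|lra]. apply eq_IZR in E. lia.
Qed.

(** * Interchanging integrals *)

Definition cont2 (phi : R -> R -> C) (x y : R) : Prop :=
  @continuous (prod_UniformSpace R_UniformSpace R_UniformSpace) C_UniformSpace
    (fun p => phi (fst p) (snd p)) (x, y).

Lemma cont2_swap (phi : R -> R -> C) (x y : R) : cont2 phi x y -> cont2 (fun s u => phi u s) y x.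
Proof.
intros H. unfold cont2.
apply (continuous_comp_2 (U:=prod_UniformSpace R_UniformSpace R_UniformSpace)
  (V:=R_UniformSpace) (W:=R_UniformSpace) (X:=C_UniformSpace) snd fst phi (y, x)).
- apply (@continuous_snd R_UniformSpace R_UniformSpace).
- apply (@continuous_fst R_UniformSpace R_UniformSpace).
- exact H.
Qed.

Lemma cont2_fst (phi : R -> R -> C) (x y : R) : cont2 phi x y ->
  @continuous R_UniformSpace C_UniformSpace (fun u => phi u y) x.
Proof.
intros H. apply (continuous_comp_2 (U:=R_UniformSpace)
  (V:=R_UniformSpace) (W:=R_UniformSpace) (X:=C_UniformSpace) (fun u => u) (fun _ => y) phi x).
- apply continuous_id.
- apply continuous_const.
- exact H.
Qed.

Lemma cont2_snd (phi : R -> R -> C) (x y : R) : cont2 phi x y ->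
  @continuous R_UniformSpace C_UniformSpace (fun s => phi x s) y.
Proof. intros H. apply (cont2_fst (fun s u => phi u s)), cont2_swap, H. Qed.

(** Uniformity in [s] comes from the compactness of the segment [{u0} x [c, d]], applied to both
    coordinates of the value. *)
Lemma cont2_uniform (phi : R -> R -> C) (u0 c d eps : R) : 0 < eps ->
  (forall s, c <= s <= d -> cont2 phi u0 s) ->
  exists delta, 0 < delta /\ forall u s, Rabs (u - u0) < delta -> c <= s <= d ->
    Cmod (phi u s - phi u0 s) < eps.
Proof.
intros He H. assert (He2 : 0 < eps / 2) by lra.
destruct (uniform_continuity_2d_1d' (fun u s => Re (phi u s)) c d u0) with (eps := mkposreal _ He2) as [d1 H1].
{ intros s Hs. apply continuity_2d_pt_filterlim. exact (continuous_Re _ _ (H s Hs)). }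
destruct (uniform_continuity_2d_1d' (fun u s => Im (phi u s)) c d u0) with (eps := mkposreal _ He2) as [d2 H2].
{ intros s Hs. apply continuity_2d_pt_filterlim. exact (continuous_Im _ _ (H s Hs)). }
exists (Rmin d1 d2); split; [apply Rmin_pos; apply cond_pos|].
intros u s Hu Hs.
assert (L1 := Rmin_l d1 d2). assert (L2 := Rmin_r d1 d2).
apply Rabs_def2 in Hu.
assert (P1 := cond_pos d1). assert (P2 := cond_pos d2).
specialize (H1 s u0 s u Hs ltac:(lra) Hs ltac:(lra) ltac:(rewrite Rminus_diag, Rabs_R0; lra)).
specialize (H2 s u0 s u Hs ltac:(lra) Hs ltac:(lra) ltac:(rewrite Rminus_diag, Rabs_R0; lra)).
simpl in H1, H2. eapply Rle_lt_trans; [apply Cmod_le_Rabs|].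
change (Rabs (Re (phi u s) - Re (phi u0 s)) + Rabs (Im (phi u s) - Im (phi u0 s)) < eps). lra.
Qed.

Lemma continuous_RC_eps (f : R -> C) (x : R) :
  (forall eps, 0 < eps -> exists delta, 0 < delta /\ forall y, Rabs (y - x) < delta -> Cmod (f y - f x) < eps) ->
  @continuous R_UniformSpace C_UniformSpace f x.
Proof.
intros H P [eps HP]. destruct (H eps (cond_pos eps)) as [d [Hd HH]].
exists (mkposreal d Hd). intros y Hy. apply HP.
specialize (HH y Hy). destruct (Re_Im_le_Cmod (f y - f x)) as [A B].
split.
- eapply Rle_lt_trans; [apply A|apply HH].
- eapply Rle_lt_trans; [apply B|apply HH].
Qed.

Lemma CI_param_continuous (phi : R -> R -> C) (u0 c d eta : R) : c <= d -> 0 < eta ->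
  (forall u s, Rabs (u - u0) < eta -> c <= s <= d -> cont2 phi u s) ->
  @continuous R_UniformSpace C_UniformSpace (fun u => CI (phi u) c d) u0.
Proof.
intros Hcd Heta H.
assert (E : forall u, Rabs (u - u0) < eta -> exC (phi u) c d).
{ intros u Hu. apply exC_continuous; [exact Hcd|]. intros s Hs. apply (cont2_snd phi), H; assumption. }
assert (Z : Rabs (u0 - u0) < eta) by (rewrite Rminus_diag, Rabs_R0; exact Heta).
apply continuous_RC_eps. intros eps He.
(* [d - c + 1] in place of [d - c], which may be 0. *)
assert (He' : 0 < eps / (d - c + 1)) by (apply Rdiv_lt_0_compat; lra).
destruct (cont2_uniform phi u0 c d _ He') as [delta [Hd HH]].
{ intros s Hs. apply H; assumption. }
exists (Rmin delta eta); split; [apply Rmin_pos; assumption|].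
intros u Hu.
assert (Hu1 := Rlt_le_trans _ _ _ Hu (Rmin_l _ _)). assert (Hu2 := Rlt_le_trans _ _ _ Hu (Rmin_r _ _)).
rewrite <- CI_minus by (apply E; assumption).
apply Rle_lt_trans with ((d - c) * (eps / (d - c + 1))).
- apply CI_norm_const; [exact Hcd|apply exC_minus; apply E; assumption|].
  intros s Hs. apply Rlt_le, HH; assumption.
- apply Rlt_le_trans with ((d - c + 1) * (eps / (d - c + 1))).
  + apply Rmult_lt_compat_r; lra.
  + right. field. lra.
Qed.

Lemma exC_swap (g : R -> C) (a b : R) : exC g a b -> exC g b a.
Proof. exact (ex_RInt_swap (V:=C_R_NormedModule) g a b). Qed.

Lemma CI_swap (g : R -> C) (a b : R) : exC g a b -> CI g b a = (- CI g a b)%C.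
Proof. intros H. symmetry. exact (opp_RInt_swap (V:=C_R_CompleteNormedModule) g a b H). Qed.

Lemma CI_norm_Rabs (g : R -> C) (M a b : R) : exC g a b ->
  (forall x, Rmin a b <= x <= Rmax a b -> Cmod (g x) <= M) -> Cmod (CI g a b) <= Rabs (b - a) * M.
Proof.
intros Hg H. destruct (Rle_lt_dec a b) as [Hab|Hab].
- rewrite Rmin_left, Rmax_right in H by exact Hab. rewrite Rabs_pos_eq by lra.
  apply CI_norm_const; assumption.
- rewrite Rmin_right, Rmax_left in H by lra. rewrite Rabs_left by lra.
  rewrite (CI_swap g b a) by (apply exC_swap, Hg). rewrite Cmod_opp.
  replace (- (b - a)) with (a - b) by ring. apply CI_norm_const; [lra|apply exC_swap, Hg|exact H].
Qed.

(** The iterated integral [K x], with [b] replaced by [x], has derivative [CI (phi x) c d] and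
    vanishes at [a], so the fundamental theorem gives the claim. The margin [eta] provides two-sided
    derivatives at the endpoints. *)
Theorem CI_Fubini (phi : R -> R -> C) (a b c d eta : R) : a <= b -> c <= d -> 0 < eta ->
  (forall u s, a - eta < u < b + eta -> c - eta < s < d + eta -> cont2 phi u s) ->
  @is_RInt C_R_NormedModule (fun u => CI (fun s => phi u s) c d) a b
    (CI (fun s => CI (fun u => phi u s) a b) c d).
Proof.
intros Hab Hcd Heta H.
assert (E1 : forall s x y, a - eta < x < b + eta -> a - eta < y < b + eta -> c - eta < s < d + eta ->
   exC (fun u => phi u s) x y).
{ intros s x y Hx Hy Hs. apply (ex_RInt_continuous (V:=C_R_CompleteNormedModule)).
  intros u Hu. apply (cont2_fst phi), H; [|exact Hs].
  revert Hu; unfold Rmin, Rmax; destruct (Rle_dec x y); lra. }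
assert (E2 : forall u, a - eta < u < b + eta -> exC (phi u) c d).
{ intros u Hu. apply exC_continuous; [exact Hcd|]. intros s Hs. apply (cont2_snd phi), H; [exact Hu|lra]. }
pose (K := fun x => CI (fun s => CI (fun u => phi u s) a x) c d).
assert (HI : forall x, a <= x <= b -> @continuous R_UniformSpace C_UniformSpace (fun u => CI (fun s => phi u s) c d) x).
{ intros x Hx. apply (CI_param_continuous phi x c d eta Hcd Heta).
  intros u s Hu Hs. apply Rabs_def2 in Hu. apply H; lra. }
assert (HC : forall s x y, a - eta < x -> x <= y -> y < b + eta -> c <= s <= d ->
   @continuous R_UniformSpace C_UniformSpace (fun s => CI (fun u => phi u s) x y) s).
{ intros s x y Hx Hxy Hy Hs. apply (CI_param_continuous (fun s u => phi u s) s x y eta Hxy Heta).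
  intros s' u Hs' Hu. apply Rabs_def2 in Hs'. apply cont2_swap, H; lra. }
assert (E3 : forall x y, a - eta < x < b + eta -> a - eta < y < b + eta -> exC (fun s => CI (fun u => phi u s) x y) c d).
{ intros x y Hx Hy. destruct (Rle_lt_dec x y).
  - apply exC_continuous; [exact Hcd|]. intros s Hs. apply HC; lra || exact Hs.
  - apply exC_continuous; [exact Hcd|]. intros s Hs.
    apply (continuous_ext_loc _ (fun s => - CI (fun u => phi u s) y x)%C).
    + exists (mkposreal eta Heta). intros s' Hs'. symmetry.
      apply Rabs_def2 in Hs'. unfold minus, plus, opp in Hs'; simpl in Hs'.
      apply CI_swap, E1; lra.
    + apply continuous_Copp, HC; lra || exact Hs. }
assert (HK : forall x, a <= x <= b -> @is_derive R_AbsRing C_R_NormedModule K x (CI (fun s => phi x s) c d)).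
{ intros x Hx. split; [apply is_linear_scal_l|].
  intros x' Hx'. apply (is_filter_lim_locally_unique (K:=R_AbsRing) (V:=R_NormedModule)) in Hx'. subst x'. intros eps.
  assert (He' : 0 < eps / (d - c + 1)) by (apply Rdiv_lt_0_compat; [apply cond_pos|lra]).
  destruct (cont2_uniform phi x c d _ He') as [delta [Hd HH]].
  { intros s Hs. apply H; lra. }
  assert (Hm : 0 < Rmin delta eta) by (apply Rmin_pos; assumption).
  exists (mkposreal _ Hm). intros y Hy.
  change (Rabs (y - x) < Rmin delta eta) in Hy.
  assert (Hy1 := Rlt_le_trans _ _ _ Hy (Rmin_l _ _)). assert (Hy2 := Rlt_le_trans _ _ _ Hy (Rmin_r _ _)).
  apply Rabs_def2 in Hy2.
  eapply Rle_trans; [right; symmetry; apply (Cmod_norm (minus (minus (K y) (K x)) (scal (minus y x) (CI (fun s => phi x s) c d))))|].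
  change (Cmod (K y - K x - scal (minus y x) (CI (fun s => phi x s) c d)) <= eps * Rabs (y - x)).
  assert (Sc : forall (r : R) (z : C), @scal R_AbsRing C_R_NormedModule r z = (RtoC r * z)%C).
  { intros r [z1 z2]. unfold scal; simpl. unfold prod_scal; simpl.
    apply injective_projections; simpl; unfold scal; simpl; unfold mult; simpl; ring. }
  rewrite Sc. change (minus y x) with (y - x).
  assert (Hx0 : a - eta < x < b + eta) by lra. assert (Hy0 : a - eta < y < b + eta) by lra.
  assert (Ha0 : a - eta < a < b + eta) by lra.
  assert (X1 := E3 a x Ha0 Hx0). assert (X2 := E3 a y Ha0 Hy0). assert (X3 := E3 x y Hx0 Hy0).
  assert (X4 := E2 x Hx0).
  (* The remainder is the double integral of [phi u s - phi x s] for [u] between [x] and [y], which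
     is uniformly small. *)
  assert (Kd : (K y - K x - RtoC (y - x) * CI (fun s => phi x s) c d)%C =
    CI (fun s => CI (fun u => phi u s) x y - RtoC (y - x) * phi x s)%C c d).
  { rewrite CI_minus, CI_scal; try assumption; [|apply exC_scal, X4].
    f_equal. unfold K. rewrite <- CI_minus by assumption. apply CI_ext; [exact Hcd|].
    intros s Hs. rewrite (CI_Chasles _ a x y); [ring|apply E1; lra|apply E1; lra]. }
  rewrite Kd.
  apply Rle_trans with ((d - c) * (Rabs (y - x) * (eps / (d - c + 1)))).
  - apply CI_norm_const; [exact Hcd|apply exC_minus; [exact X3|apply exC_scal, X4]|].
    intros s Hs. rewrite <- CI_const, <- CI_minus; [|apply E1; lra|apply (ex_RInt_const (V:=C_R_NormedModule))].
    apply CI_norm_Rabs.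
    + apply exC_minus; [apply E1; lra|apply (ex_RInt_const (V:=C_R_NormedModule))].
    + intros u Hu. apply Rlt_le, HH; [|exact Hs]. apply Rabs_def2 in Hy1. apply Rabs_def1;
      revert Hu; unfold Rmin, Rmax; destruct (Rle_dec x y); lra.
  - replace ((d - c) * (Rabs (y - x) * (eps / (d - c + 1)))) with ((d - c) / (d - c + 1) * (eps * Rabs (y - x))) by (field; lra).
    rewrite <- (Rmult_1_l (eps * Rabs (y - x))) at 2. apply Rmult_le_compat_r.
    + apply Rmult_le_pos; [apply Rlt_le, cond_pos|apply Rabs_pos].
    + apply Rmult_le_reg_r with (d - c + 1); [lra|]. unfold Rdiv. rewrite Rmult_assoc, Rinv_l; lra. }
assert (HR := is_RInt_derive (V:=C_R_CompleteNormedModule) K (fun u => CI (fun s => phi u s) c d) a b).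
rewrite Rmin_left, Rmax_right in HR by exact Hab.
specialize (HR HK HI).
assert (K0 : K a = 0).
{ unfold K. rewrite (CI_ext _ (fun _ => RtoC 0)); [rewrite CI_const; ring|exact Hcd|].
  intros s _. unfold CI. rewrite RInt_point. reflexivity. }
change (minus (K b) (K a)) with (K b - K a)%C in HR. rewrite K0 in HR.
replace (K b - 0)%C with (K b) in HR by ring. exact HR.
Qed.

(** * The sinc kernel integrated along the sides *)

(* With [theta = PI / 2 - atan y] this is [sin theta <= theta]. *)
Lemma inv_sqrt_atan_le (y : R) : / sqrt (1 + y * y) + atan y <= PI / 2.
Proof.
generalize (cos_atan y) (atan_bound y). intros Hc Hb.
assert (Hs := Rabs_sin_le (PI / 2 - atan y)).
rewrite sin_minus, sin_PI2, cos_PI2, Hc in Hs.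
rewrite (Rabs_pos_eq (PI / 2 - atan y)) in Hs by lra.
apply Rabs_le_between in Hs. unfold Rdiv, Rsqr in Hs. lra.
Qed.

Definition kern (om a b : R) (z : C) : C :=
  CI (fun u => RtoC (sin (om * u)) * / (z - RtoC u))%C a b.

Lemma continuous_RtoC {U : UniformSpace} (f : U -> R) (x : U) : continuous f x ->
  @continuous U C_UniformSpace (fun y => RtoC (f y)) x.
Proof. intros H. apply continuous_pair; [exact H|apply continuous_const]. Qed.

Lemma continuous_sin_scal (om u : R) : continuous (fun u => sin (om * u)) u.
Proof. apply (ex_derive_continuous (fun u => sin (om * u))). auto_derive. exact I. Qed.

Lemma continuous_kern (om u : R) (z : C) : z <> RtoC u ->
  @continuous R_UniformSpace C_UniformSpace (fun u => RtoC (sin (om * u)) * / (z - RtoC u))%C u.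
Proof.
intros H. apply continuous_Cmult.
- apply continuous_RtoC, continuous_sin_scal.
- apply (continuous_Cinv (fun u => z - RtoC u)%C).
  + apply continuous_Cplus; [apply continuous_const|].
    apply continuous_Copp, continuous_RtoC, continuous_id.
  + apply Cminus_neq_0, H.
Qed.

Lemma exC_kern (om a b : R) (z : C) : a <= b -> (forall u, a <= u <= b -> z <> RtoC u) ->
  exC (fun u => RtoC (sin (om * u)) * / (z - RtoC u))%C a b.
Proof.
intros Hab Hz. apply exC_continuous; [exact Hab|].
intros u Hu. apply continuous_kern, Hz, Hu.
Qed.

(* Integration by parts, so that the bound does not grow logarithmically with the interval. *)
Lemma kern_hor_bound (om a b s y : R) : 0 < om -> a <= b -> y <> 0 ->
  Cmod (kern om a b (s, y)) <= / om * (PI / Rabs y).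
Proof.
intros Ho Hab Hy.
assert (Hne : forall u, (s, y) <> RtoC u) by (intros u E; injection E; lra).
assert (Hne' : forall u, ((s, y) - RtoC u)%C <> 0) by (intros u; apply Cminus_neq_0, Hne).
assert (Hden : forall u, (s - u) * (s - u) + y * y <> 0).
{ intros u. apply sum_sq_neq. right; exact Hy. }
assert (Hr : forall u, @continuous R_UniformSpace C_UniformSpace (fun u => / ((s, y) - RtoC u))%C u).
{ intros u. apply (continuous_Cinv (fun u => (s, y) - RtoC u)%C); [|apply Hne'].
  apply continuous_Cplus; [apply continuous_const|]. apply continuous_Copp, continuous_RtoC, continuous_id. }
assert (Hcos : forall u, continuous (fun u => cos (om * u)) u).
{ intros u. apply (ex_derive_continuous (fun u => cos (om * u))). auto_derive. exact I. }
pose (P := fun u => (RtoC (cos (om * u)) * / ((s, y) - RtoC u))%C).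
pose (q := fun u => (RtoC (cos (om * u)) * (/ ((s, y) - RtoC u) * / ((s, y) - RtoC u)))%C).
assert (Hq : exC q a b).
{ apply exC_continuous; [exact Hab|]. intros u _. apply continuous_Cmult; [apply continuous_RtoC, Hcos|].
  apply continuous_Cmult; apply Hr. }
assert (Hk : exC (fun u => RtoC (sin (om * u)) * / ((s, y) - RtoC u))%C a b).
{ apply exC_kern; [exact Hab|]. intros; apply Hne. }
assert (HI : CI (fun u => q u - RtoC om * (RtoC (sin (om * u)) * / ((s, y) - RtoC u)))%C a b = (P b - P a)%C).
{ apply CI_unique. apply (is_CI_derive P); [exact Hab|..].
  - intros u Hu. unfold P, q. simpl. auto_derive.
    + repeat split; intros E; apply (Hden u); rewrite <- E; ring.
    + field. intros E; apply (Hden u); rewrite <- E; ring.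
  - intros u Hu. unfold P, q. simpl. auto_derive.
    + repeat split; intros E; apply (Hden u); rewrite <- E; ring.
    + field. intros E; apply (Hden u); rewrite <- E; ring.
  - intros u Hu. apply continuous_Cplus.
    + apply continuous_Cmult; [apply continuous_RtoC, Hcos|]. apply continuous_Cmult; apply Hr.
    + apply continuous_Copp, continuous_Cmult; [apply continuous_const|].
      apply continuous_kern, Hne. }
rewrite CI_minus, CI_scal in HI; [|exact Hk|exact Hq|apply exC_scal, Hk].
fold (kern om a b (s, y)) in HI.
assert (Ek : (RtoC om * kern om a b (s, y) = CI q a b - P b + P a)%C).
{ replace (P a) with (P b - (P b - P a))%C by ring. rewrite <- HI. ring. }
set (t := Rabs y). assert (Ht : 0 < t) by (apply Rabs_pos_lt, Hy).
assert (Htt : t * t = y * y) by (unfold t; rewrite <- Rabs_mult; apply Rabs_pos_eq; nra).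
assert (Hcb : forall x, Cmod (RtoC (cos x)) <= 1).
{ intros x. rewrite Cmod_R. apply Rabs_le. apply COS_bound. }
assert (Hm : forall u, Cmod (/ ((s, y) - RtoC u)) = / sqrt ((s - u) * (s - u) + t * t)).
{ intros u. rewrite Cmod_inv by apply Hne'. f_equal. rewrite Htt. unfold Cmod. f_equal. simpl. ring. }
assert (Hpos : forall u, 0 < (s - u) * (s - u) + t * t).
{ intros u. assert (0 < t * t) by nra. generalize (Rle_0_sqr (s - u)). unfold Rsqr. lra. }
(* The right-hand side is the integral of [1 / (v^2 + t^2)] over [v >= w]. Each boundary term is
   thus at most the part of this integral beyond its endpoint, and together they complete the
   integral over [[a, b]] to the one over the whole line, [PI / t]. *)
assert (Hw : forall w, / sqrt (w * w + t * t) <= (PI / 2 - atan (w / t)) / t).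
{ intros w. generalize (inv_sqrt_atan_le (w / t)); intros G.
  replace (w * w + t * t) with (t * t * (1 + w / t * (w / t))) by (field; lra).
  assert (0 <= w / t * (w / t)) by apply Rle_0_sqr.
  rewrite sqrt_mult by nra. rewrite sqrt_square by lra. rewrite Rinv_mult.
  unfold Rdiv at 3. rewrite (Rmult_comm (/ t)). apply Rmult_le_compat_r; [apply Rlt_le, Rinv_0_lt_compat, Ht|].
  lra. }
assert (Bq : Cmod (CI q a b) <= (atan ((b - s) / t) - atan ((a - s) / t)) / t).
{ assert (HB : is_RInt (fun u => / ((s - u) * (s - u) + t * t)) a b ((atan ((b - s) / t) - atan ((a - s) / t)) / t)).
  { replace ((atan ((b - s) / t) - atan ((a - s) / t)) / t) with
      (minus (atan ((b - s) / t) / t) (atan ((a - s) / t) / t)) by (unfold minus, plus, opp; simpl; field; lra).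
    apply (is_RInt_derive (V:=R_CompleteNormedModule) (fun u => atan ((u - s) / t) / t)).
    - intros u _. auto_derive; [exact I|]. unfold Rsqr. generalize (Hpos u). intros. field. split; nra.
    - intros u _. apply (ex_derive_continuous (fun u => / ((s - u) * (s - u) + t * t))). auto_derive.
      generalize (Hpos u). intros; nra. }
  rewrite <- (is_RInt_unique _ _ _ _ HB). apply CI_norm; try assumption.
  - eexists; exact HB.
  - intros u _. unfold q. rewrite !Cmod_mult, !Hm.
    rewrite <- Rinv_mult, sqrt_sqrt by (generalize (Hpos u); lra).
    rewrite <- (Rmult_1_l (/ ((s - u) * (s - u) + t * t))) at 2. apply Rmult_le_compat_r; [|apply Hcb].
    apply Rlt_le, Rinv_0_lt_compat, Hpos. }
assert (BP : forall u, Cmod (P u) <= / sqrt ((s - u) * (s - u) + t * t)).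
{ intros u. unfold P. rewrite Cmod_mult, Hm. rewrite <- (Rmult_1_l (/ sqrt _)) at 2.
  apply Rmult_le_compat_r; [|apply Hcb]. apply Rlt_le, Rinv_0_lt_compat, sqrt_lt_R0, Hpos. }
assert (Bb := Rle_trans _ _ _ (BP b) ltac:(replace ((s - b) * (s - b)) with ((b - s) * (b - s)) by ring; apply Hw)).
assert (Ba := Rle_trans _ _ _ (BP a) (Hw (s - a))).
replace ((s - a) / t) with (- ((a - s) / t)) in Ba by (field; lra). rewrite atan_opp in Ba.
apply Rmult_le_reg_l with om; [exact Ho|].
rewrite <- Rmult_assoc, Rinv_r, Rmult_1_l by lra.
rewrite <- (Rabs_pos_eq om) at 1 by lra. rewrite <- Cmod_R, <- Cmod_mult, Ek.
eapply Rle_trans; [apply Cmod_triangle|]. unfold Cminus.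
eapply Rle_trans; [apply Rplus_le_compat_r, Cmod_triangle|]. rewrite Cmod_opp.
replace (PI / t) with ((atan ((b - s) / t) - atan ((a - s) / t)) / t + (PI / 2 - atan ((b - s) / t)) / t
  + (PI / 2 - - atan ((a - s) / t)) / t) by (field; lra).
lra.
Qed.

(** Crude, but enough for the vertical sides, where the decay of [F] makes the contribution vanish
    in the limit. *)
Lemma kern_ver_bound (om a b D : R) (z : C) : a <= b -> 0 < D ->
  (forall u, a <= u <= b -> D <= Rabs (Re z - u)) ->
  Cmod (kern om a b z) <= (b - a) / D.
Proof.
intros Hab HD H.
assert (Hne : forall u, a <= u <= b -> z <> RtoC u).
{ intros u Hu E. specialize (H u Hu). rewrite E in H. simpl in H. rewrite Rminus_diag, Rabs_R0 in H. lra. }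
apply CI_norm_const; [exact Hab|apply exC_kern; assumption|].
intros u Hu. rewrite Cmod_mult, Cmod_R.
assert (Hn := Cminus_neq_0 _ _ (Hne u Hu)).
rewrite Cmod_inv by exact Hn.
rewrite <- (Rmult_1_l (/ D)). apply Rmult_le_compat.
- apply Rabs_pos.
- apply Rlt_le, Rinv_0_lt_compat, Cmod_gt_0, Hn.
- apply Rabs_le, SIN_bound.
- apply Rinv_le_contravar; [exact HD|]. eapply Rle_trans; [apply (H u Hu)|].
  apply (proj1 (Re_Im_le_Cmod (z - RtoC u))).
Qed.

(** One exchange of integrals for all four sides, parametrized by [gam]; the factor [dz] is left to
    [contour]. The existence statement is what the later norm bounds need. *)
Lemma side_integral (G : C -> C) (gam : R -> C) (om a b c d eta : R) : a <= b -> c <= d -> 0 < eta ->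
  (forall s, c - eta < s < d + eta -> @continuous R_UniformSpace C_UniformSpace (fun s => G (gam s)) s) ->
  (forall s, c - eta < s < d + eta -> @continuous R_UniformSpace C_UniformSpace gam s) ->
  (forall s u, c - eta < s < d + eta -> a - eta < u < b + eta -> gam s <> RtoC u) ->
  @is_RInt C_R_NormedModule
    (fun u => RtoC (sin (om * u)) * CI (fun s => G (gam s) * / (gam s - RtoC u)) c d)%C a b
    (CI (fun s => G (gam s) * kern om a b (gam s))%C c d) /\
  exC (fun s => G (gam s) * kern om a b (gam s))%C c d.
Proof.
intros Hab Hcd Heta HG Hgam Hne.
pose (phi := fun u s => (G (gam s) * (RtoC (sin (om * u)) * / (gam s - RtoC u)))%C).
assert (Hphi : forall u s, a - eta < u < b + eta -> c - eta < s < d + eta -> cont2 phi u s).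
{ intros u s Hu Hs. unfold cont2, phi.
  assert (Cs : @continuous (prod_UniformSpace R_UniformSpace R_UniformSpace) R_UniformSpace (fun p => snd p) (u, s))
   by apply (@continuous_snd R_UniformSpace R_UniformSpace).
  assert (Cf : @continuous (prod_UniformSpace R_UniformSpace R_UniformSpace) R_UniformSpace (fun p => fst p) (u, s))
   by apply (@continuous_fst R_UniformSpace R_UniformSpace).
  apply continuous_Cmult.
  - apply (continuous_comp (fun p => snd p) (fun s => G (gam s)) (u, s) Cs (HG s Hs)).
  - apply continuous_Cmult.
    + apply continuous_RtoC. apply (continuous_comp (fun p => fst p) (fun u => sin (om * u)) (u, s) Cf (continuous_sin_scal om u)).
    + apply (continuous_Cinv (fun p => gam (snd p) - RtoC (fst p))%C).
      * apply continuous_Cplus.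
        -- apply (continuous_comp (fun p => snd p) gam (u, s) Cs (Hgam s Hs)).
        -- apply continuous_Copp, continuous_RtoC, Cf.
      * apply Cminus_neq_0, Hne; assumption. }
assert (HF := CI_Fubini phi a b c d eta Hab Hcd Heta Hphi).
assert (Ek : forall s, c <= s <= d -> CI (fun u => phi u s) a b = (G (gam s) * kern om a b (gam s))%C).
{ intros s Hs. unfold phi. rewrite CI_scal; [reflexivity|].
  apply exC_kern; [exact Hab|]. intros; apply Hne; lra. }
assert (E1 : CI (fun s => CI (fun u => phi u s) a b) c d = CI (fun s => G (gam s) * kern om a b (gam s))%C c d).
{ apply CI_ext; [exact Hcd|exact Ek]. }
split.
- rewrite <- E1. refine (is_RInt_ext (V:=C_R_NormedModule) _ _ _ _ _ _ HF).
  rewrite Rmin_left, Rmax_right by exact Hab. intros u Hu.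
  rewrite <- CI_scal.
  + apply CI_ext; [exact Hcd|]. intros s _. unfold phi. ring.
  + apply exC_continuous; [exact Hcd|]. intros s Hs. apply continuous_Cmult; [apply HG; lra|].
    apply (continuous_Cinv (fun s => gam s - RtoC u)%C).
    * apply continuous_Cplus; [apply Hgam; lra|apply continuous_const].
    * apply Cminus_neq_0, Hne; lra.
- apply (ex_RInt_ext (V:=C_R_NormedModule) (fun s => CI (fun u => phi u s) a b)).
  + rewrite Rmin_left, Rmax_right by exact Hcd. intros s Hs. apply Ek; lra.
  + apply exC_continuous; [exact Hcd|]. intros s Hs.
    apply (CI_param_continuous (fun s u => phi u s) s a b eta Hab Heta).
    intros s' u Hs' Hu. apply Rabs_def2 in Hs'. apply cont2_swap, Hphi; lra.
Qed.

(** * Truncated indefinite interpolation error *)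

Lemma continuous_sinc (x : R) : continuous sinc x.
Proof.
destruct (Req_dec x 0) as [->|Hx].
- apply continuity_pt_filterlim. intros eps He.
  exists (Rmin 1 eps); split; [apply Rmin_pos; lra|].
  intros y [_ Hy]. simpl in *. unfold Rdist in *. rewrite Rminus_0_r in Hy. rewrite sinc_0.
  assert (Hy1 := Rlt_le_trans _ _ _ Hy (Rmin_l _ _)). assert (Hy2 := Rlt_le_trans _ _ _ Hy (Rmin_r _ _)).
  destruct (Req_dec y 0) as [->|Hy0]; [rewrite sinc_0, Rminus_diag, Rabs_R0; lra|].
  rewrite sinc_neq by exact Hy0.
  assert (Hp : 0 < Rabs y) by (apply Rabs_pos_lt, Hy0).
  replace (sin y / y - 1) with ((sin y - y) / y) by (field; exact Hy0).
  unfold Rdiv. rewrite Rabs_mult, Rabs_inv.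
  apply Rle_lt_trans with (Rabs y * Rabs y).
  + apply Rmult_le_reg_r with (Rabs y); [exact Hp|].
    rewrite Rmult_assoc, Rinv_l, Rmult_1_r by lra. apply sin_minus_id_le.
  + nra.
- apply (continuous_ext_loc _ (fun y => sin y / y)).
  + assert (Hp : 0 < Rabs x) by (apply Rabs_pos_lt, Hx).
    exists (mkposreal _ Hp). intros y Hy. symmetry. apply sinc_neq. intros ->.
    change (Rabs (0 - x) < Rabs x) in Hy. rewrite Rminus_0_l, Rabs_Ropp in Hy. lra.
  + apply (ex_derive_continuous (fun y => sin y / y)). auto_derive. tauto.
Qed.

Lemma ex_RInt_sinc (a b : R) : ex_RInt sinc a b.
Proof. apply (ex_RInt_continuous (V:=R_CompleteNormedModule)). intros; apply continuous_sinc. Qed.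

Lemma is_derive_Si (x : R) : is_derive Si x (sinc x).
Proof.
apply (is_derive_RInt (V:=R_NormedModule) sinc (fun x => RInt sinc 0 x) 0 x).
- exists (mkposreal 1 Rlt_0_1). intros y _.
  apply (RInt_correct (V:=R_CompleteNormedModule)), ex_RInt_sinc.
- apply continuous_sinc.
Qed.

(** [J] is a primitive of the cardinal function, and so appears when the interpolation formula is
    integrated in [u]. *)
Lemma is_derive_J (k h om u : R) : h <> 0 -> om * h = PI ->
  is_derive (fun u => J k h u) u (sinc (om * (u - k * h))).
Proof.
intros Hh Ho. unfold J.
assert (E : forall v, PI * (v / h - k) = om * (v - k * h)) by (intros v; rewrite <- Ho; field; exact Hh).
apply (is_derive_ext (fun v => h * (/ 2 + / PI * Si (om * (v - k * h))))).
{ intros v. rewrite E. reflexivity. }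
auto_derive.
- exists (sinc (om * (u - k * h))). apply is_derive_Si.
- rewrite (is_derive_unique _ _ _ (is_derive_Si _)).
  generalize PI_RGT_0; intros.
  replace (om * (u + - (k * h))) with (om * (u - k * h)) by ring. set (s := sinc _).
  transitivity (om * h / PI * s); [field; lra|]. rewrite Ho. field. lra.
Qed.

Lemma is_RInt_sinc_shift (k h om a b : R) : h <> 0 -> om * h = PI ->
  is_RInt (fun u => sinc (om * (u - k * h))) a b (J k h b - J k h a).
Proof.
intros Hh Ho.
apply (is_RInt_derive (V:=R_CompleteNormedModule) (fun u => J k h u)).
- intros u _. apply is_derive_J; assumption.
- intros u _. apply (continuous_comp (fun u => om * (u - k * h)) sinc); [|apply continuous_sinc].
  apply (ex_derive_continuous (fun u => om * (u - k * h))). auto_derive. exact I.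
Qed.

Lemma is_CI_CS (f : nat -> R -> C) (l : nat -> C) (a b : R) (n : nat) :
  (forall i, @is_RInt C_R_NormedModule (f i) a b (l i)) ->
  @is_RInt C_R_NormedModule (fun u => CS (fun i => f i u) n) a b (CS l n).
Proof.
intros H. induction n.
- rewrite sum_OC. apply (is_RInt_ext (V:=C_R_NormedModule) (f 0%nat)); [|apply H].
  intros u _. rewrite sum_OC. reflexivity.
- rewrite sum_SnC.
  apply (is_RInt_ext (V:=C_R_NormedModule) (fun u => CS (fun i => f i u) n + f (S n) u)%C).
  + intros u _. rewrite sum_SnC. reflexivity.
  + exact (is_RInt_plus (V:=C_R_NormedModule) _ _ _ _ _ _ IHn (H (S n))).
Qed.

Lemma is_CI_RtoC (f : R -> R) (a b l : R) : is_RInt f a b l ->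
  @is_RInt C_R_NormedModule (fun u => RtoC (f u)) a b (RtoC l).
Proof.
intros H. apply is_CI_parts; [exact H|].
assert (H0 := is_RInt_const (V:=R_NormedModule) a b 0).
change (scal (b - a) 0) with ((b - a) * 0) in H0. rewrite Rmult_0_r in H0. exact H0.
Qed.

Lemma Cmod_csin_scal2 (om s y : R) :
  Cmod (csin (RtoC om * (s, y))) ^ 2 = sin (om * s) * sin (om * s) + sinh (om * y) * sinh (om * y).
Proof.
rewrite Cmod_csin2. simpl. replace (om * s - 0 * y) with (om * s) by ring.
replace (om * y + 0 * s) with (om * y) by ring. reflexivity.
Qed.

Lemma le_of_sqr_le (a b : R) : 0 <= b -> a * a <= b ^ 2 -> a <= b.
Proof. intros Hb H. apply Rsqr_incr_0_var; [unfold Rsqr; lra|exact Hb]. Qed.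

Lemma csin_hor_lower (om s y t : R) : Rabs y = t ->
  sinh (om * t) <= Cmod (csin (RtoC om * (s, y))).
Proof.
intros Hy. apply le_of_sqr_le; [apply Cmod_ge_0|]. rewrite Cmod_csin_scal2.
assert (E : sinh (om * t) * sinh (om * t) = sinh (om * y) * sinh (om * y)).
{ rewrite <- Hy. unfold Rabs; destruct (Rcase_abs y); [|reflexivity].
  rewrite Ropp_mult_distr_r_reverse, sinh_neg. ring. }
rewrite E. generalize (Rle_0_sqr (sin (om * s))). unfold Rsqr. lra.
Qed.

Lemma csin_ver_lower (om s y : R) : sin (om * s) * sin (om * s) = 1 ->
  1 <= Cmod (csin (RtoC om * (s, y))).
Proof.
intros H. apply le_of_sqr_le; [apply Cmod_ge_0|]. rewrite Cmod_csin_scal2, H.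
generalize (Rle_0_sqr (sinh (om * y))). unfold Rsqr. lra.
Qed.

(** The half-width [(L + 1/2) h] is midway between two zeros of the sine, hence at an extremum. *)
Lemma sin_half_grid (om h : R) (L : nat) : om * h = PI ->
  sin (om * ((INR L + / 2) * h)) * sin (om * ((INR L + / 2) * h)) = 1.
Proof.
intros H. replace (om * ((INR L + / 2) * h)) with (om * (IZR (Z.of_nat L) * h) + PI / 2).
- rewrite sin_plus, cos_PI2, sin_PI2, (sin_multiple om h _ H).
  rewrite Rmult_0_l, Rplus_0_l, Rmult_1_r. apply cos_sq_of_sin_0, sin_multiple, H.
- rewrite <- H, INR_IZR_INZ. field.
Qed.

(** The first term comes from the two horizontal sides, with kernel at most [h / t] and [|sin|] at
    least [sinh (om t)]; the second from the two vertical sides, of length [2 t], at distance [D] or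
    more from [[a, b]]. Both carry the factor [/ (2 PI)] of the residue formula. *)
Theorem truncated_error (F : C -> C) (bd : R -> R) (d t h om a b D X beta B : R) (L : nat) :
  0 < h -> om * h = PI -> 0 < t < d -> X = (INR L + / 2) * h ->
  (forall z : C, Rabs (Im z) < d -> cdiff F z) ->
  a <= b -> 0 < D -> D <= X - b -> D <= a + X ->
  (forall s y, - X <= s <= X -> Rabs y <= t -> Cmod (F (s, y)) <= bd s) ->
  is_RInt bd (- X) X B -> bd X <= beta -> bd (- X) <= beta ->
  Cmod (CI (fun u => F (RtoC u)) a b -
    sum_Z (fun k => F (RtoC (IZR k * h)) * RtoC (J (IZR k) h b - J (IZR k) h a))%C
      (Z.of_nat L) (Z.of_nat L)) <=
  B * (h / t) / (PI * sinh (om * t)) + 2 * t * beta * ((b - a) / D) / PI.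
Proof.
intros Hh Hoh Ht EX HF Hab HD HDb HDa Hbd HB Hb1 Hb2.
assert (HPI := PI_RGT_0).
assert (Ho : 0 < om) by (apply Rmult_lt_reg_r with h; lra).
assert (HX : 0 < X) by lra.
assert (Hsh : 0 < sinh (om * t)) by (apply sinh_pos, Rmult_lt_0_compat; lra).
assert (Hsx : sin (om * X) * sin (om * X) = 1) by (rewrite EX; apply sin_half_grid, Hoh).
assert (Hsx' : sin (om * - X) * sin (om * - X) = 1) by (rewrite Ropp_mult_distr_r_reverse, sin_neg; lra).
pose (G := fun w => (F w * / csin (RtoC om * w))%C).
(* The margin for the exchange of integrals: [d - t] keeps the vertical sides in the strip, [D]
   keeps [u] away from them. *)
set (eta := Rmin (d - t) D).
assert (Heta : 0 < eta) by (apply Rmin_pos; lra).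
assert (He1 : eta <= d - t) by apply Rmin_l. assert (He2 : eta <= D) by apply Rmin_r.
assert (HGc : forall x y, Rabs y < d -> (y <> 0 \/ sin (om * x) <> 0) -> @continuous C_UniformSpace C_UniformSpace G (x, y)).
{ intros x y Hy Hn. apply cdiff_continuous, cdiff_mult; [apply HF, Hy|].
  apply cdiff_inv; [apply cdiff_csin_scal|apply csin_neq_0; assumption]. }
assert (Chor : forall y s, @continuous R_UniformSpace C_UniformSpace (fun s => (s, y)) s).
{ intros y s. apply continuous_pair; [apply continuous_id|apply continuous_const]. }
assert (Cver : forall x s, @continuous R_UniformSpace C_UniformSpace (fun s => (x, s)) s).
{ intros x s. apply continuous_pair; [apply continuous_const|apply continuous_id]. }
assert (Shor : forall y, Rabs y = t ->
  @is_RInt C_R_NormedModule (fun u => RtoC (sin (om * u)) * CI (fun s => G (s, y) * / ((s, y) - RtoC u)) (- X) X)%C a b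
    (CI (fun s => G (s, y) * kern om a b (s, y))%C (- X) X) /\
  exC (fun s => G (s, y) * kern om a b (s, y))%C (- X) X).
{ intros y Hy. assert (Hy0 : y <> 0) by (intros ->; rewrite Rabs_R0 in Hy; lra).
  apply (side_integral G (fun s => (s, y)) om a b (- X) X eta Hab ltac:(lra) Heta).
  - intros s _. apply continuous_hor, HGc; [lra|left; exact Hy0].
  - intros s _. apply Chor.
  - intros s u _ _ E. injection E; lra. }
assert (Sver : forall x, x = X \/ x = - X ->
  @is_RInt C_R_NormedModule (fun u => RtoC (sin (om * u)) * CI (fun s => G (x, s) * / ((x, s) - RtoC u)) (- t) t)%C a b
    (CI (fun s => G (x, s) * kern om a b (x, s))%C (- t) t) /\
  exC (fun s => G (x, s) * kern om a b (x, s))%C (- t) t).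
{ intros x Hx. assert (Hs : sin (om * x) <> 0) by (intros E; destruct Hx; subst x; rewrite E in *; lra).
  apply (side_integral G (fun s => (x, s)) om a b (- t) t eta Hab ltac:(lra) Heta).
  - intros s Hs'. apply continuous_ver, HGc; [apply Rabs_def1; lra|right; exact Hs].
  - intros s _. apply Cver.
  - intros s u _ Hu E. injection E; intros; destruct Hx; lra. }
destruct (Shor (- t) ltac:(rewrite Rabs_Ropp; apply Rabs_pos_eq; lra)) as [S1 X1].
destruct (Shor t ltac:(apply Rabs_pos_eq; lra)) as [S2 X2].
destruct (Sver X ltac:(left; reflexivity)) as [S3 X3].
destruct (Sver (- X) ltac:(right; reflexivity)) as [S4 X4].
set (I1 := CI (fun s => G (s, (- t)%R) * kern om a b (s, (- t)%R))%C (- X) X) in *.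
set (I2 := CI (fun s => G (s, t) * kern om a b (s, t))%C (- X) X) in *.
set (I3 := CI (fun s => G (X, s) * kern om a b (X, s))%C (- t) t) in *.
set (I4 := CI (fun s => G ((- X)%R, s) * kern om a b ((- X)%R, s))%C (- t) t) in *.
assert (SR := is_CI_scal _ _ _ (/ (RtoC (2 * PI) * Ci))%C _
  (is_RInt_plus (V:=C_R_NormedModule) _ _ _ _ _ _
   (is_RInt_minus (V:=C_R_NormedModule) _ _ _ _ _ _ S1 S2)
   (is_CI_scal _ _ _ Ci _ (is_RInt_minus (V:=C_R_NormedModule) _ _ _ _ _ _ S3 S4)))).
assert (SF : exC (fun u => F (RtoC u)) a b).
{ apply exC_continuous; [exact Hab|]. intros u _.
  apply (continuous_hor F u 0). apply cdiff_continuous, HF. simpl. rewrite Rabs_R0. lra. }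
assert (SS := is_CI_CS (fun i u => F (RtoC (IZR (Z.of_nat i - Z.of_nat L) * h)) * RtoC (sinc (om * (u - IZR (Z.of_nat i - Z.of_nat L) * h))))%C
  (fun i => F (RtoC (IZR (Z.of_nat i - Z.of_nat L) * h)) * RtoC (J (IZR (Z.of_nat i - Z.of_nat L)) h b - J (IZR (Z.of_nat i - Z.of_nat L)) h a))%C
  a b (2 * L)).
specialize (SS ltac:(intros i; apply is_CI_scal, is_CI_RtoC, is_RInt_sinc_shift; [lra|exact Hoh])).
assert (SL := is_RInt_minus (V:=C_R_NormedModule) _ _ _ _ _ _ (is_CI _ _ _ SF) SS).
rewrite sum_Z_sym.
assert (Main : (CI (fun u => F (RtoC u)) a b - CS (fun i => F (RtoC (IZR (Z.of_nat i - Z.of_nat L) * h)) * RtoC (J (IZR (Z.of_nat i - Z.of_nat L)) h b - J (IZR (Z.of_nat i - Z.of_nat L)) h a)) (2 * L))%C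
   = (/ (RtoC (2 * PI) * Ci) * ((I1 - I2) + Ci * (I3 - I4)))%C).
{ etransitivity; [symmetry; exact (CI_unique _ _ _ _ SL)|].
  etransitivity; [|exact (CI_unique _ _ _ _ SR)].
  apply CI_ext; [exact Hab|]. intros u Hu.
  assert (CIP := cardinal_interpolation F om h t u L Hh Hoh (proj1 Ht)).
  rewrite <- EX in CIP. specialize (CIP ltac:(intros; apply HF; simpl; apply Rabs_def1; lra) ltac:(lra)).
  rewrite sum_Z_sym in CIP. etransitivity; [exact CIP|]. unfold contour.
  match goal with |- _ = ?r => change r with (/ (RtoC (2 * PI) * Ci) *
   (RtoC (sin (om * u)) * CI (fun s => G (s, (- t)%R) * / ((s, (- t)%R) - RtoC u)) (- X) X
    - RtoC (sin (om * u)) * CI (fun s => G (s, t) * / ((s, t) - RtoC u)) (- X) X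
    + Ci * (RtoC (sin (om * u)) * CI (fun s => G (X, s) * / ((X, s) - RtoC u)) (- t) t
    - RtoC (sin (om * u)) * CI (fun s => G ((- X)%R, s) * / (((- X)%R, s) - RtoC u)) (- t) t)))%C end.
  unfold G. ring. }
eapply Rle_trans; [right; exact (f_equal Cmod Main)|]. clear Main SL SS SR.
assert (N12 : forall y, Rabs y = t -> exC (fun s => G (s, y) * kern om a b (s, y))%C (- X) X ->
   Cmod (CI (fun s => G (s, y) * kern om a b (s, y))%C (- X) X) <= / sinh (om * t) * (h / t) * B).
{ intros y Hy Hex. assert (Hy0 : y <> 0) by (intros ->; rewrite Rabs_R0 in Hy; lra).
  assert (HB' := is_RInt_scal (V:=R_NormedModule) _ _ _ (/ sinh (om * t) * (h / t)) _ HB).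
  change (scal (/ sinh (om * t) * (h / t)) B) with (/ sinh (om * t) * (h / t) * B) in HB'.
  rewrite <- (is_RInt_unique _ _ _ _ HB').
  apply CI_norm; [lra|exact Hex|eexists; exact HB'|].
  intros s Hs. change (scal (/ sinh (om * t) * (h / t)) (bd s)) with (/ sinh (om * t) * (h / t) * bd s).
  rewrite Cmod_mult. unfold G. rewrite Cmod_mult.
  assert (Hcs : csin (RtoC om * (s, y)) <> 0) by (apply csin_neq_0; [exact Ho|left; exact Hy0]).
  rewrite Cmod_inv by exact Hcs.
  assert (Hk := kern_hor_bound om a b s y Ho Hab Hy0). rewrite Hy in Hk.
  replace (/ om * (PI / t)) with (h / t) in Hk by (rewrite <- Hoh; field; lra).
  replace (/ sinh (om * t) * (h / t) * bd s) with ((bd s * / sinh (om * t)) * (h / t)) by ring.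
  assert (Hci := proj1 (Cmod_gt_0 _) Hcs).
  assert (0 <= / Cmod (csin (RtoC om * (s, y)))) by (apply Rlt_le, Rinv_0_lt_compat, Hci).
  assert (HFb := Hbd s y Hs ltac:(lra)).
  apply Rmult_le_compat; [apply Rmult_le_pos; [apply Cmod_ge_0|assumption]|apply Cmod_ge_0| |exact Hk].
  apply Rmult_le_compat; [apply Cmod_ge_0|assumption|exact HFb|].
  apply Rinv_le_contravar; [exact Hsh|]. apply csin_hor_lower, Hy. }
assert (N34 : forall x, (x = X \/ x = - X) -> exC (fun s => G (x, s) * kern om a b (x, s))%C (- t) t ->
   Cmod (CI (fun s => G (x, s) * kern om a b (x, s))%C (- t) t) <= (t - - t) * (beta * ((b - a) / D))).
{ intros x Hx Hex. assert (Hs : sin (om * x) * sin (om * x) = 1) by (destruct Hx; subst x; assumption).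
  apply CI_norm_const; [lra|exact Hex|].
  intros s Hs'. rewrite Cmod_mult. unfold G. rewrite Cmod_mult.
  assert (Hlow := csin_ver_lower om x s Hs).
  assert (Hcs : csin (RtoC om * (x, s)) <> 0) by (apply Cmod_gt_0; lra).
  rewrite Cmod_inv by exact Hcs.
  assert (HFb : Cmod (F (x, s)) <= beta).
  { eapply Rle_trans; [apply Hbd; [destruct Hx; lra|apply Rabs_le; lra]|]. destruct Hx; subst x; assumption. }
  assert (H0 : 0 <= / Cmod (csin (RtoC om * (x, s)))) by (apply Rlt_le, Rinv_0_lt_compat; lra).
  apply Rmult_le_compat; [apply Rmult_le_pos; [apply Cmod_ge_0|assumption]|apply Cmod_ge_0| |].
  - rewrite <- (Rmult_1_r beta). apply Rmult_le_compat; [apply Cmod_ge_0|assumption|exact HFb|].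
    rewrite <- Rinv_1. apply Rinv_le_contravar; [lra|exact Hlow].
  - apply kern_ver_bound; [exact Hab|exact HD|]. intros u Hu. simpl.
    destruct Hx; subst x; [rewrite Rabs_pos_eq|rewrite Rabs_left]; lra. }
assert (M1 := N12 (- t) ltac:(rewrite Rabs_Ropp; apply Rabs_pos_eq; lra) X1).
assert (M2 := N12 t ltac:(apply Rabs_pos_eq; lra) X2).
assert (M3 := N34 X ltac:(left; reflexivity) X3).
assert (M4 := N34 (- X) ltac:(right; reflexivity) X4).
fold I1 in M1. fold I2 in M2. fold I3 in M3. fold I4 in M4.
assert (T : forall u v, Cmod (u - v) <= Cmod u + Cmod v).
{ intros u v. unfold Cminus. rewrite <- (Cmod_opp v). apply Cmod_triangle. }
rewrite Cmod_mult, Cmod_inv, Cmod_mult, Cmod_R, Cmod_Ci, Rmult_1_r, Rabs_pos_eq by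
  (lra || (apply Cmult_neq_0; [apply RtoC_neq_0; lra|intros E; injection E; lra])).
apply Rle_trans with (/ (2 * PI) * (Cmod I1 + Cmod I2 + (Cmod I3 + Cmod I4))).
- apply Rmult_le_compat_l; [apply Rlt_le, Rinv_0_lt_compat; lra|].
  eapply Rle_trans; [apply Cmod_triangle|]. rewrite Cmod_mult, Cmod_Ci, Rmult_1_l.
  generalize (T I1 I2) (T I3 I4); lra.
- apply Rle_trans with (/ (2 * PI) * (2 * (/ sinh (om * t) * (h / t) * B) + 2 * ((t - - t) * (beta * ((b - a) / D))))).
  + apply Rmult_le_compat_l; [apply Rlt_le, Rinv_0_lt_compat; lra|lra].
  + right. field. repeat split; lra.
Qed.

(** * Sine integral *)

Lemma PI_bounds : 31 / 10 < PI < 32 / 10.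
Proof.
generalize (PI_2_3_7_ineq 1). simpl. unfold tg_alt, PI_2_3_7_tg, Ratan_seq. simpl. lra.
Qed.

Lemma Si_0 : Si 0 = 0.
Proof. unfold Si. rewrite RInt_point. reflexivity. Qed.

Lemma sinc_opp (x : R) : sinc (- x) = sinc x.
Proof.
destruct (Req_dec x 0) as [->|H]; [rewrite Ropp_0; reflexivity|].
rewrite !sinc_neq by lra. rewrite sin_neg. field. exact H.
Qed.

Lemma Si_opp (x : R) : Si (- x) = - Si x.
Proof.
assert (H : is_RInt sinc 0 x (- Si (- x) - - Si (- 0))).
{ apply (is_RInt_derive (V:=R_CompleteNormedModule) (fun x => - Si (- x))).
  - intros y _. auto_derive.
    + exists (sinc (- y)). apply is_derive_Si.
    + rewrite (is_derive_unique _ _ _ (is_derive_Si _)), sinc_opp. ring.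
  - intros y _. apply continuous_sinc. }
apply (is_RInt_unique (V:=R_CompleteNormedModule)) in H. fold (Si x) in H. rewrite Ropp_0, Si_0 in H. lra.
Qed.

(** This is [PI / 2 - Si x], as obtained by integrating [exp (i z) / z] along the quarter circle of
    radius [x]. Over a bounded interval, it can be differentiated under the integral sign and
    estimated in absolute value. *)
Definition Si_complement (x : R) : R :=
  RInt (fun t => exp (- (x * cos t)) * cos (x * sin t)) 0 (PI / 2).

Lemma is_derive_Si_complement_integrand (t x : R) :
  is_derive (fun x => exp (- (x * cos t)) * cos (x * sin t)) x
    (- (exp (- (x * cos t)) * cos (t - x * sin t))).
Proof.
auto_derive; [exact I|]. rewrite cos_minus. ring.
Qed.

Lemma continuity_2d_Si_complement (x t : R) :
  continuity_2d_pt (fun u v => - (exp (- (u * cos v)) * cos (v - u * sin v))) x t.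
Proof.
apply continuity_2d_pt_opp, continuity_2d_pt_mult.
- apply (continuity_1d_2d_pt_comp exp (fun u v => - (u * cos v))).
  + apply derivable_continuous_pt, derivable_pt_exp.
  + apply continuity_2d_pt_opp, continuity_2d_pt_mult; [apply continuity_2d_pt_id1|].
    apply (continuity_1d_2d_pt_comp cos (fun u v => v)); [apply continuity_cos|apply continuity_2d_pt_id2].
- apply (continuity_1d_2d_pt_comp cos (fun u v => v - u * sin v)).
  + apply continuity_cos.
  + apply continuity_2d_pt_minus; [apply continuity_2d_pt_id2|].
    apply continuity_2d_pt_mult; [apply continuity_2d_pt_id1|].
    apply (continuity_1d_2d_pt_comp sin (fun u v => v)); [apply continuity_sin|apply continuity_2d_pt_id2].
Qed.

Lemma ex_RInt_Si_complement (x a b : R) : ex_RInt (fun t => exp (- (x * cos t)) * cos (x * sin t)) a b.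
Proof.
apply (ex_RInt_continuous (V:=R_CompleteNormedModule)). intros t _.
apply (ex_derive_continuous (fun t => exp (- (x * cos t)) * cos (x * sin t))). auto_derive. exact I.
Qed.

(* The integrand of the derivative is the exact derivative of
   [- exp (- x cos t) sin (x sin t) / x] with respect to [t]. *)
Lemma is_derive_Si_complement (x : R) : is_derive Si_complement x (- sinc x).
Proof.
assert (H : is_derive Si_complement x
  (RInt (fun t => Derive (fun x => exp (- (x * cos t)) * cos (x * sin t)) x) 0 (PI / 2))).
{ apply (is_derive_RInt_param (fun x t => exp (- (x * cos t)) * cos (x * sin t))).
  - exists (mkposreal 1 Rlt_0_1). intros y _ t _. eexists. apply is_derive_Si_complement_integrand.
  - intros t _. apply (continuity_2d_pt_ext (fun u v => - (exp (- (u * cos v)) * cos (v - u * sin v)))).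
    + intros u v. symmetry. apply is_derive_unique, is_derive_Si_complement_integrand.
    + apply continuity_2d_Si_complement.
  - exists (mkposreal 1 Rlt_0_1). intros y _. apply ex_RInt_Si_complement. }
replace (- sinc x) with (RInt (fun t => Derive (fun x => exp (- (x * cos t)) * cos (x * sin t)) x) 0 (PI / 2)); [exact H|].
rewrite (RInt_ext _ (fun t => - (exp (- (x * cos t)) * cos (t - x * sin t)))).
2:{ intros t _. apply is_derive_unique, is_derive_Si_complement_integrand. }
apply is_RInt_unique.
(* The primitive used for [x <> 0] divides by [x]; at 0 the integrand is [- cos t]. *)
destruct (Req_dec x 0) as [->|Hx].
- rewrite sinc_0.
  replace (- (1)) with (minus (- sin (PI / 2)) (- sin 0)).
  2:{ rewrite sin_PI2, sin_0. unfold minus, plus, opp; simpl; ring. }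
  apply (is_RInt_derive (V:=R_CompleteNormedModule) (fun t => - sin t)).
  + intros t _. auto_derive; [exact I|]. rewrite !Rmult_0_l, Ropp_0, exp_0, Rminus_0_r. ring.
  + intros t _. apply (ex_derive_continuous (fun t => - (exp (- (0 * cos t)) * cos (t - 0 * sin t)))).
    auto_derive. exact I.
- replace (- sinc x) with (minus (- (exp (- (x * cos (PI / 2))) * sin (x * sin (PI / 2))) / x)
    (- (exp (- (x * cos 0)) * sin (x * sin 0)) / x)).
  2:{ rewrite cos_PI2, sin_PI2, sin_0, Rmult_0_r, sin_0, Ropp_0, exp_0, Rmult_1_r.
      rewrite sinc_neq by exact Hx. unfold minus, plus, opp; simpl. field. exact Hx. }
  apply (is_RInt_derive (V:=R_CompleteNormedModule) (fun t => - (exp (- (x * cos t)) * sin (x * sin t)) / x)).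
  + intros t _. auto_derive; [exact I|]. rewrite cos_minus. field. exact Hx.
  + intros t _. apply (ex_derive_continuous (fun t => - (exp (- (x * cos t)) * cos (t - x * sin t)))).
    auto_derive. exact I.
Qed.

(** Both sides have derivative [sinc] and vanish at 0. With the decay of [Si_complement], this also
    provides the limit [PI / 2] of [Si]. *)
Lemma Si_eq_complement (x : R) : Si x = PI / 2 - Si_complement x.
Proof.
assert (H : is_RInt sinc 0 x (- Si_complement x - - Si_complement 0)).
{ apply (is_RInt_derive (V:=R_CompleteNormedModule) (fun x => - Si_complement x)).
  - intros y _. replace (sinc y) with (opp (- sinc y)) by (unfold opp; simpl; ring).
    apply (is_derive_opp (V:=R_NormedModule) Si_complement), is_derive_Si_complement.
  - intros y _. apply continuous_sinc. }
apply (is_RInt_unique (V:=R_CompleteNormedModule)) in H. fold (Si x) in H. rewrite H.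
assert (H0 : Si_complement 0 = PI / 2).
{ unfold Si_complement. rewrite (RInt_ext _ (fun _ => 1)).
  - rewrite RInt_const. unfold scal; simpl; unfold mult; simpl. ring.
  - intros t _. rewrite !Rmult_0_l, Ropp_0, exp_0, cos_0. exact (Rmult_1_r 1). }
rewrite H0. ring.
Qed.

(** Jordan's inequality with [4 / 7] in place of the sharp [2 / PI]: two terms of the sine series
    suffice, as [1 - s^2 / 6 >= 4 / 7] for [s <= 1.6]. *)
Lemma cos_ge_linear (t : R) : 0 <= t <= PI / 2 -> 4 / 7 * (PI / 2 - t) <= cos t.
Proof.
intros Ht. generalize PI_bounds; intros HP.
replace (cos t) with (sin (PI / 2 - t)) by (rewrite sin_minus, sin_PI2, cos_PI2; ring).
set (s := PI / 2 - t) in *.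
destruct (sin_bound s 0) as [H _]; [unfold s; lra|unfold s; lra|].
eapply Rle_trans; [|exact H]. unfold sin_approx, sin_term; simpl.
assert (Hs : 0 <= s <= 16 / 10) by (unfold s; lra).
replace (1 * (s * 1 / 1) + -1 * 1 * (s * (s * (s * 1)) / (1 + 1 + 1 + 1 + 1 + 1))) with (s - s * (s * s) / 6) by field.
nra.
Qed.

(** Jordan's lemma: by [cos_ge_linear] the integrand is dominated by an exponential of rate
    [c = 4 x / 7], whose integral is below [1 / c]. *)
Lemma Si_complement_bound (x : R) : 0 < x -> Rabs (Si_complement x) <= 7 / (4 * x).
Proof.
intros Hx. generalize PI_bounds; intros HP.
set (c := 4 / 7 * x). assert (Hc : 0 < c) by (unfold c; lra).
assert (HB : is_RInt (fun t => exp (- (c * (PI / 2 - t)))) 0 (PI / 2)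
   (exp (- (c * (PI / 2 - PI / 2))) / c - exp (- (c * (PI / 2 - 0))) / c)).
{ apply (is_RInt_derive (V:=R_CompleteNormedModule) (fun t => exp (- (c * (PI / 2 - t))) / c)).
  - intros t _. auto_derive; [exact I|]. change (PI / 2 + - t) with (PI / 2 - t). field. lra.
  - intros t _. apply (ex_derive_continuous (fun t => exp (- (c * (PI / 2 - t))))). auto_derive. exact I. }
apply Rle_trans with (exp (- (c * (PI / 2 - PI / 2))) / c - exp (- (c * (PI / 2 - 0))) / c).
- apply (norm_RInt_le (V:=R_NormedModule) (fun t => exp (- (x * cos t)) * cos (x * sin t))
   (fun t => exp (- (c * (PI / 2 - t)))) 0 (PI / 2)); [lra| | |exact HB].
  + intros t Ht. change (Rabs (exp (- (x * cos t)) * cos (x * sin t)) <= exp (- (c * (PI / 2 - t)))).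
    rewrite Rabs_mult, (Rabs_pos_eq (exp _)) by (apply Rlt_le, exp_pos).
    rewrite <- (Rmult_1_r (exp (- (c * _)))). apply Rmult_le_compat; [apply Rlt_le, exp_pos|apply Rabs_pos| |].
    * apply exp_le. apply Ropp_le_contravar. unfold c.
      rewrite (Rmult_comm (4 / 7) x), Rmult_assoc. apply Rmult_le_compat_l; [lra|]. apply cos_ge_linear, Ht.
    * apply Rabs_le, COS_bound.
  + apply (RInt_correct (V:=R_CompleteNormedModule)), ex_RInt_Si_complement.
- rewrite Rminus_diag, Rmult_0_r, Ropp_0, exp_0.
  assert (0 < exp (- (c * (PI / 2 - 0))) / c) by (apply Rdiv_lt_0_compat; [apply exp_pos|exact Hc]).
  replace (7 / (4 * x)) with (1 / c) by (unfold c; field; lra). lra.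
Qed.

Lemma Si_mono_sinc (a b : R) : a <= b -> (forall t, a < t < b -> 0 <= sinc t) -> Si a <= Si b.
Proof.
intros Hab H. unfold Si.
rewrite <- (RInt_Chasles (V:=R_CompleteNormedModule) sinc 0 a b) by apply ex_RInt_sinc.
unfold plus; simpl. generalize (RInt_ge_0 sinc a b Hab (ex_RInt_sinc a b) H). lra.
Qed.

Lemma Si_anti_sinc (a b : R) : a <= b -> (forall t, a < t < b -> sinc t <= 0) -> Si b <= Si a.
Proof.
intros Hab H. unfold Si.
rewrite <- (RInt_Chasles (V:=R_CompleteNormedModule) sinc 0 a b) by apply ex_RInt_sinc.
unfold plus; simpl.
assert (H' : RInt sinc a b <= RInt (fun _ => 0) a b).
{ apply RInt_le; [exact Hab|apply ex_RInt_sinc|apply ex_RInt_const|exact H]. }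
rewrite RInt_const in H'. unfold scal in H'; simpl in H'; unfold mult in H'; simpl in H'. lra.
Qed.

Lemma sinc_nonneg (t : R) : 0 <= t <= PI -> 0 <= sinc t.
Proof.
intros Ht. destruct (Req_dec t 0) as [->|H]; [rewrite sinc_0; lra|].
rewrite sinc_neq by exact H. apply Rmult_le_pos; [apply sin_ge_0; lra|apply Rlt_le, Rinv_0_lt_compat; lra].
Qed.

Lemma sin_approx_4 (t : R) :
  sin_approx t (2 * (1 + 1)) = t - t^3 / 6 + t^5 / 120 - t^7 / 5040 + t^9 / 362880.
Proof.
assert (F : forall n, INR (fact (S n)) = INR (S n) * INR (fact n)).
{ intros n. rewrite fact_simpl. apply mult_INR. }
change (2 * (1 + 1))%nat with 4%nat. unfold sin_approx. rewrite !tech5. cbn [sum_f_R0]. unfold sin_term.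
change (2 * 0 + 1)%nat with 1%nat. change (2 * 1 + 1)%nat with 3%nat. change (2 * 2 + 1)%nat with 5%nat.
change (2 * 3 + 1)%nat with 7%nat. change (2 * 4 + 1)%nat with 9%nat.
rewrite !F. change (fact 0) with 1%nat. simpl INR. field.
Qed.

(** The true ratio [Si PI / PI] is about 0.589, so integrating the degree 9 Taylor majorant of the
    sine, divided by [t], leaves enough room. *)
Lemma Si_PI_le : Si PI <= 6 / 10 * PI.
Proof.
generalize PI_bounds; intros HP.
pose (P := fun t => t - t^3 / 18 + t^5 / 600 - t^7 / 35280 + t^9 / 3265920).
pose (p := fun t => 1 - t^2 / 6 + t^4 / 120 - t^6 / 5040 + t^8 / 362880).
assert (HI : is_RInt p 0 PI (P PI - P 0)).
{ apply (is_RInt_derive (V:=R_CompleteNormedModule) P).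
  - intros t _. unfold P, p. auto_derive; [exact I|]. simpl. field.
  - intros t _. apply (ex_derive_continuous p). unfold p. auto_derive. exact I. }
assert (Hle : RInt sinc 0 PI <= RInt p 0 PI).
{ apply RInt_le; [lra|apply ex_RInt_sinc|eexists; exact HI|].
  intros t Ht. rewrite sinc_neq by lra.
  destruct (sin_bound t 1) as [_ H]; [lra|lra|].
  apply Rmult_le_reg_r with t; [lra|]. unfold Rdiv. rewrite Rmult_assoc, Rinv_l, Rmult_1_r by lra.
  eapply Rle_trans; [exact H|]. right. rewrite sin_approx_4. unfold p. field. }
rewrite (is_RInt_unique _ _ _ _ HI) in Hle. fold (Si PI) in Hle.
eapply Rle_trans; [exact Hle|].
unfold P.
set (y := PI * PI).
assert (Hy : 961 / 100 <= y <= 1024 / 100) by (unfold y; nra).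
replace (PI - PI ^ 3 / 18 + PI ^ 5 / 600 - PI ^ 7 / 35280 + PI ^ 9 / 3265920 -
  (0 - 0 ^ 3 / 18 + 0 ^ 5 / 600 - 0 ^ 7 / 35280 + 0 ^ 9 / 3265920)) with
  (PI * (1 - y / 18 + y * y / 600 - y * y * y / 35280 + y * y * y * y / 3265920)) by (unfold y; field).
rewrite (Rmult_comm (6 / 10)). apply Rmult_le_compat_l; [lra|].
(* Recentred at [3.1^2], the polynomial has a small argument, and bounding the powers of [z] by 1
   makes the claim linear. *)
set (z := y - 961 / 100). assert (Hz : 0 <= z <= 63 / 100) by (unfold z; lra).
replace y with (z + 961 / 100) by (unfold z; ring).
assert (0 <= z * z <= 1) by nra. assert (0 <= z * z * z <= 1) by nra. assert (0 <= z * z * z * z <= 1) by nra.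
lra.
Qed.

(** [Si] rises on [[0, PI]] and falls on [[PI, 2 PI]], so there its maximum is [Si PI]. Beyond
    [2 PI] it differs from [PI / 2] by at most [7 / (4 * 6.2)], less than [PI / 10]. *)
Lemma Si_bound_nonneg (x : R) : 0 <= x -> 0 <= Si x <= 6 / 10 * PI.
Proof.
intros Hx. generalize PI_bounds Si_PI_le; intros HP HS.
assert (Hl : forall y, 0 < y -> Rabs (Si y - PI / 2) <= 7 / (4 * y)).
{ intros y Hy. rewrite Si_eq_complement. replace (PI / 2 - Si_complement y - PI / 2) with (- Si_complement y) by ring.
  rewrite Rabs_Ropp. apply Si_complement_bound, Hy. }
assert (Hd : forall y r, 0 < r -> r <= y -> 7 / (4 * y) <= 7 / (4 * r)).
{ intros y r Hr Hy. apply Rmult_le_compat_l; [lra|]. apply Rinv_le_contravar; lra. }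
destruct (Rle_lt_dec x PI) as [H1|H1].
- split.
  + rewrite <- Si_0. apply Si_mono_sinc; [exact Hx|]. intros; apply sinc_nonneg; lra.
  + eapply Rle_trans; [|exact HS]. apply Si_mono_sinc; [exact H1|]. intros; apply sinc_nonneg; lra.
- assert (L := Hl x ltac:(lra)). apply Rabs_le_between in L. split.
  + assert (D1 := Hd x 3 ltac:(lra) ltac:(lra)). lra.
  + destruct (Rle_lt_dec x (2 * PI)) as [H2|H2].
    * eapply Rle_trans; [|exact HS]. apply Si_anti_sinc; [lra|]. intros t Ht.
      rewrite sinc_neq by lra. assert (sin t <= 0) by (apply sin_le_0; lra).
      unfold Rdiv. generalize (Rinv_0_lt_compat t ltac:(lra)). intros. nra.
    * assert (D1 := Hd x (62 / 10) ltac:(lra) ltac:(lra)). lra.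
Qed.

Lemma Si_bound (x : R) : Rabs (Si x) <= 6 / 10 * PI.
Proof.
destruct (Rle_lt_dec 0 x) as [H|H].
- generalize (Si_bound_nonneg x H). intros. rewrite Rabs_pos_eq; lra.
- generalize (Si_bound_nonneg (- x) ltac:(lra)). rewrite Si_opp. intros. rewrite Rabs_left1; lra.
Qed.

(** [11 / 10 = 1 / 2 + 6 / 10]: this is the constant 1.1 of the theorem. *)
Lemma J_bound (k h x : R) : 0 < h -> Rabs (J k h x) <= 11 / 10 * h.
Proof.
intros Hh. unfold J. rewrite Rabs_mult, (Rabs_pos_eq h), Rmult_comm by lra.
apply Rmult_le_compat_r; [lra|].
eapply Rle_trans; [apply Rabs_triang|]. rewrite (Rabs_pos_eq (/ 2)), Rabs_mult by lra.
generalize PI_bounds; intros. assert (0 < / PI) by (apply Rinv_0_lt_compat; lra).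
rewrite (Rabs_pos_eq (/ PI)) by lra.
assert (/ PI * Rabs (Si (PI * (x / h - k))) <= / PI * (6 / 10 * PI)).
{ apply Rmult_le_compat_l; [lra|apply Si_bound]. }
replace (/ PI * (6 / 10 * PI)) with (6 / 10) in H1 by (field; lra). lra.
Qed.

(** To the left of the node the [/ 2] in [J] cancels the limit of the sine integral, leaving
    [h / PI * Si_complement y]. The resulting constant [7 / (4 PI^2)] is rounded up to 1. *)
Lemma J_left_bound (k h x : R) : 0 < h -> x < k * h ->
  Rabs (J k h x) <= h * h / (k * h - x).
Proof.
intros Hh Hx. unfold J.
generalize PI_bounds; intros HP.
replace (PI * (x / h - k)) with (- (PI * ((k * h - x) / h))) by (field; lra).
set (y := PI * ((k * h - x) / h)).
assert (Hq : 0 < (k * h - x) / h) by (apply Rdiv_lt_0_compat; lra).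
assert (Hy : 0 < y) by (apply Rmult_lt_0_compat; lra).
rewrite Si_opp, Si_eq_complement.
replace (h * (/ 2 + / PI * - (PI / 2 - Si_complement y))) with (h * / PI * Si_complement y) by (field; lra).
assert (Hh' : 0 < h * / PI) by (apply Rmult_lt_0_compat; [lra|apply Rinv_0_lt_compat; lra]).
rewrite Rabs_mult, (Rabs_pos_eq (h * / PI)) by lra.
apply Rle_trans with (h * / PI * (7 / (4 * y))).
- apply Rmult_le_compat_l; [lra|]. apply Si_complement_bound, Hy.
- replace (h * / PI * (7 / (4 * y))) with (7 / (4 * PI * PI) * (h * h / (k * h - x))).
  + rewrite <- (Rmult_1_l (h * h / (k * h - x))) at 2. apply Rmult_le_compat_r.
    * apply Rlt_le, Rdiv_lt_0_compat; nra.
    * apply Rmult_le_reg_r with (4 * PI * PI); [nra|]. unfold Rdiv. rewrite Rmult_assoc, Rinv_l by nra. nra.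
  + unfold y. field. lra.
Qed.

(** * Grid sums and decay of the integrand *)

Lemma sum_n_recl (f : nat -> C) (n : nat) : CS f (S n) = (f 0%nat + CS (fun i => f (S i)) n)%C.
Proof.
induction n.
- rewrite sum_SnC, !sum_OC. reflexivity.
- rewrite sum_SnC, IHn, (sum_SnC (fun i => f (S i))). ring.
Qed.

Lemma sum_Z_succ_r (g : Z -> C) (M N : Z) : (0 <= M)%Z -> (0 <= N)%Z ->
  sum_Z g M (N + 1) = (sum_Z g M N + g (N + 1)%Z)%C.
Proof.
intros HM HN. unfold sum_Z.
replace (Z.to_nat (N + 1 + M)) with (S (Z.to_nat (N + M))) by lia.
etransitivity; [apply sum_SnC|]. unfold CS. f_equal. f_equal. lia.
Qed.

Lemma sum_Z_succ_l (g : Z -> C) (M N : Z) : (0 <= M)%Z -> (0 <= N)%Z ->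
  sum_Z g (M + 1) N = (sum_Z g M N + g (- (M + 1))%Z)%C.
Proof.
intros HM HN. unfold sum_Z.
replace (Z.to_nat (N + (M + 1))) with (S (Z.to_nat (N + M))) by lia.
etransitivity; [apply sum_n_recl|]. rewrite Cplus_comm. unfold CS. f_equal.
- apply sum_n_ext. intros i. f_equal. lia.
Qed.

(** A Riemann sum term against the integral of [exp (- b s)] over [[r, r + h]]. Written as a
    difference, the right-hand side telescopes over the nodes. *)
Lemma exp_step (b h r : R) : 0 < b -> 0 < h ->
  h * exp (- (b * (r + h))) <= (exp (- (b * r)) - exp (- (b * (r + h)))) / b.
Proof.
intros Hb Hh.
assert (E : exp (- (b * r)) = exp (- (b * (r + h))) * exp (b * h)).
{ rewrite <- exp_plus. f_equal. ring. }
rewrite E. assert (H := exp_ineq1_le (b * h)). assert (Hp := exp_pos (- (b * (r + h)))).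
set (e := exp (- (b * (r + h)))) in *.
apply Rmult_le_reg_l with b; [exact Hb|]. replace (b * ((e * exp (b * h) - e) / b)) with (e * exp (b * h) - e) by (field; lra).
nra.
Qed.

(** The allowance [v] per term does not decay with [k]. It is 0 for the truncation error and
    exponentially small in [X] in [grid_left_sum]. *)
Lemma sum_Z_tail_r (g : Z -> C) (A b h v : R) (M N : Z) (i : nat) :
  0 <= A -> 0 < b -> 0 < h -> (0 <= M)%Z -> (0 <= N)%Z ->
  (forall k : Z, (0 < k)%Z -> Cmod (g k) <= A * (h * exp (- (b * (IZR k * h)))) + v) ->
  Cmod (sum_Z g M (N + Z.of_nat i) - sum_Z g M N) <=
   A / b * (exp (- (b * (IZR N * h))) - exp (- (b * (IZR (N + Z.of_nat i) * h)))) + INR i * v.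
Proof.
intros HA Hb Hh HM HN Hg. induction i as [|i IH].
- rewrite Z.add_0_r, !Rminus_diag. replace (sum_Z g M N - sum_Z g M N)%C with (RtoC 0) by ring.
  rewrite Cmod_0. simpl. lra.
- rewrite S_INR. replace (N + Z.of_nat (S i))%Z with (N + Z.of_nat i + 1)%Z by lia.
  set (N' := (N + Z.of_nat i)%Z) in *.
  rewrite sum_Z_succ_r by lia.
  replace (sum_Z g M N' + g (N' + 1)%Z - sum_Z g M N)%C with ((sum_Z g M N' - sum_Z g M N) + g (N' + 1)%Z)%C by ring.
  eapply Rle_trans; [apply Cmod_triangle|].
  assert (H1 := Hg (N' + 1)%Z ltac:(lia)). rewrite plus_IZR in *.
  assert (H2 := exp_step b h (IZR N' * h) Hb Hh).
  replace ((IZR N' + 1) * h) with (IZR N' * h + h) in * by ring.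
  apply (Rmult_le_compat_l A) in H2; [|exact HA].
  assert (H3 : A * ((exp (- (b * (IZR N' * h))) - exp (- (b * (IZR N' * h + h)))) / b) =
    A / b * exp (- (b * (IZR N' * h))) - A / b * exp (- (b * (IZR N' * h + h)))) by (field; lra).
  lra.
Qed.

Lemma sum_Z_reflect (g : Z -> C) (M N : Z) : (0 <= M)%Z -> (0 <= N)%Z ->
  sum_Z g M N = sum_Z (fun k => g (- k)%Z) N M.
Proof.
intros HM HN. revert g N HN. pattern M. apply natlike_ind; [| |exact HM].
- intros g N HN. pattern N. apply natlike_ind; [| |exact HN].
  + unfold sum_Z. etransitivity; [apply sum_OC|]. symmetry. etransitivity; [apply sum_OC|]. reflexivity.
  + intros N0 H0 IH. unfold Z.succ. rewrite sum_Z_succ_r, sum_Z_succ_l by lia. rewrite IH. do 2 f_equal. lia.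
- intros M0 H0 IH g N HN. unfold Z.succ. rewrite sum_Z_succ_l, sum_Z_succ_r by lia. rewrite IH by lia. reflexivity.
Qed.

Lemma sum_Z_tails (g : Z -> C) (A a b h v : R) (M N : Z) (i j : nat) :
  0 <= A -> 0 < a -> 0 < b -> 0 < h -> (0 <= M)%Z -> (0 <= N)%Z ->
  (forall k : Z, (0 < k)%Z -> Cmod (g k) <= A * (h * exp (- (b * (IZR k * h)))) + v) ->
  (forall k : Z, (0 < k)%Z -> Cmod (g (- k)%Z) <= A * (h * exp (- (a * (IZR k * h)))) + v) ->
  Cmod (sum_Z g (M + Z.of_nat j) (N + Z.of_nat i) - sum_Z g M N) <=
   A / a * exp (- (a * (IZR M * h))) + A / b * exp (- (b * (IZR N * h))) + (INR i + INR j) * v.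
Proof.
intros HA Ha Hb Hh HM HN H1 H2.
assert (T1 := sum_Z_tail_r g A b h v (M + Z.of_nat j) N i HA Hb Hh ltac:(lia) HN H1).
assert (T2 := sum_Z_tail_r (fun k => g (- k)%Z) A a h v N M j HA Ha Hh HN HM H2).
rewrite <- !sum_Z_reflect in T2 by lia.
set (S1 := sum_Z g (M + Z.of_nat j) (N + Z.of_nat i)) in *. set (S2 := sum_Z g (M + Z.of_nat j) N) in *.
replace (S1 - sum_Z g M N)%C with ((S1 - S2) + (S2 - sum_Z g M N))%C by ring.
eapply Rle_trans; [apply Cmod_triangle|].
assert (P : forall c r, 0 < c -> 0 <= A / c * exp r).
{ intros c r Hc. apply Rmult_le_pos; [|apply Rlt_le, exp_pos]. apply Rmult_le_pos; [exact HA|].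
  apply Rlt_le, Rinv_0_lt_compat, Hc. }
generalize (P a (- (a * (IZR (M + Z.of_nat j) * h))) Ha) (P b (- (b * (IZR (N + Z.of_nat i) * h))) Hb).
lra.
Qed.

Lemma sum_Z_minus (f g : Z -> C) (M N : Z) :
  sum_Z (fun k => f k - g k)%C M N = (sum_Z f M N - sum_Z g M N)%C.
Proof.
unfold sum_Z. fold (CS (fun i => f (Z.of_nat i - M)%Z - g (Z.of_nat i - M)%Z)%C (Z.to_nat (N + M))).
fold (CS (fun i => f (Z.of_nat i - M)%Z) (Z.to_nat (N + M))).
fold (CS (fun i => g (Z.of_nat i - M)%Z) (Z.to_nat (N + M))).
induction (Z.to_nat (N + M)) as [|n IH].
- rewrite !sum_OC. reflexivity.
- rewrite !sum_SnC, IH. ring.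
Qed.

Lemma sum_Z_ext (f g : Z -> C) (M N : Z) : (forall k, f k = g k) -> sum_Z f M N = sum_Z g M N.
Proof. intros H. unfold sum_Z. apply sum_n_ext. intros i. apply H. Qed.

Lemma one_plus_csinh2 (z : C) : (1 + csinh z * csinh z = ccosh z * ccosh z)%C.
Proof.
destruct z as [x y]. unfold csinh, ccosh, Cmult; simpl.
generalize (cosh2_sinh2 x) (sin2_cos2' y). intros H1 H2.
apply injective_projections; simpl; [|ring].
set (c := cosh x) in *. set (s := sinh x) in *. set (p := cos y) in *. set (q := sin y) in *.
replace (c * p * (c * p)) with (c * c * (p * p)) by ring.
replace (c * q * (c * q)) with (c * c * (q * q)) by ring.
rewrite H1. replace (p * p) with (1 - q * q) by lra.
replace (s * p * (s * p)) with (s * s * (p * p)) by ring. replace (p * p) with (1 - q * q) by lra. ring.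
Qed.

Lemma Cmod_ccosh_lower (s y : R) : cosh s * Rabs (cos y) <= Cmod (ccosh (s, y)).
Proof.
apply le_of_sqr_le; [apply Cmod_ge_0|]. rewrite Cmod2_alt. unfold ccosh; simpl.
assert (E : Rabs (cos y) * Rabs (cos y) = cos y * cos y).
{ rewrite <- Rabs_mult. apply Rabs_pos_eq. apply Rle_0_sqr. }
replace (cosh s * Rabs (cos y) * (cosh s * Rabs (cos y))) with (cosh s * cosh s * (cos y * cos y)).
- generalize (Rle_0_sqr (sinh s * sin y)); unfold Rsqr. lra.
- rewrite <- E. ring.
Qed.

Lemma cosh_lower (s : R) : exp (Rabs s) / 2 <= cosh s.
Proof.
unfold cosh. generalize (exp_pos s) (exp_pos (- s)). unfold Rabs. destruct (Rcase_abs s); lra.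
Qed.

(* Covers [kappa = cos d] off the real axis and [kappa = 1] on it. *)
Lemma decay_bound (f : C -> C) (K gam nu kappa s y : R) : 0 < K -> 0 < gam <= nu ->
  0 < kappa <= 1 -> kappa <= cos y ->
  Cmod (f (csinh (s, y))) <= K * Rpower (Cmod (1 + csinh (s, y) * csinh (s, y))) (- (gam + 1) / 2) ->
  Cmod (f (csinh (s, y)) * ccosh (s, y)) <= K * Rpower (2 / kappa) nu * exp (- (gam * Rabs s)).
Proof.
intros HK Hg Hk Hky Hf.
rewrite one_plus_csinh2, Cmod_mult in Hf. rewrite Cmod_mult.
set (m := Cmod (ccosh (s, y))) in *.
assert (Hm : exp (Rabs s) / 2 * kappa <= m).
{ eapply Rle_trans; [|apply Cmod_ccosh_lower]. apply Rmult_le_compat.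
  - generalize (exp_pos (Rabs s)); lra.
  - lra.
  - apply cosh_lower.
  - eapply Rle_trans; [exact Hky|apply Rle_abs]. }
assert (He := exp_pos (Rabs s)).
assert (Hm0 : 0 < m) by (eapply Rlt_le_trans; [|exact Hm]; apply Rmult_lt_0_compat; lra).
assert (Hl : Rabs s - ln (2 / kappa) <= ln m).
{ replace (Rabs s - ln (2 / kappa)) with (ln (exp (Rabs s) / 2 * kappa)).
  - destruct Hm as [Hm| <-]; [left; apply ln_increasing; [apply Rmult_lt_0_compat; lra|exact Hm]|right; reflexivity].
  - rewrite ln_mult by lra. rewrite !ln_div by lra. rewrite ln_exp. ring. }
assert (Hl0 : 0 <= ln (2 / kappa)).
{ rewrite <- ln_1. apply ln_le; [lra|].
  apply Rmult_le_reg_r with kappa; [lra|]. unfold Rdiv. rewrite Rmult_assoc, Rinv_l; lra. }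
(* As [|1 + sinh^2| = m^2], the hypothesis gives [K m^(- (gam + 1))], and the factor [cosh] of the
   substitution takes up one power of [m]. *)
apply Rle_trans with (K * exp (- gam * ln m)).
- apply Rle_trans with (K * Rpower (m * m) (- (gam + 1) / 2) * m).
  + apply Rmult_le_compat_r; [lra|exact Hf].
  + right. rewrite Rmult_assoc. f_equal. rewrite <- (exp_ln m Hm0) at 3. unfold Rpower.
    rewrite <- exp_plus, ln_mult by lra. f_equal. field.
- rewrite Rmult_assoc. apply Rmult_le_compat_l; [lra|]. unfold Rpower. rewrite <- exp_plus. apply exp_le.
  (* Since [2 / kappa >= 1], the exponent [gam] of the constant may be raised to [nu], which serves
     both half-strips. *)
  apply Rle_trans with (gam * (ln (2 / kappa) - Rabs s)); [nra|].
  assert (gam * ln (2 / kappa) <= nu * ln (2 / kappa)) by (apply Rmult_le_compat_r; lra). lra.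
Qed.

(** * The improper integral *)

Definition pullback (f : C -> C) (z : C) : C := (f (csinh z) * ccosh z)%C.

Lemma cdiff_pullback (f : C -> C) (z : C) : Cdiff f (csinh z) -> cdiff (pullback f) z.
Proof.
intros H. apply cdiff_mult; [|apply cdiff_ccosh].
apply (cdiff_comp f csinh); [apply Cdiff_cdiff, H|apply cdiff_csinh].
Qed.

Lemma csinh_RtoC (s : R) : csinh (RtoC s) = RtoC (sinh s).
Proof. unfold csinh; simpl. rewrite cos_0, sin_0. apply injective_projections; simpl; ring. Qed.

Lemma ccosh_RtoC (s : R) : ccosh (RtoC s) = RtoC (cosh s).
Proof. unfold ccosh; simpl. rewrite cos_0, sin_0. apply injective_projections; simpl; ring. Qed.

Lemma is_RInt_pullback (f : C -> C) (a x : R) :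
  (forall s : R, @continuous C_UniformSpace C_UniformSpace f (RtoC (sinh s))) ->
  @is_RInt C_R_NormedModule (fun t => f (RtoC t)) (sinh a) (sinh x)
    (CI (fun s => pullback f (RtoC s)) a x).
Proof.
intros Hf.
assert (Hc : forall t, @continuous R_UniformSpace C_UniformSpace (fun t => f (RtoC t)) t).
{ intros t. rewrite <- (sinh_arcsinh t). apply (continuous_hor f _ 0), Hf. }
assert (HR := is_RInt_comp (V:=C_R_CompleteNormedModule) (fun t => f (RtoC t)) sinh cosh a x).
assert (E : CI (fun s => pullback f (RtoC s)) a x = CI (fun t => f (RtoC t)) (sinh a) (sinh x)).
{ apply CI_unique. eapply is_RInt_ext; [|apply HR].
  - intros s _. unfold pullback. rewrite csinh_RtoC, ccosh_RtoC.
    destruct (f (RtoC (sinh s))) as [u v]. apply injective_projections; simpl; unfold scal; simpl; unfold mult; simpl; ring.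
  - intros s _. apply Hc.
  - intros s _. split; [apply is_derive_sinh|].
    apply (ex_derive_continuous cosh). eexists. apply is_derive_cosh. }
rewrite E. apply is_CI. apply (ex_RInt_continuous (V:=C_R_CompleteNormedModule)). intros t _; apply Hc.
Qed.

Lemma CI_exp_tail (F : R -> C) (c al u v : R) : 0 < al -> u <= v -> exC F u v ->
  (forall s, u <= s <= v -> Cmod (F s) <= c * exp (al * s)) ->
  Cmod (CI F u v) <= c / al * (exp (al * v) - exp (al * u)).
Proof.
intros Ha Huv Hex HF.
assert (HB : is_RInt (fun s => c * exp (al * s)) u v (c / al * exp (al * v) - c / al * exp (al * u))).
{ apply (is_RInt_derive (V:=R_CompleteNormedModule) (fun s => c / al * exp (al * s))).
  - intros s _. auto_derive; [exact I|]. field. lra.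
  - intros s _. apply (ex_derive_continuous (fun s => c * exp (al * s))). auto_derive. exact I. }
rewrite Rmult_minus_distr_l, <- (is_RInt_unique _ _ _ _ HB).
apply CI_norm; [exact Huv|exact Hex|eexists; exact HB|exact HF].
Qed.

Lemma exp_small (al eps : R) : 0 < al -> 0 < eps -> exists A, A <= 0 /\ forall s, s < A -> exp (al * s) < eps.
Proof.
intros Ha He. exists (Rmin 0 (ln eps / al)). split; [apply Rmin_l|]. intros s Hs.
rewrite <- (exp_ln eps He). apply exp_increasing.
assert (s < ln eps / al) by (eapply Rlt_le_trans; [exact Hs|apply Rmin_r]).
replace (ln eps) with (al * (ln eps / al)) by (field; lra). apply Rmult_lt_compat_l; lra.
Qed.

(** By Cauchy's criterion: two such integrals differ by an integral far to the left, dominated by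
    that of the exponential. *)
Lemma CI_limit_m_infty (F : R -> C) (c al x : R) : 0 < c -> 0 < al ->
  (forall s, @continuous R_UniformSpace C_UniformSpace F s) ->
  (forall s, s < 0 -> Cmod (F s) <= c * exp (al * s)) ->
  exists I : C, filterlim (fun a => CI F a x) (Rbar_locally m_infty) (@locally C_UniformSpace I).
Proof.
intros Hc Ha HF Hb.
assert (Hex : forall u v, exC F u v).
{ intros u v. apply (ex_RInt_continuous (V:=C_R_CompleteNormedModule)). intros t _; apply HF. }
apply (filterlim_locally_cauchy (U:=C_R_CompleteNormedModule) (F:=Rbar_locally m_infty) (fun a => CI F a x)).
intros eps.
destruct (exp_small al (eps * al / c) Ha) as [A [HA H]].
{ apply Rdiv_lt_0_compat; [|exact Hc]. apply Rmult_lt_0_compat; [apply cond_pos|exact Ha]. }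
exists (fun a => a < A). split; [exists A; auto|].
assert (K : forall u v, u <= v -> v < A -> Cmod (CI F u x - CI F v x) < eps).
{ intros u v Huv Hv. rewrite (CI_Chasles F u v x) by apply Hex.
  replace (CI F u v + CI F v x - CI F v x)%C with (CI F u v) by ring.
  eapply Rle_lt_trans; [apply (CI_exp_tail F c al u v Ha Huv (Hex u v))|].
  - intros s Hs. apply Hb. lra.
  - assert (H1 := H v Hv). assert (H2 := exp_pos (al * u)).
    apply Rle_lt_trans with (c / al * exp (al * v)).
    + apply Rmult_le_compat_l; [apply Rlt_le, Rdiv_lt_0_compat; assumption|lra].
    + replace (pos eps) with (c / al * (eps * al / c)) by (field; lra).
      apply Rmult_lt_compat_l; [apply Rdiv_lt_0_compat; assumption|exact H1]. }
assert (K' : forall u v, u < A -> v < A -> Cmod (CI F v x - CI F u x) < eps).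
{ intros u v Hu Hv. destruct (Rle_lt_dec v u); [apply K; assumption|].
  rewrite <- Cmod_opp. replace (- (CI F v x - CI F u x))%C with (CI F u x - CI F v x)%C by ring.
  apply K; lra. }
intros u v Hu Hv. destruct (Re_Im_le_Cmod (CI F v x - CI F u x)) as [A1 A2].
specialize (K' u v Hu Hv). split; [eapply Rle_lt_trans; [apply A1|exact K']|eapply Rle_lt_trans; [apply A2|exact K']].
Qed.

Lemma filterlim_m_infty_eps (Phi : R -> C) (I : C) (eps : R) : 0 < eps ->
  filterlim Phi (Rbar_locally m_infty) (@locally C_UniformSpace I) ->
  exists A, forall a, a < A -> Cmod (I - Phi a) <= eps.
Proof.
intros He H. assert (He2 : 0 < eps / 2) by lra.
destruct (H _ (locally_ball I (mkposreal _ He2))) as [A HA].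
exists A. intros a Ha. destruct (HA a Ha) as [B1 B2].
rewrite <- Cmod_opp. replace (- (I - Phi a))%C with (Phi a - I)%C by ring.
eapply Rle_trans; [apply Cmod_le_Rabs|].
change (Rabs (Re (Phi a) - Re I) < eps / 2) in B1. change (Rabs (Im (Phi a) - Im I) < eps / 2) in B2.
change (Rabs (Re (Phi a) - Re I) + Rabs (Im (Phi a) - Im I) <= eps). lra.
Qed.

Lemma is_RInt_gen_pullback (f : C -> C) (tau : R) (I : C) :
  (forall s : R, @continuous C_UniformSpace C_UniformSpace f (RtoC (sinh s))) ->
  filterlim (fun a => CI (fun s => pullback f (RtoC s)) a (arcsinh tau)) (Rbar_locally m_infty) (@locally C_UniformSpace I) ->
  @is_RInt_gen C_R_NormedModule (fun t : R => f (RtoC t)) (Rbar_locally m_infty) (at_point tau) I.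
Proof.
intros Hf HI P HP.
destruct (HI P HP) as [A HA].
apply (Filter_prod _ _ _ (fun a => a < sinh A) (fun b => b = tau)).
- exists (sinh A). auto.
- reflexivity.
- intros a b Ha ->. exists (CI (fun s => pullback f (RtoC s)) (arcsinh a) (arcsinh tau)). split.
  + simpl. rewrite <- (sinh_arcsinh a) at 1. rewrite <- (sinh_arcsinh tau) at 1. apply is_RInt_pullback, Hf.
  + apply HA. rewrite <- (arcsinh_sinh A). apply arcsinh_lt, Ha.
Qed.

Lemma narrower_strip (om d : R) : 0 < om -> 0 < d ->
  exists t, 0 < t < d /\ 2 * d * sinh (om * d) <= PI * (t * sinh (om * t)).
Proof.
intros Ho Hd. generalize PI_bounds; intros HP.
assert (Hs : 0 < sinh (om * d)) by (apply sinh_pos, Rmult_lt_0_compat; assumption).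
assert (Hc : continuity_pt (fun t => PI * (t * sinh (om * t))) d).
{ apply derivable_continuous_pt. exists (PI * (sinh (om * d) + d * (om * cosh (om * d)))).
  apply is_derive_Reals. auto_derive; [exact I|ring]. }
assert (Hp : 0 < d * sinh (om * d)) by (apply Rmult_lt_0_compat; assumption).
(* A deviation below [d sinh (om d)] from the value at [d] leaves more than
   [(PI - 1) d sinh (om d)], and [PI - 1 >= 2]. *)
destruct (Hc (d * sinh (om * d)) Hp) as [dl [Hdl H]].
assert (Hm : 0 < Rmin dl d) by (apply Rmin_pos; assumption).
assert (L1 := Rmin_l dl d). assert (L2 := Rmin_r dl d).
exists (d - Rmin dl d / 2). split; [lra|].
assert (X : Rabs (PI * ((d - Rmin dl d / 2) * sinh (om * (d - Rmin dl d / 2))) - PI * (d * sinh (om * d))) < d * sinh (om * d)).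
{ apply H. split; [split; [exact I|lra]|]. simpl. unfold Rdist. rewrite Rabs_left; lra. }
apply Rabs_def2 in X. nra.
Qed.

Lemma exp_neg_le (c X : R) : 0 < c -> 0 < X -> exp (- (c * X)) <= / (c * X).
Proof.
intros Hc HX. assert (0 < c * X) by (apply Rmult_lt_0_compat; assumption).
rewrite exp_Ropp. apply Rinv_le_contravar; [assumption|]. generalize (exp_ineq1_le (c * X)); lra.
Qed.

(** The square of [exp_neg_le] at the rate [c / 2]. *)
Lemma X_exp_neg_le (c X : R) : 0 < c -> 0 < X -> X * exp (- (c * X)) <= 4 / (c * c) / X.
Proof.
intros Hc HX. assert (H := exp_neg_le (c / 2) X ltac:(lra) HX).
replace (exp (- (c * X))) with (exp (- (c / 2 * X)) * exp (- (c / 2 * X))) by (rewrite <- exp_plus; f_equal; field).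
assert (Hp := exp_pos (- (c / 2 * X))).
apply Rle_trans with (X * (/ (c / 2 * X) * / (c / 2 * X))).
- apply Rmult_le_compat_l; [lra|]. apply Rmult_le_compat; lra.
- right. field. lra.
Qed.

(** * Error of sinc indefinite integration *)

Lemma is_RInt_two_sided_exp (bd : R -> R) (c al be X : R) : 0 < al -> 0 < be -> 0 <= X ->
  (forall s, s < 0 -> bd s = c * exp (- (al * Rabs s))) ->
  (forall s, 0 <= s -> bd s = c * exp (- (be * Rabs s))) ->
  is_RInt bd (- X) X (c / al * (1 - exp (- (al * X))) + c / be * (1 - exp (- (be * X)))).
Proof.
intros Ha Hb HX H1 H2.
apply (is_RInt_Chasles (V:=R_NormedModule) bd (- X) 0 X).
- apply (is_RInt_ext (V:=R_NormedModule) (fun s => c * exp (al * s))).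
  { rewrite Rmin_left, Rmax_right by lra. intros s Hs. rewrite H1 by lra. rewrite Rabs_left by lra.
    apply (f_equal (fun r => c * exp r)). ring. }
  replace (c / al * (1 - exp (- (al * X)))) with (minus (c / al * exp (al * 0)) (c / al * exp (al * - X))).
  2:{ rewrite Rmult_0_r, exp_0. replace (al * - X) with (- (al * X)) by ring. unfold minus, plus, opp; simpl. ring. }
  apply (is_RInt_derive (V:=R_CompleteNormedModule) (fun s => c / al * exp (al * s))).
  + intros s _. auto_derive; [exact I|]. field. lra.
  + intros s _. apply (ex_derive_continuous (fun s => c * exp (al * s))). auto_derive. exact I.
- apply (is_RInt_ext (V:=R_NormedModule) (fun s => c * exp (- (be * s)))).
  { rewrite Rmin_left, Rmax_right by lra. intros s Hs. rewrite H2 by lra. rewrite Rabs_pos_eq by lra. reflexivity. }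
  replace (c / be * (1 - exp (- (be * X)))) with (minus (- c / be * exp (- (be * X))) (- c / be * exp (- (be * 0)))).
  2:{ rewrite Rmult_0_r, Ropp_0, exp_0. unfold minus, plus, opp; simpl. field. lra. }
  apply (is_RInt_derive (V:=R_CompleteNormedModule) (fun s => - c / be * exp (- (be * s)))).
  + intros s _. auto_derive; [exact I|]. field. lra.
  + intros s _. apply (ex_derive_continuous (fun s => c * exp (- (be * s)))). auto_derive. exact I.
Qed.

(** The terms coming from the lower limit [- X / 2] vanish as [X] grows. Nodes right of [- X / 4]
    are at least [X / 4] away from it, so [J_left_bound] gains a factor [1 / X]. The others have
    [|F| <= c0 exp (- mu X / 4)], and their number is at most proportional to [X / h]. *)
Lemma grid_left_sum (F : C -> C) (c0 al be mu h X : R) (L : nat) :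
  0 < h -> 0 < c0 -> 0 < al -> 0 < be -> 0 < mu -> mu <= al -> 0 < X -> INR L * h <= X ->
  (forall s : R, s < 0 -> Cmod (F (RtoC s)) <= c0 * exp (- (al * Rabs s))) ->
  (forall s : R, 0 <= s -> Cmod (F (RtoC s)) <= c0 * exp (- (be * Rabs s))) ->
  Cmod (sum_Z (fun k => F (RtoC (IZR k * h)) * RtoC (J (IZR k) h (- (X / 2))))%C (Z.of_nat L) (Z.of_nat L)) <=
  (2 * c0 * (h * h) + 4 * c0 * h * (/ al + / be) + 141 * c0 / (mu * mu)) / X.
Proof.
intros Hh Hc0 Hal Hbe Hmu Hma HX HL Hl Hr.
set (g := fun k => (F (RtoC (IZR k * h)) * RtoC (J (IZR k) h (- (X / 2))))%C).
set (A := c0 * (4 * h / X)). set (v := 11 / 10 * h * (c0 * exp (- (mu / 4 * X)))).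
assert (Hv : 0 <= v).
{ unfold v. apply Rmult_le_pos; [lra|]. apply Rmult_le_pos; [lra|apply Rlt_le, exp_pos]. }
assert (HhX : 0 < 4 * h / X) by (apply Rdiv_lt_0_compat; lra).
assert (HA : 0 <= A) by (unfold A; nra).
assert (HJ : forall k : R, - (X / 4) <= k * h -> Rabs (J k h (- (X / 2))) <= h * (4 * h / X)).
{ intros k Hk. eapply Rle_trans; [apply J_left_bound; lra|].
  replace (h * (4 * h / X)) with (h * h / (X / 4)) by (field; lra).
  apply Rmult_le_compat_l; [nra|]. apply Rinv_le_contravar; lra. }
assert (T := sum_Z_tails g A al be h v 0 0 L L HA Hal Hbe Hh ltac:(lia) ltac:(lia)).
rewrite !Z.add_0_l, !Rmult_0_l, !Rmult_0_r, !Ropp_0, !exp_0 in T.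
assert (G0 : sum_Z g 0 0 = g 0%Z).
{ unfold sum_Z. etransitivity; [apply sum_OC|]. reflexivity. }
rewrite G0 in T.
assert (B0 : Cmod (g 0%Z) <= c0 * (2 * (h * h) / X)).
{ unfold g. rewrite Cmod_mult, Cmod_R. apply Rmult_le_compat; [apply Cmod_ge_0|apply Rabs_pos| |].
  - rewrite Rmult_0_l. eapply Rle_trans; [apply Hr; lra|]. rewrite Rabs_R0, Rmult_0_r, Ropp_0, exp_0. lra.
  - eapply Rle_trans; [apply J_left_bound; lra|]. right. field. lra. }
assert (T' : Cmod (sum_Z g (Z.of_nat L) (Z.of_nat L) - g 0%Z) <= A / al * 1 + A / be * 1 + (INR L + INR L) * v).
{ apply T.
  - intros k Hk. apply IZR_lt in Hk. unfold g. rewrite Cmod_mult, Cmod_R.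
    assert (Hkh : 0 < IZR k * h) by (apply Rmult_lt_0_compat; assumption).
    assert (H1 := Hr (IZR k * h) ltac:(lra)). rewrite (Rabs_pos_eq (IZR k * h)) in H1 by lra.
    assert (H2 := HJ (IZR k) ltac:(lra)).
    assert (H3 := Rmult_le_compat _ _ _ _ (Cmod_ge_0 _) (Rabs_pos _) H1 H2).
    unfold A. lra.
  - intros k Hk. apply IZR_lt in Hk. unfold g. rewrite Cmod_mult, Cmod_R, opp_IZR.
    assert (Hkh : 0 < IZR k * h) by (apply Rmult_lt_0_compat; assumption).
    assert (H1 := Hl (- IZR k * h) ltac:(lra)).
    rewrite <- Ropp_mult_distr_l, Rabs_Ropp, (Rabs_pos_eq (IZR k * h)) in H1 by lra.
    rewrite <- Ropp_mult_distr_l.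
    destruct (Rle_lt_dec (IZR k * h) (X / 4)) as [Hc|Hc].
    + assert (H2 := HJ (- IZR k) ltac:(lra)).
      assert (H3 := Rmult_le_compat _ _ _ _ (Cmod_ge_0 _) (Rabs_pos _) H1 H2).
      unfold A. lra.
    + assert (H2 := J_bound (- IZR k) h (- (X / 2)) Hh).
      assert (He : exp (- (al * (IZR k * h))) <= exp (- (mu / 4 * X))).
      { apply exp_le, Ropp_le_contravar. nra. }
      assert (H1' : Cmod (F (RtoC (- (IZR k * h)))) <= c0 * exp (- (mu / 4 * X))).
      { eapply Rle_trans; [exact H1|]. apply Rmult_le_compat_l; lra. }
      assert (H3 := Rmult_le_compat _ _ _ _ (Cmod_ge_0 _) (Rabs_pos _) H1' H2).
      assert (0 <= A * (h * exp (- (al * (IZR k * h))))).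
      { apply Rmult_le_pos; [exact HA|]. apply Rmult_le_pos; [lra|apply Rlt_le, exp_pos]. }
      unfold v. lra. }
replace (sum_Z g (Z.of_nat L) (Z.of_nat L)) with ((sum_Z g (Z.of_nat L) (Z.of_nat L) - g 0%Z) + g 0%Z)%C by ring.
eapply Rle_trans; [apply Cmod_triangle|].
assert (V : (INR L + INR L) * v <= 141 * c0 / (mu * mu) / X).
{ assert (E := X_exp_neg_le (mu / 4) X ltac:(lra) HX).
  unfold v. replace ((INR L + INR L) * (11 / 10 * h * (c0 * exp (- (mu / 4 * X)))))
    with (22 / 10 * c0 * (INR L * h * exp (- (mu / 4 * X)))) by field.
  apply Rle_trans with (22 / 10 * c0 * (4 / (mu / 4 * (mu / 4)) / X)).
  - apply Rmult_le_compat_l; [lra|]. eapply Rle_trans; [|exact E].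
    apply Rmult_le_compat_r; [apply Rlt_le, exp_pos|exact HL].
  (* [2.2 * 4 * 16 = 140.8], rounded up to 141. *)
  - replace (22 / 10 * c0 * (4 / (mu / 4 * (mu / 4)) / X)) with (1408 / 10 * (c0 / (mu * mu) / X)) by (field; lra).
    replace (141 * c0 / (mu * mu) / X) with (141 * (c0 / (mu * mu) / X)) by (field; lra).
    apply Rmult_le_compat_r; [|lra]. apply Rlt_le, Rdiv_lt_0_compat; [apply Rdiv_lt_0_compat; nra|exact HX]. }
replace ((2 * c0 * (h * h) + 4 * c0 * h * (/ al + / be) + 141 * c0 / (mu * mu)) / X) with
  (c0 * (2 * (h * h) / X) + (A / al * 1 + A / be * 1) + 141 * c0 / (mu * mu) / X) by (unfold A; field; lra).
lra.
Qed.

(** The first term is the discretization error, the second the truncation. All other contributions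
    are below [del] for large [X]: the integral left of [a], the vertical sides, and the grid sum at
    [a]. *)
Theorem sinc_indefinite_error (F : C -> C) (c c0 al be d h om x : R) (M N : Z) (I : C) :
  0 < h -> om * h = PI -> 0 < d -> 0 < c -> 0 < c0 -> 0 < al -> 0 < be ->
  (forall z : C, Rabs (Im z) < d -> cdiff F z) ->
  (forall s y, Rabs y < d -> s < 0 -> Cmod (F (s, y)) <= c * exp (- (al * Rabs s))) ->
  (forall s y, Rabs y < d -> 0 <= s -> Cmod (F (s, y)) <= c * exp (- (be * Rabs s))) ->
  (forall s : R, s < 0 -> Cmod (F (RtoC s)) <= c0 * exp (- (al * Rabs s))) ->
  (forall s : R, 0 <= s -> Cmod (F (RtoC s)) <= c0 * exp (- (be * Rabs s))) ->
  filterlim (fun a => CI (fun s => F (RtoC s)) a x) (Rbar_locally m_infty) (@locally C_UniformSpace I) ->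
  (0 <= M)%Z -> (0 <= N)%Z ->
  Cmod (I - sum_Z (fun k => F (RtoC (IZR k * h)) * RtoC (J (IZR k) h x))%C M N) <=
  c * (/ al + / be) * (h / (2 * d * sinh (om * d))) +
  11 / 10 * c0 * (exp (- (al * (IZR M * h))) / al + exp (- (be * (IZR N * h))) / be).
Proof.
intros Hh Hoh Hd Hc Hc0 Hal Hbe HF Hbl Hbr Hrl Hrr HI HM HN.
generalize PI_bounds; intros HPI.
assert (Ho : 0 < om) by (apply Rmult_lt_reg_r with h; lra).
destruct (narrower_strip om d Ho Hd) as [t [Ht Hnar]].
assert (Hsd : 0 < sinh (om * d)) by (apply sinh_pos, Rmult_lt_0_compat; lra).
assert (Hst : 0 < sinh (om * t)) by (apply sinh_pos, Rmult_lt_0_compat; lra).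
assert (Hia := Rinv_0_lt_compat al Hal). assert (Hib := Rinv_0_lt_compat be Hbe).
set (mu := Rmin al be). assert (Hmu : 0 < mu) by (apply Rmin_pos; assumption).
assert (Hma : mu <= al) by apply Rmin_l. assert (Hmb : mu <= be) by apply Rmin_r.
(* [Q / X] bounds the grid sum at [a], and [4 t c / (mu X)] the vertical sides; [W] collects
   both. *)
set (Q := (2 * c0 * (h * h) + 4 * c0 * h * (/ al + / be) + 141 * c0 / (mu * mu))).
set (W := 4 * t * c / mu + Q).
assert (HW : 0 < W).
{ assert (0 < t * c) by (apply Rmult_lt_0_compat; lra). assert (0 < mu * mu) by (apply Rmult_lt_0_compat; lra).
  assert (0 < h * h) by (apply Rmult_lt_0_compat; lra). assert (0 < c0 * h) by (apply Rmult_lt_0_compat; lra).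
  assert (0 < c0 * (h * h)) by (apply Rmult_lt_0_compat; lra).
  unfold W, Q. assert (0 < 4 * t * c / mu) by (apply Rdiv_lt_0_compat; lra).
  assert (0 < 141 * c0 / (mu * mu)) by (apply Rdiv_lt_0_compat; lra).
  assert (0 < 4 * c0 * h * (/ al + / be)) by (apply Rmult_lt_0_compat; lra). lra. }
apply le_epsilon. intros del Hdel.
destruct (filterlim_m_infty_eps _ I (del / 2) ltac:(lra) HI) as [A0 HA0].
(* The three lower bounds keep [|x|] below [X / 2], put [a = - X / 2] to the left of [A0], and make
   [W / X] at most [del / 2]. *)
set (X0 := Rmax (2 * Rabs x) (Rmax (1 - 2 * A0) (2 * W / del))).
destruct (nfloor_ex (X0 / h)) as [L0 [_ HL0]].
{ apply Rlt_le, Rdiv_lt_0_compat; [|exact Hh]. unfold X0.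
  eapply Rlt_le_trans; [|eapply Rle_trans; [apply Rmax_r|apply Rmax_r]]. apply Rdiv_lt_0_compat; lra. }
(* Large enough also for [[-L, L]] to contain [[-M, N]]. *)
set (L := (L0 + 1 + Z.to_nat M + Z.to_nat N)%nat).
set (X := (INR L + / 2) * h).
assert (HLX : X0 < X).
{ replace X0 with (X0 / h * h) by (field; lra). apply Rmult_lt_compat_r; [exact Hh|].
  apply Rlt_le_trans with (INR L0 + 1); [exact HL0|].
  unfold L. rewrite !plus_INR. simpl. generalize (pos_INR (Z.to_nat M)) (pos_INR (Z.to_nat N)). lra. }
assert (HX1 : 2 * Rabs x < X) by (eapply Rle_lt_trans; [apply Rmax_l|exact HLX]).
assert (HX2 : 1 - 2 * A0 < X) by (eapply Rle_lt_trans; [eapply Rle_trans; [apply Rmax_l|apply Rmax_r]|exact HLX]).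
assert (HX3 : 2 * W / del < X) by (eapply Rle_lt_trans; [eapply Rle_trans; [apply Rmax_r|apply Rmax_r]|exact HLX]).
assert (HX : 0 < X) by (generalize (Rabs_pos x); lra).
assert (Hxx := Rle_abs x). assert (Hxx' := Rle_abs (- x)). rewrite Rabs_Ropp in Hxx'.
assert (HWX : W / X <= del / 2).
{ apply Rmult_le_reg_r with X; [exact HX|]. replace (W / X * X) with W by (field; lra).
  apply (Rmult_lt_compat_r (del / 2)) in HX3; [|lra].
  replace (2 * W / del * (del / 2)) with W in HX3 by (field; lra). lra. }
set (a := - (X / 2)).
assert (S1 := HA0 a ltac:(unfold a; lra)).
set (bd := fun s => if Rlt_dec s 0 then c * exp (- (al * Rabs s)) else c * exp (- (be * Rabs s))).
assert (Hbd1 : forall s, s < 0 -> bd s = c * exp (- (al * Rabs s))).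
{ intros s Hs. unfold bd. destruct (Rlt_dec s 0); [reflexivity|lra]. }
assert (Hbd2 : forall s, 0 <= s -> bd s = c * exp (- (be * Rabs s))).
{ intros s Hs. unfold bd. destruct (Rlt_dec s 0); [lra|reflexivity]. }
assert (HB := is_RInt_two_sided_exp bd c al be X Hal Hbe ltac:(lra) Hbd1 Hbd2).
set (B := c / al * (1 - exp (- (al * X))) + c / be * (1 - exp (- (be * X)))) in *.
assert (HB2 : B <= c * (/ al + / be)).
{ unfold B, Rdiv. assert (P1 := exp_pos (- (al * X))). assert (P2 := exp_pos (- (be * X))).
  assert (0 <= c * / al) by nra. assert (0 <= c * / be) by nra. nra. }
assert (Hmono : forall r, mu <= r -> c * exp (- (r * X)) <= c * exp (- (mu * X))).
{ intros r Hr. apply Rmult_le_compat_l; [lra|]. apply exp_le, Ropp_le_contravar, Rmult_le_compat_r; lra. }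
assert (S2 := truncated_error F bd d t h om a x (X / 2) X (c * exp (- (mu * X))) B L Hh Hoh Ht eq_refl HF
  ltac:(unfold a; lra) ltac:(lra) ltac:(lra) ltac:(unfold a; lra)).
assert (S2' := S2 ltac:(intros s y Hs Hy; destruct (Rlt_le_dec s 0);
    [rewrite Hbd1 by assumption; apply Hbl; [lra|assumption]|rewrite Hbd2 by assumption; apply Hbr; [lra|assumption]])
  HB ltac:(rewrite Hbd2 by lra; rewrite Rabs_pos_eq by lra; apply Hmono; assumption)
  ltac:(rewrite Hbd1 by lra; rewrite Rabs_left by lra; rewrite Ropp_involutive; apply Hmono; assumption)).
clear S2.
assert (S3 := grid_left_sum F c0 al be mu h X L Hh Hc0 Hal Hbe Hmu Hma HX ltac:(unfold X; nra) Hrl Hrr).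
fold a in S3. fold Q in S3.
set (gx := fun k => (F (RtoC (IZR k * h)) * RtoC (J (IZR k) h x))%C).
set (ga := fun k => (F (RtoC (IZR k * h)) * RtoC (J (IZR k) h a))%C) in *.
assert (S4 : Cmod (sum_Z gx (Z.of_nat L) (Z.of_nat L) - sum_Z gx M N) <=
   11 / 10 * c0 * (exp (- (al * (IZR M * h))) / al + exp (- (be * (IZR N * h))) / be)).
{ assert (T := sum_Z_tails gx (11 / 10 * c0) al be h 0 M N (L - Z.to_nat N) (L - Z.to_nat M)
    ltac:(lra) Hal Hbe Hh HM HN).
  replace (M + Z.of_nat (L - Z.to_nat M))%Z with (Z.of_nat L) in T by (unfold L; lia).
  replace (N + Z.of_nat (L - Z.to_nat N))%Z with (Z.of_nat L) in T by (unfold L; lia).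
  replace (11 / 10 * c0 * (exp (- (al * (IZR M * h))) / al + exp (- (be * (IZR N * h))) / be)) with
   (11 / 10 * c0 / al * exp (- (al * (IZR M * h))) + 11 / 10 * c0 / be * exp (- (be * (IZR N * h))) +
    (INR (L - Z.to_nat N) + INR (L - Z.to_nat M)) * 0) by (field; lra).
  apply T.
  - intros k Hk. apply IZR_lt in Hk. unfold gx. rewrite Cmod_mult, Cmod_R.
    assert (Hkh : 0 < IZR k * h) by (apply Rmult_lt_0_compat; assumption).
    assert (H1 := Hrr (IZR k * h) ltac:(lra)). rewrite (Rabs_pos_eq (IZR k * h)) in H1 by lra.
    assert (H3 := Rmult_le_compat _ _ _ _ (Cmod_ge_0 _) (Rabs_pos _) H1 (J_bound (IZR k) h x Hh)). lra.
  - intros k Hk. apply IZR_lt in Hk. unfold gx. rewrite Cmod_mult, Cmod_R, opp_IZR.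
    assert (Hkh : 0 < IZR k * h) by (apply Rmult_lt_0_compat; assumption).
    assert (H1 := Hrl (- IZR k * h) ltac:(lra)).
    rewrite <- Ropp_mult_distr_l, Rabs_Ropp, (Rabs_pos_eq (IZR k * h)) in H1 by lra.
    rewrite <- Ropp_mult_distr_l.
    assert (H3 := Rmult_le_compat _ _ _ _ (Cmod_ge_0 _) (Rabs_pos _) H1 (J_bound (- IZR k) h x Hh)). lra. }
assert (ES : sum_Z (fun k => F (RtoC (IZR k * h)) * RtoC (J (IZR k) h x - J (IZR k) h a))%C (Z.of_nat L) (Z.of_nat L)
  = (sum_Z gx (Z.of_nat L) (Z.of_nat L) - sum_Z ga (Z.of_nat L) (Z.of_nat L))%C).
{ rewrite <- sum_Z_minus. apply sum_Z_ext. intros k. unfold gx, ga. rewrite RtoC_minus. ring. }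
rewrite ES in S2'. clear ES.
set (Phi := CI (fun s => F (RtoC s)) a x) in *.
replace (I - sum_Z gx M N)%C with
  ((I - Phi) + (Phi - (sum_Z gx (Z.of_nat L) (Z.of_nat L) - sum_Z ga (Z.of_nat L) (Z.of_nat L)))
   + - sum_Z ga (Z.of_nat L) (Z.of_nat L)
   + (sum_Z gx (Z.of_nat L) (Z.of_nat L) - sum_Z gx M N))%C by ring.
eapply Rle_trans; [apply Cmod_triangle|].
eapply Rle_trans; [apply Rplus_le_compat_r, Cmod_triangle|].
eapply Rle_trans; [apply Rplus_le_compat_r, Rplus_le_compat_r, Cmod_triangle|].
rewrite Cmod_opp.
assert (D1 : B * (h / t) / (PI * sinh (om * t)) <= c * (/ al + / be) * (h / (2 * d * sinh (om * d)))).
{ replace (B * (h / t) / (PI * sinh (om * t))) with (B * (h / (PI * (t * sinh (om * t))))) by (field; lra).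
  assert (0 < 2 * d * sinh (om * d)) by (apply Rmult_lt_0_compat; lra).
  apply Rle_trans with (c * (/ al + / be) * (h / (PI * (t * sinh (om * t))))).
  - apply Rmult_le_compat_r; [|exact HB2]. apply Rlt_le, Rdiv_lt_0_compat; lra.
  - apply Rmult_le_compat_l; [nra|]. apply Rmult_le_compat_l; [lra|]. apply Rinv_le_contravar; assumption. }
assert (D2 : 2 * t * (c * exp (- (mu * X))) * ((x - a) / (X / 2)) / PI <= 4 * t * c / mu / X).
{ assert (E := exp_neg_le mu X Hmu HX).
  assert (R1 : (x - a) / (X / 2) <= 2).
  { apply Rmult_le_reg_r with (X / 2); [lra|]. replace ((x - a) / (X / 2) * (X / 2)) with (x - a) by (field; lra).
    unfold a; lra. }
  assert (R0 : 0 <= (x - a) / (X / 2)) by (apply Rlt_le, Rdiv_lt_0_compat; unfold a; lra).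
  assert (He := exp_pos (- (mu * X))).
  assert (P1 : 0 <= 2 * t * (c * exp (- (mu * X)))) by (apply Rmult_le_pos; [lra|nra]).
  apply Rle_trans with (2 * t * (c * exp (- (mu * X))) * 2 * 1).
  - unfold Rdiv at 1. apply Rmult_le_compat; [apply Rmult_le_pos; assumption|apply Rlt_le, Rinv_0_lt_compat; lra| |].
    + apply Rmult_le_compat_l; assumption.
    + rewrite <- Rinv_1. apply Rinv_le_contravar; lra.
  - replace (4 * t * c / mu / X) with (2 * t * (c * / (mu * X)) * 2 * 1) by (field; lra).
    apply Rmult_le_compat_r; [lra|]. apply Rmult_le_compat_r; [lra|]. apply Rmult_le_compat_l; [lra|].
    apply Rmult_le_compat_l; lra. }
assert (D3 : 4 * t * c / mu / X + Q / X = W / X) by (unfold W; field; lra).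
lra.
Qed.

(* By the choice of [h], [PI / h * d = sqrt (PI * d * mu * nn)]. *)
Lemma discretization_constant (Ck d h mu nn : R) : 0 < Ck -> 0 < d -> 0 < mu -> 1 <= nn ->
  h = sqrt (PI * d / (mu * nn)) ->
  Ck * (h / (d * sinh (PI / h * d))) <=
  2 * Ck * (/ (1 - exp (- 2 * sqrt (PI * d * mu))) * sqrt (PI / (d * mu))) * exp (- sqrt (PI * d * mu * nn)).
Proof.
intros HC Hd Hmu Hn Eh. generalize PI_bounds; intros HP.
assert (Hmn : 0 < mu * nn) by (apply Rmult_lt_0_compat; lra).
assert (HPd : 0 < PI * d) by (apply Rmult_lt_0_compat; lra).
assert (Hq : 0 < PI * d / (mu * nn)) by (apply Rdiv_lt_0_compat; assumption).
assert (Hh : 0 < h) by (rewrite Eh; apply sqrt_lt_R0, Hq).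
assert (Hhh : h * h = PI * d / (mu * nn)) by (rewrite Eh; apply sqrt_sqrt; lra).
set (e0 := sqrt (PI * d * mu)). set (e := sqrt (PI * d * mu * nn)).
assert (HPm : 0 < PI * d * mu) by (apply Rmult_lt_0_compat; assumption).
assert (He0 : 0 < e0) by (apply sqrt_lt_R0, HPm).
assert (He : e0 <= e) by (apply sqrt_le_1_alt; nra).
assert (EE : PI / h * d = e).
{ unfold e. symmetry. apply sqrt_lem_1; [nra|apply Rmult_le_pos; [apply Rlt_le, Rdiv_lt_0_compat; lra|lra]|].
  replace (PI / h * d * (PI / h * d)) with (PI * d * (PI * d) / (h * h)) by (field; lra).
  rewrite Hhh. field. lra. }
rewrite EE.
assert (Hhd : h / d <= sqrt (PI / (d * mu))).
{ assert (0 < d * mu) by (apply Rmult_lt_0_compat; assumption).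
  assert (Hs : h / d * (h / d) <= PI / (d * mu)).
  { replace (h / d * (h / d)) with (PI / (d * mu) * / nn).
    - rewrite <- (Rmult_1_r (PI / (d * mu))) at 2. apply Rmult_le_compat_l; [apply Rlt_le, Rdiv_lt_0_compat; lra|].
      rewrite <- Rinv_1. apply Rinv_le_contravar; lra.
    - replace (h / d * (h / d)) with (h * h / (d * d)) by (field; lra). rewrite Hhh. field. lra. }
  rewrite <- (sqrt_square (h / d)) by (apply Rlt_le, Rdiv_lt_0_compat; lra). apply sqrt_le_1_alt, Hs. }
(* In [/ sinh e = 2 exp (- e) / (1 - exp (- 2 e))] the denominator is bounded by its value at [e0],
   that is at [nn = 1], so that the constant no longer depends on [nn]. *)
assert (Hx1 : exp (- 2 * e) <= exp (- 2 * e0)) by (apply exp_le; lra).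
assert (Hx0 : exp (- 2 * e0) < 1) by (rewrite <- exp_0; apply exp_increasing; lra).
assert (Hsh : / sinh e = 2 * exp (- e) * / (1 - exp (- 2 * e))).
{ unfold sinh. replace (- 2 * e) with (- e + - e) by ring. rewrite exp_plus.
  assert (X := exp_pos e). assert (Y := exp_pos (- e)).
  assert (XY : exp e * exp (- e) = 1) by (rewrite <- exp_plus, Rplus_opp_r; apply exp_0).
  replace (- 2 * e) with (- e + - e) in Hx1 by ring. rewrite exp_plus in Hx1.
  replace (exp e) with (/ exp (- e)) by (rewrite exp_Ropp; field; lra).
  field. repeat split; nra. }
replace (h / (d * sinh e)) with (h / d * / sinh e).
2:{ unfold Rdiv. rewrite Rinv_mult. ring. }
rewrite Hsh.
assert (Y := exp_pos (- e)).
assert (Z : / (1 - exp (- 2 * e)) <= / (1 - exp (- 2 * e0))) by (apply Rinv_le_contravar; lra).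
assert (Z0 : 0 < / (1 - exp (- 2 * e))) by (apply Rinv_0_lt_compat; lra).
replace (2 * Ck * (/ (1 - exp (- 2 * e0)) * sqrt (PI / (d * mu))) * exp (- e)) with
  (Ck * (sqrt (PI / (d * mu)) * (2 * exp (- e) * / (1 - exp (- 2 * e0))))) by ring.
apply Rmult_le_compat_l; [lra|]. apply Rmult_le_compat.
- apply Rlt_le, Rdiv_lt_0_compat; lra.
- apply Rmult_le_pos; lra.
- exact Hhd.
- apply Rmult_le_compat_l; lra.
Qed.

Theorem theorem10 (d : R) (f : C -> C) (K alpha beta : R) (n : nat) :
  0 < d < PI / 2 ->
  (* f analytic on psi(D_d) *)
  (forall zeta : C, Rabs (Im zeta) < d -> Cdiff f (csinh zeta)) ->
  0 < K -> 0 < alpha -> 0 < beta ->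
  (forall zeta : C, Rabs (Im zeta) < d -> Re zeta < 0 ->
     Cmod (f (csinh zeta)) <=
       K * Rpower (Cmod (Cplus 1 (Cmult (csinh zeta) (csinh zeta)))) (- (alpha + 1) / 2)) ->
  (forall zeta : C, Rabs (Im zeta) < d -> 0 <= Re zeta ->
     Cmod (f (csinh zeta)) <=
       K * Rpower (Cmod (Cplus 1 (Cmult (csinh zeta) (csinh zeta)))) (- (beta + 1) / 2)) ->
  (0 < n)%nat ->
  let mu := Rmin alpha beta in
  let nu := Rmax alpha beta in
  let h := sqrt (PI * d / (mu * INR n)) in
  let M : Z := if Rle_dec alpha beta then Z.of_nat n
               else Zceil (beta * INR n / alpha) in
  let N : Z := if Rle_dec alpha beta then Zceil (alpha * INR n / beta)
               else Z.of_nat n in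
  let C1 := Rpower 2 (nu + 1) * K / mu *
            (/ ((1 - exp (- 2 * sqrt (PI * d * mu))) * Rpower (cos d) nu)
               * sqrt (PI / (d * mu)) + 11 / 10) in
  forall tau : R,
    exists I : C,
      is_RInt_gen (fun t : R => f (RtoC t)) (Rbar_locally m_infty) (at_point tau) I /\
      Cmod (Cminus I (sum_Z (fun k : Z =>
                 Cmult (Cmult (f (RtoC (sinh (IZR k * h)))) (RtoC (cosh (IZR k * h))))
                       (RtoC (J (IZR k) h (arcsinh tau)))) M N))
        <= C1 * exp (- sqrt (PI * d * mu * INR n)).
Proof.
intros Hd Hf HK Hal Hbe Hl Hr Hn mu nu h M N C1 tau.
generalize PI_bounds; intros HPI.
assert (Hn1 : 1 <= INR n) by (apply (le_INR 1); lia).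
assert (Hmu : 0 < mu) by (apply Rmin_pos; assumption).
assert (Hma : mu <= alpha) by apply Rmin_l. assert (Hmb : mu <= beta) by apply Rmin_r.
assert (Hna : alpha <= nu) by apply Rmax_l. assert (Hnb : beta <= nu) by apply Rmax_r.
assert (Hmn : 0 < mu * INR n) by (apply Rmult_lt_0_compat; lra).
assert (HPd : 0 < PI * d) by (apply Rmult_lt_0_compat; lra).
assert (Hq : 0 < PI * d / (mu * INR n)) by (apply Rdiv_lt_0_compat; assumption).
assert (Hh : 0 < h) by (apply sqrt_lt_R0, Hq).
assert (Hhh : h * h = PI * d / (mu * INR n)) by (apply sqrt_sqrt; lra).
assert (Hcd : 0 < cos d) by (apply cos_gt_0; lra).
assert (Hcd1 : cos d <= 1) by apply COS_bound.
assert (Hcosy : forall y, Rabs y < d -> cos d <= cos y).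
{ intros y Hy. assert (E : cos y = cos (Rabs y)).
  { unfold Rabs. destruct (Rcase_abs y); [rewrite cos_neg|]; reflexivity. }
  rewrite E. apply cos_decr_1; generalize (Rabs_pos y); lra. }
assert (HFc : forall z : C, Rabs (Im z) < d -> cdiff (pullback f) z).
{ intros z Hz. apply cdiff_pullback, Hf, Hz. }
assert (Hfc : forall s : R, @continuous C_UniformSpace C_UniformSpace f (RtoC (sinh s))).
{ intros s. rewrite <- csinh_RtoC. apply cdiff_continuous, Cdiff_cdiff, Hf. simpl. rewrite Rabs_R0; lra. }
assert (Bl : forall kappa s y, 0 < kappa <= 1 -> kappa <= cos y -> Rabs y < d -> s < 0 ->
  Cmod (pullback f (s, y)) <= K * Rpower (2 / kappa) nu * exp (- (alpha * Rabs s))).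
{ intros kappa s y H1 H2 Hy Hs. apply decay_bound; try assumption; [lra|]. apply Hl; assumption. }
assert (Br : forall kappa s y, 0 < kappa <= 1 -> kappa <= cos y -> Rabs y < d -> 0 <= s ->
  Cmod (pullback f (s, y)) <= K * Rpower (2 / kappa) nu * exp (- (beta * Rabs s))).
{ intros kappa s y H1 H2 Hy Hs. apply decay_bound; try assumption; [lra|]. apply Hr; assumption. }
(* [c] bounds the pullback throughout the strip ([kappa = cos d]), [c0] only on the real axis
   ([kappa = 1]), where the nodes lie. *)
set (c := K * Rpower (2 / cos d) nu). set (c0 := K * Rpower 2 nu).
assert (Hp2 : 0 < Rpower 2 nu) by apply exp_pos.
assert (Hpc : 0 < Rpower (cos d) nu) by apply exp_pos.
assert (Ec : c = c0 / Rpower (cos d) nu).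
{ unfold c, c0, Rpower. rewrite ln_div by lra.
  replace (nu * (ln 2 - ln (cos d))) with (nu * ln 2 + - (nu * ln (cos d))) by ring.
  rewrite exp_plus, exp_Ropp. field. apply Rgt_not_eq, exp_pos. }
assert (Hc0 : 0 < c0) by (apply Rmult_lt_0_compat; lra).
assert (Hc : 0 < c) by (rewrite Ec; apply Rdiv_lt_0_compat; assumption).
assert (R0 : Rabs 0 < d) by (rewrite Rabs_R0; lra).
assert (Rl : forall s : R, s < 0 -> Cmod (pullback f (RtoC s)) <= c0 * exp (- (alpha * Rabs s))).
{ intros s Hs. assert (X := Bl 1 s 0 ltac:(lra) ltac:(rewrite cos_0; lra) R0 Hs). rewrite Rdiv_1_r in X. exact X. }
assert (Rr : forall s : R, 0 <= s -> Cmod (pullback f (RtoC s)) <= c0 * exp (- (beta * Rabs s))).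
{ intros s Hs. assert (X := Br 1 s 0 ltac:(lra) ltac:(rewrite cos_0; lra) R0 Hs). rewrite Rdiv_1_r in X. exact X. }
destruct (CI_limit_m_infty (fun s => pullback f (RtoC s)) c0 alpha (arcsinh tau) Hc0 Hal) as [I HI].
{ intros s. apply (continuous_hor (pullback f) s 0), cdiff_continuous, HFc. exact R0. }
{ intros s Hs. eapply Rle_trans; [apply Rl, Hs|]. rewrite Rabs_left by lra. right. f_equal. f_equal. ring. }
exists I. split; [apply is_RInt_gen_pullback; assumption|].
(* The ceiling rounds so that each tail decays at least as fast as the one with rate [mu] and [n]
   nodes. *)
assert (HM : (0 <= M)%Z /\ mu * INR n <= alpha * IZR M).
{ unfold M, mu, Rmin. destruct (Rle_dec alpha beta).
  - split; [lia|]. rewrite <- INR_IZR_INZ. lra.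
  - destruct (Zceil_bound (beta * INR n / alpha)) as [_ Hz].
    assert (0 < beta * INR n / alpha) by (apply Rdiv_lt_0_compat; nra).
    split; [apply le_IZR; lra|]. apply (Rmult_le_compat_l alpha) in Hz; [|lra].
    replace (alpha * (beta * INR n / alpha)) with (beta * INR n) in Hz by (field; lra). exact Hz. }
assert (HN : (0 <= N)%Z /\ mu * INR n <= beta * IZR N).
{ unfold N, mu, Rmin. destruct (Rle_dec alpha beta).
  - destruct (Zceil_bound (alpha * INR n / beta)) as [_ Hz].
    assert (0 < alpha * INR n / beta) by (apply Rdiv_lt_0_compat; nra).
    split; [apply le_IZR; lra|]. apply (Rmult_le_compat_l beta) in Hz; [|lra].
    replace (beta * (alpha * INR n / beta)) with (alpha * INR n) in Hz by (field; lra). exact Hz.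
  - split; [lia|]. rewrite <- INR_IZR_INZ. lra. }
destruct HM as [HM0 HM]. destruct HN as [HN0 HN].
(* The choice of [h] makes the tail exponent [mu n h] equal to the exponent [PI d / h] of the
   discretization error. *)
set (E := sqrt (PI * d * mu * INR n)).
assert (EE : mu * INR n * h = E).
{ unfold E. symmetry. apply sqrt_lem_1; [nra|nra|].
  replace (mu * INR n * h * (mu * INR n * h)) with (mu * INR n * (mu * INR n) * (h * h)) by ring.
  rewrite Hhh. field. lra. }
assert (EM : exp (- (alpha * (IZR M * h))) <= exp (- E)).
{ apply exp_le, Ropp_le_contravar. rewrite <- EE, <- Rmult_assoc. apply Rmult_le_compat_r; lra. }
assert (EN : exp (- (beta * (IZR N * h))) <= exp (- E)).
{ apply exp_le, Ropp_le_contravar. rewrite <- EE, <- Rmult_assoc. apply Rmult_le_compat_r; lra. }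
assert (T := sinc_indefinite_error (pullback f) c c0 alpha beta d h (PI / h) (arcsinh tau) M N I Hh
  ltac:(field; lra) (proj1 Hd) Hc Hc0 Hal Hbe HFc
  ltac:(intros s y Hy Hs; apply Bl; auto; lra) ltac:(intros s y Hy Hs; apply Br; auto; lra) Rl Rr HI HM0 HN0).
rewrite (sum_Z_ext _ (fun k => pullback f (RtoC (IZR k * h)) * RtoC (J (IZR k) h (arcsinh tau)))%C).
2:{ intros k. unfold pullback. rewrite csinh_RtoC, ccosh_RtoC. reflexivity. }
eapply Rle_trans; [exact T|]. clear T.
(* This factor 2 turns [2^nu] into the [2^(nu + 1)] of [C1], in both terms. *)
assert (Hinv : / alpha + / beta <= 2 / mu).
{ assert (/ alpha <= / mu) by (apply Rinv_le_contravar; assumption).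
  assert (/ beta <= / mu) by (apply Rinv_le_contravar; assumption). lra. }
assert (Hsh : 0 < sinh (PI / h * d)).
{ apply sinh_pos, Rmult_lt_0_compat; [apply Rdiv_lt_0_compat; lra|lra]. }
assert (T1 := discretization_constant (c / mu) d h mu (INR n) ltac:(apply Rdiv_lt_0_compat; lra)
  (proj1 Hd) Hmu Hn1 eq_refl).
assert (T1' : c * (/ alpha + / beta) * (h / (2 * d * sinh (PI / h * d))) <= c / mu * (h / (d * sinh (PI / h * d)))).
{ replace (c / mu * (h / (d * sinh (PI / h * d)))) with (c * (2 / mu) * (h / (2 * d * sinh (PI / h * d)))) by (field; lra).
  apply Rmult_le_compat_r.
  - apply Rlt_le, Rdiv_lt_0_compat; [exact Hh|]. apply Rmult_lt_0_compat; lra.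
  - apply Rmult_le_compat_l; lra. }
assert (T2 : 11 / 10 * c0 * (exp (- (alpha * (IZR M * h))) / alpha + exp (- (beta * (IZR N * h))) / beta) <=
  2 * (11 / 10) * c0 / mu * exp (- E)).
{ assert (Y := exp_pos (- E)).
  assert (Ia := Rinv_0_lt_compat _ Hal). assert (Ib := Rinv_0_lt_compat _ Hbe).
  replace (2 * (11 / 10) * c0 / mu * exp (- E)) with (11 / 10 * c0 * (exp (- E) * (2 / mu))) by (field; lra).
  apply Rmult_le_compat_l; [lra|].
  apply Rle_trans with (exp (- E) * (/ alpha + / beta)).
  - rewrite Rmult_plus_distr_l. apply Rplus_le_compat; apply Rmult_le_compat_r; lra.
  - apply Rmult_le_compat_l; lra. }
eapply Rle_trans; [apply Rplus_le_compat; [eapply Rle_trans; [exact T1'|exact T1]|exact T2]|].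
right. unfold C1. fold E. rewrite Rpower_plus, Rpower_1 by lra. rewrite Ec. unfold c0.
rewrite Rinv_mult. field.
assert (Hx0 : exp (- 2 * sqrt (PI * d * mu)) < 1).
{ rewrite <- exp_0. apply exp_increasing.
  assert (0 < sqrt (PI * d * mu)) by (apply sqrt_lt_R0, Rmult_lt_0_compat; assumption). lra. }
repeat split; lra.
Qed.
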